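(* For each $\beta\in\mathbb{R}$, each $(\theta_1,\theta_2)\in(0,1)^2$, and each $(t_{11},t_{12},t_{21},t_{22})\in\Sigma_4$, $$\min\{\mathcal{I}_\beta(\nu)\,:\,\nu\in W_{\theta_1,\theta_2}(t_{11},t_{12},t_{21},t_{22})\}=\widetilde{\Phi}_\beta(\theta_1,\theta_2;t_{11},t_{12},t_{21},t_{22}),$$ where $$\begin{aligned}\widetilde{\Phi}_\beta(\theta_1,\theta_2;t_{11},t_{12},t_{21},t_{22}) :=\;& p(\beta)+\sum_{i,j=1}^2 t_{ij}\ln\left(\frac{t_{ij}}{|\Lambda_{ij}|}\right)+\sum_{i,j=1}^2 t_{ij}\,p(\beta t_{ij})\\ &-(t_{11}+t_{12})\,p(\beta(t_{11}+t_{12}))-(t_{11}+t_{21})\,p(\beta(t_{11}+t_{21}))\\ &-(t_{12}+t_{22})\,p(\beta(t_{12}+t_{22}))-(t_{21}+t_{22})\,p(\beta(t_{21}+t_{22}))+\beta t_{12}t_{21}.\end{aligned}$$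
   Context: $\mathcal{M}_{+,1}([0,1]^2)$ is the set of Borel probability measures on $[0,1]^2$. $\lambda$ is Lebesgue measure on $[0,1]$, and $\lambda^{\otimes 2}$ is Lebesgue measure on $[0,1]^2$. Relative entropy (negative of the Kullback–Leibler divergence): $S(\mu|\nu)=-\int\ln\left(\frac{d\mu}{d\nu}\right)d\mu$ if $\mu\ll\nu$, and $S(\mu|\nu)=-\infty$ otherwise. Energy: $\mathcal{E}(\nu)=\frac12\int_{[0,1]^2}\int_{[0,1]^2}h((x_1,y_1),(x_2,y_2))\,d\nu(x_1,y_1)\,d\nu(x_2,y_2)$, where $h((x_1,y_1),(x_2,y_2))=1$ if $(x_1-x_2)(y_1-y_2)<0$ and $0$ otherwise. Pressure: $p(\beta)=\int_0^1\ln\left(\frac{1-e^{-\beta x}}{\beta x}\right)dx$ for $\beta\in\mathbb{R}$, with the continuous extension $p(0)=0$. Rate function: $\mathcal{I}_\beta(\nu)=-S(\nu|\lambda^{\otimes 2})+\beta\mathcal{E}(\nu)+p(\beta)\in\mathbb{R}\cup\{+\infty\}$. $L_1(\theta)=[0,\theta]$, $L_2(\theta)=(\theta,1]$, and $\Lambda_{ij}=\Lambda_{ij}(\theta_1,\theta_2)=L_i(\theta_1)\times L_j(\theta_2)$ for $i,j\in\{1,2\}$; $|\Lambda_{ij}|=\lambda^{\otimes2}(\Lambda_{ij})$. $\Sigma_4=\{(t_{11},t_{12},t_{21},t_{22})\in[0,1]^4: t_{11}+t_{12}+t_{21}+t_{22}=1\}$. $W_{\theta_1,\theta_2}(t_{11},t_{12},t_{21},t_{22})=\{\nu\in\mathcal{M}_{+,1}([0,1]^2):\nu(\Lambda_{ij}(\theta_1,\theta_2))=t_{ij}\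 \forall i,j\in\{1,2\}\}$. Convention: $0\ln 0=0$. *)

(* Defs.v *)
From HB Require Import structures.
From mathcomp Require Import all_boot all_order all_algebra.
From mathcomp Require Import all_classical all_reals all_analysis.

Set Implicit Arguments.
Unset Strict Implicit.
Unset Printing Implicit Defensive.

Import Order.TTheory GRing.Theory Num.Theory.
Import numFieldNormedType.Exports.

Local Open Scope classical_set_scope.
Local Open Scope charge_scope.
Local Open Scope ring_scope.

Definition unit_square {R : realType} : set (R * R) := `[0, 1]%classic `*` `[0, 1]%classic.

(* Lebesgue measure on [0, 1], as a measure on R vanishing off [0, 1]. *)
Definition lambda {R : realType} : set (measurableTypeR R) -> \bar R :=
  mrestr lebesgue_measure (measurable_itv `[0%R, 1%R]).

HB.instance Definition _ (R : realType) := Measure.on (@lambda R).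

Lemma lambda_setT (R : realType) : @lambda R [set: R] = 1%E.
Proof.
by rewrite /lambda /mrestr setTI lebesgue_measure_itv/= lte_fin ltr01 oppr0 adde0.
Qed.

HB.instance Definition _ (R : realType) :=
  Measure_isProbability.Build _ _ _ (@lambda R) (@lambda_setT R).

Definition lambda2 {R : realType} :
    probability (measurableTypeR R * measurableTypeR R)%type R :=
  (lambda \x lambda)%E.

(* The negative of the Kullback-Leibler divergence.  When mu `<< nu the
   negative part of the integrand is mu-integrable, so the integral is
   well defined in ]-oo, +oo]. *)
Definition rel_entropy d (T : measurableType d) (R : realType)
    (mu : probability T R) (nu : {sigma_finite_measure set T -> \bar R}) :
    \bar R :=
  if `[< mu `<< nu >]
  then (- \int[mu]_x lne (('d (charge_of_finite_measure mu) '/d nu) x))%E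
  else -oo%E.

(* A Borel probability measure on [0, 1]^2 is represented by a Borel
   probability measure nu on R * R with nu [0, 1]^2 = 1. *)
Notation prob2 R := 
  (probability (measurableTypeR R * measurableTypeR R)%type R).

Definition on_unit_square {R : realType} : set (prob2 R) :=
  [set nu | nu unit_square = 1%E].

Definition inv_kernel {R : realType} (p q : R * R) : R :=
  if (p.1 - q.1) * (p.2 - q.2) < 0 then 1 else 0.

Definition energy {R : realType} (nu : prob2 R) : \bar R :=
  ((2^-1)%:E * \int[nu]_(q in unit_square) \int[nu]_(p in unit_square)
    (inv_kernel p q)%:E)%E.

Definition pressure {R : realType} (beta : R) : R :=
  if beta == 0 then 0 else
  \int[lebesgue_measure]_(x in `[0, 1])
    ln ((1 - expR (- (beta * x))) / (beta * x)).

Definition rate {R : realType} (beta : R) (nu : prob2 R) : \bar R :=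
  (- rel_entropy nu lambda2 + beta%:E * energy nu + (pressure beta)%:E)%E.

(* The indices 1, 2 of the four blocks are the elements 0, 1 of 'I_2; in
   particular (t_11, t_12, t_21, t_22) is the 2 x 2 matrix t with t_11 = t 0 0,
   t_12 = t 0 1, t_21 = t 1 0, t_22 = t 1 1. *)
Definition Lpart {R : realType} (i : 'I_2) (theta : R) : set R :=
  if i == 0 then `[0, theta]%classic else `]theta, 1]%classic.

Definition Lambda {R : realType} (theta1 theta2 : R) (i j : 'I_2) :
    set (R * R) :=
  Lpart i theta1 `*` Lpart j theta2.

Definition area {R : realType} (A : set (R * R)) : R := fine (lambda2 A).

Definition Sigma4 {R : realType} : set 'M[R]_2 :=
  [set t | (forall i j, 0 <= t i j <= 1) /\ \sum_i \sum_j t i j = 1].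

Definition W {R : realType} (theta1 theta2 : R) (t : 'M[R]_2) :
    set (prob2 R) :=
  [set nu | on_unit_square nu /\
    forall i j, nu (Lambda theta1 theta2 i j) = (t i j)%:E].

(* The convention 0 ln 0 = 0 holds because a product with 0 is 0. *)
Definition Phi {R : realType} (beta theta1 theta2 : R) (t : 'M[R]_2) : R :=
  let t11 := t 0 0 in let t12 := t 0 1 in
  let t21 := t 1 0 in let t22 := t 1 1 in
  let p := @pressure R in
  p beta
  + \sum_i \sum_j t i j * ln (t i j / area (Lambda theta1 theta2 i j))
  + \sum_i \sum_j t i j * p (beta * t i j)
  - (t11 + t12) * p (beta * (t11 + t12))
  - (t11 + t21) * p (beta * (t11 + t21))
  - (t12 + t22) * p (beta * (t12 + t22))
  - (t21 + t22) * p (beta * (t21 + t22))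
  + beta * t12 * t21.

Definition is_min {R : realType} (A : set \bar R) (m : \bar R) : Prop :=
  A m /\ lbound A m.

(* Main.v *)
(* Let [x] = (1 - e^(-beta x)) / beta, F x = x p(beta x) and G x = x ln x + F x;
   then F' = ln ([x] / x), hence G' = 1 + ln [x].  The addition formula
   e^(-beta y) [x] + [y] = [x + y] and the log-sum inequality show that
   (s, t) |-> G s + G t - G (s + t) is a subsolution of the Hamilton-Jacobi
   equation for the cost, entropy plus beta times the number of inversions, of
   a monotone path from (0, 0) to (s, t).

   Lower bound: on a fine grid adapted to the blocks, coarse-graining does not
   increase the negative of the entropy, and it changes the energy by at most
   the sum of the squares of the masses of the grid lines, which vanishes with
   the mesh when nu << lambda^2.  Merging the grid columns of a vertical strip
   one at a time, and then the two strips inside each horizontal strip, each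
   time by the subsolution inequality, gives Phi.

   Upper bound: in the second coordinate the masses of the two vertical strips
   follow, in each horizontal strip, a path along which the Hamilton-Jacobi
   inequality is an equality.  Given these two marginals, the law in a vertical
   strip of mass m has the distribution function
   N(u, v) = - ln (1 - beta [u] [v] / [m]) / beta, u and v being the two
   marginal distribution functions.  Since
   ln (d^2 N / du dv) = - ln [m] - beta (u + v - 2 N), the rate of this measure
   has an explicit primitive in each variable. *)
From HB Require Import structures.
Require Import Defs.
From mathcomp Require Import all_boot all_order all_algebra.
From mathcomp Require Import all_classical all_reals all_analysis.
From mathcomp Require Import ring lra measurable_realfun.

Set Implicit Arguments.
Unset Strict Implicit.
Unset Printing Implicit Defensive.

Import Order.TTheory GRing.Theory Num.Theory.
Import numFieldNormedType.Exports.

Local Open Scope classical_set_scope.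
Local Open Scope ring_scope.

(** * Entropy and pressure functions *)

Section real_integrals.
Context {R : realType}.
Implicit Types f F : R -> R.

(** The minimizer is read off from the equality cases of the lower bound. Equality in [sum_xl_ge],
    used once for widths and once for heights, means a uniform first marginal in each vertical strip
    and a uniform second marginal in each horizontal strip. Equality in [Gent_HJ] prescribes the
    ratio of the speeds at which the two strip masses grow, a differential equation that [path1] and
    [path2] solve in closed form. Attainment is thus a computation with an explicit density, with no
    compactness argument. Two obstacles shape the development. Points on a common grid line have no
    determined order; such ties are charged [|beta|] times squares of line masses, so that the sign
    of [beta] never enters. Moreover blocks and strips may have mass 0, where [m] = 0 and the
    derivative of G is infinite. Hence derivatives are taken on open intervals with mere continuity
    at the ends, hypotheses have the form [b != 0 -> 0 < m], and degenerate cases are split off. *)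

Lemma integral_is_derive f F (a b : R) : a <= b ->
  (forall x, x \in `]a, b[ -> is_derive x (1 : R) F (f x)) ->
  {within `[a, b], continuous F} -> {within `[a, b], continuous f} ->
  (\int[lebesgue_measure]_(x in `[a, b]) (f x)%:E)%E = (F b - F a)%:E.
Proof.
rewrite le_eqVlt => /predU1P[-> _ _ _|ab dF cF cf].
  by rewrite set_itv1 integral_set1 subrr.
have [cFo cFa cFb] := (continuous_within_itvP F ab).1 cF.
rewrite (@continuous_FTC2 _ f F)//.
- by split => // x /dF[].
- by move=> x /dF dFx; rewrite derive1E derive_val.
Qed.

End real_integrals.

Section scalar_functions.
Context {R : realType}.
Variable beta : R.

(** At [beta * z = 0] the conventions [0^-1 = 0] and [ln 0 = 0] give the value 0, which is the
    continuous extension, both at [z = 0] and for [beta = 0]. *)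
Definition phi (z : R) : R := ln ((1 - expR (- (beta * z))) / (beta * z)).

Lemma phi0 : phi 0 = 0.
Proof. by rewrite /phi mulr0 invr0 mulr0 ln0. Qed.

(** Both sides come from [1 + u <= expR u], used at [u] and at [- u]. The crude exponential form is
    chosen because its logarithm is the linear bound [phi_bound]. *)
Lemma ratio_bounds (u : R) : u != 0 ->
  expR (- `|u|) <= (1 - expR (- u)) / u <= expR `|u|.
Proof.
move=> u0.
have h1 : 1 - expR (- u) <= u by have := expR_ge1Dx (- u); lra.
have h2 : u * expR (- u) <= 1 - expR (- u).
  have h : 1 + u <= expR u := expR_ge1Dx u.
  have e : expR u * expR (- u) = 1 by rewrite -expRD subrr expR0.
  have e0 : 0 < expR (- u) := expR_gt0 _.
  by have := ler_wpM2r (ltW e0) h; rewrite e; lra.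
case: (ltrP 0 u) => [up|um].
- rewrite gtr0_norm//; apply/andP; split.
    by rewrite ler_pdivlMr// mulrC.
  rewrite ler_pdivrMr//; apply: (le_trans h1).
  by rewrite ler_peMl ?(ltW up)// -expR0 ler_expR ltW.
- have un : u < 0 by rewrite lt_neqAle u0.
  rewrite ltr0_norm// opprK; apply/andP; split.
    rewrite ler_ndivlMr//; apply: (le_trans h1).
    by have := ler_wnM2r um (_ : expR u <= 1); rewrite mul1r; apply; rewrite -expR0 ler_expR.
  by rewrite ler_ndivrMr// mulrC.
Qed.

Lemma ratio_gt0 (u : R) : u != 0 -> 0 < (1 - expR (- u)) / u.
Proof.
by move=> /ratio_bounds /andP[+ _]; apply: lt_le_trans; exact: expR_gt0.
Qed.

Lemma phi_bound z : `|phi z| <= `|beta * z|.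
Proof.
rewrite /phi; have [->|u0] := eqVneq (beta * z) 0.
  by rewrite invr0 mulr0 ln0// normr0.
have /andP[l u] := ratio_bounds u0.
rewrite ler_norml; apply/andP; split.
  by rewrite -[leLHS]expRK ler_ln ?posrE ?expR_gt0 ?ratio_gt0.
by rewrite -[leRHS]expRK ler_ln ?posrE ?expR_gt0 ?ratio_gt0.
Qed.

Lemma continuous_phi : continuous phi.
Proof.
move=> z; have [->|z0] := eqVneq z 0.
  have c0 : (fun x => `|beta * x|) @ (0 : R) --> (0 : R).
    rewrite -[X in _ --> X](normr0 R) -[X in `|X|](mulr0 beta).
    by apply: cvg_norm; apply: cvgM; [exact: cvg_cst|exact: cvg_id].
  rewrite /continuous_at phi0; apply/cvgr0Pnorm_le => e e0; near=> x.
  apply: (le_trans (phi_bound x)).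
  have : `| `|beta * x| | <= e.
    by near: x; move/cvgr0Pnorm_le : c0 => /(_ e e0); exact.
  by rewrite normr_id.
have [b0|b0] := eqVneq beta 0.
  have -> : phi = cst 0 by apply/funext => x; rewrite /phi b0 mul0r invr0 mulr0 ln0.
  exact: cvg_cst.
have u0 : beta * z != 0 by rewrite mulf_neq0.
apply: continuous_comp; last first.
  by apply: continuous_ln; exact: ratio_gt0.
have cbz : {for z, continuous (fun x => beta * x)}.
  by apply: cvgM; [exact: cvg_cst|exact: cvg_id].
apply: cvgM; last exact: cvgV.
apply: cvgB; first exact: cvg_cst.
by apply: continuous_comp; [exact: cvgN|exact: continuous_expR].
Unshelve. all: by end_near. Qed.

Lemma continuousW_phi (A : set R) : {within A, continuous phi}.
Proof. by apply: continuous_subspaceT; exact: continuous_phi. Qed.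

(** The base point -1 makes 0 an interior point, so that [Fpress] gets a two-sided derivative at 0
    as well. *)
Lemma primitive_phi : exists Gam : R -> R,
  forall x : R, -1 < x -> is_derive x (1 : R) Gam (phi x).
Proof.
exists (fun x => \int[lebesgue_measure]_(t in `[-1, x]) phi t) => x x1.
have xx1 : x < x + 1 by rewrite ltrDl.
have intphi : lebesgue_measure.-integrable `[-1, (x + 1)] (EFin \o phi).
  apply: continuous_compact_integrable; first exact: segment_compact.
  exact: continuousW_phi.
have [d1 d2] := continuous_FTC1_closed xx1 intphi x1 (@continuous_phi x).
by apply: DeriveDef; [exact: d1|rewrite -derive1E; exact: d2].
Qed.

Definition Fpress (m : R) : R := m * pressure (beta * m).

Lemma Fpress0 : Fpress 0 = 0. Proof. by rewrite /Fpress mul0r. Qed.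

(** The substitution [z = m x] turns [m] times the integral in [pressure (beta * m)] into the
    integral of [phi] from 0 to [m]. The value 0 prescribed for [beta * m = 0] agrees with it: there
    [m = 0], or [beta = 0] and [phi] vanishes identically. *)
Lemma Fpress_primitive (Gam : R -> R) (m : R) :
  (forall x : R, -1 < x -> is_derive x (1 : R) Gam (phi x)) ->
  -1 < m -> Fpress m = Gam m - Gam 0.
Proof.
move=> dG m1; rewrite /Fpress /pressure; case: ifPn => [bm0|bm0].
  rewrite mulr0.
  have [->|m0] := eqVneq m 0; first by rewrite subrr.
  have b0 : beta = 0 by apply/eqP; move: bm0; rewrite mulf_eq0 (negbTE m0) orbF.
  have phi00 x : phi x = 0 by rewrite /phi b0 mul0r invr0 mulr0 ln0.
  have cG (a b : R) : -1 < a -> {within `[a, b], continuous Gam}.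
    move=> a1; apply: continuous_in_subspaceT => x; rewrite inE/= in_itv/= => /andP[ax _].
    have [dx _] := dG _ (lt_le_trans a1 ax).
    by apply: differentiable_continuous; apply/derivable1_diffP.
  have [m0'|m0'] := leP 0 m.
    have N1 : -1 < 0 :> R by lra.
    have dGx (x : R) : x \in `]0, m[ -> is_derive x (1 : R) Gam (phi x).
      by rewrite in_itv/= => /andP[x0 _]; apply: dG; lra.
    by have [c _ ->] := MVT_segment m0' dGx (cG _ _ N1); rewrite phi00 mul0r.
  have dGx (x : R) : x \in `]m, 0[ -> is_derive x (1 : R) Gam (phi x).
    by rewrite in_itv/= => /andP[x0 _]; apply: dG; lra.
  have [c _] := MVT_segment (ltW m0') dGx (cG _ _ m1).
  by rewrite phi00 mul0r; lra.
pose psi x := Gam (m * x).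
have mx1 (x : R) : 0 <= x <= 1 -> -1 < m * x.
  move=> /andP[x0 x1]; have [m0|m0] := leP 0 m.
    by apply: lt_le_trans (mulr_ge0 m0 x0); lra.
  by have := ler_wnM2l (ltW m0) x1; rewrite mulr1; exact: lt_le_trans.
have dpsi (x : R) : 0 <= x <= 1 -> is_derive x (1 : R) psi (m * phi (m * x)).
  move=> x01.
  rewrite /psi; have := dG _ (mx1 _ x01) => dGx.
  have dm : is_derive x (1 : R) ( *%R m : R -> R) m.
    by have := is_deriveZ m (is_derive_id x (1:R)); rewrite /GRing.scale/= mulr1.
  by have := is_derive1_comp dGx dm; rewrite mulrC.
have cps : {within `[0, 1], continuous psi}.
  apply: continuous_in_subspaceT => x; rewrite inE/= in_itv/= => x01.
  have [dx _] := dpsi _ x01.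
  by apply: differentiable_continuous; apply/derivable1_diffP.
have cf : continuous (fun x => m * phi (m * x)).
  move=> x; apply: cvgM; first exact: cvg_cst.
  apply: continuous_comp; last exact: continuous_phi.
  by apply: cvgM; [exact: cvg_cst|exact: cvg_id].
have dpsi' (x : R) : x \in `]0, 1[ -> is_derive x (1 : R) psi (m * phi (m * x)).
  by rewrite in_itv/= => /andP[x0 x1]; apply: dpsi; rewrite !ltW.
have E := integral_is_derive ler01 dpsi' cps (continuous_subspaceT cf).
rewrite -RintegralZl//; last first.
  apply: continuous_compact_integrable; first exact: segment_compact.
  apply: continuous_subspaceT => x.
  rewrite (_ : (fun x0 : R => _) = phi \o ( *%R m)); last first.
    by apply/funext => y; rewrite /phi/= !mulrA.
  apply: continuous_comp; last exact: continuous_phi.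
  by apply: cvgM; [exact: cvg_cst|exact: cvg_id].
rewrite /Rintegral.
under eq_integral do rewrite -mulrA -/(phi _).
by rewrite E /= /psi mulr1 mulr0.
Qed.

Lemma is_derive_Fpress (m : R) : -1 < m -> is_derive m (1 : R) Fpress (phi m).
Proof.
have [Gam dG] := primitive_phi => m1.
have := is_deriveB (dG _ m1) (is_derive_cst (Gam 0) m (1 : R)).
rewrite subr0; apply: near_eq_is_derive.
near=> x; rewrite (Fpress_primitive dG)//.
by near: x; exact: lt_nbhsr.
Unshelve. all: by end_near. Qed.

End scalar_functions.

Section entropy_functions.
Context {R : realType}.

(** As [ln] is 0 on nonpositive numbers, [xl] vanishes there and is continuous on the whole line. *)
Definition xl (x : R) : R := x * ln x.

Lemma xl0 : xl 0 = 0. Proof. by rewrite /xl mul0r. Qed.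

Lemma xl_le0 (x : R) : x <= 0 -> xl x = 0.
Proof. by move=> x0; rewrite /xl ln0// mulr0. Qed.

(** For [x = s ^+ 2] one has [- x ln x = 2 s^2 ln (1/s)], and [ln (1/s) < 1/s]. This gives
    continuity at 0. *)
Lemma xl_bound (x : R) : x <= 1 -> `|xl x| <= 2 * Num.sqrt x.
Proof.
move=> x1; have [x0|x0] := leP x 0.
  by rewrite xl_le0// normr0 mulr_ge0// sqrtr_ge0.
rewrite /xl normrM gtr0_norm// ler0_norm ?ln_le0//.
set s := Num.sqrt x; have s0 : 0 < s by rewrite sqrtr_gt0.
have xE : x = s ^+ 2 by rewrite sqr_sqrtr// ltW.
rewrite [in ln _]xE lnXn//.
have h : ln s^-1 < s^-1 by apply: ln_sublinear; rewrite invr_gt0.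
rewrite lnV ?posrE// in h.
have : s ^+ 2 * - ln s <= s ^+ 2 * s^-1 by rewrite ler_pM2l ?exprn_gt0// ltW.
by rewrite expr2 mulfK ?gt_eqF// xE expr2; lra.
Qed.

Lemma continuous_xl : continuous xl.
Proof.
move=> x; have [x0|x0|->] := ltgtP x 0.
- have : xl y @[y --> x] --> (0 : R).
    apply: (@cvg_near_cst _ _ _ xl) => //=.
    by near=> y; apply/xl_le0/ltW; near: y; exact: lt_nbhsl.
  by rewrite /continuous_at (xl_le0 (ltW x0)).
- by apply: cvgM; [exact: cvg_id|exact: continuous_ln].
have c0 : 2 * Num.sqrt z @[z --> (0 : R)] --> (0 : R).
  rewrite -[X in _ --> X](mulr0 (2 : R)) -[X in _ --> (_ * X : R)](@sqrtr0 R).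
  by apply: cvgM; [exact: cvg_cst|exact: sqrt_continuous].
rewrite /continuous_at xl0; apply/cvgr0Pnorm_le => e e0; near=> y.
have y1 : y <= 1 by apply: ltW; near: y; exact: lt_nbhsl.
apply: (le_trans (xl_bound y1)).
apply: (le_trans (ler_norm _)).
by near: y; move/cvgr0Pnorm_le : c0 => /(_ e e0); exact.
Unshelve. all: by end_near. Qed.

(** The tangent inequality [ln r <= r - 1] at [r = w / a], multiplied by [a]. The log-sum
    inequalities below reduce to it. *)
Lemma gibbs (a w : R) : 0 <= a -> 0 < w -> a * ln w - xl a <= w - a.
Proof.
rewrite le_eqVlt => /predU1P[<- w0|a0 w0]; first by rewrite mul0r xl0; lra.
have h : ln (w / a) <= w / a - 1.
  have := @le_ln1Dx R (w / a - 1); rewrite [1 + _]addrC subrK; apply.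
  by have := divr_gt0 w0 a0; lra.
rewrite ln_div ?posrE// in h.
have := ler_wpM2l (ltW a0) h.
have -> : a * (w / a - 1) = w - a by field; rewrite gt_eqF.
by rewrite mulrBr.
Qed.

(** [gibbs] with the weights [(a + b) p] and [(a + b) q]: its linear terms cancel because
    [p + q = 1]. *)
Lemma log_sum (a b p q : R) : 0 <= a -> 0 <= b -> 0 < p -> 0 < q -> p + q = 1 ->
  a * ln p + b * ln q <= xl a + xl b - xl (a + b).
Proof.
move=> a0 b0 p0 q0 pq.
have [c0|c0] := eqVneq (a + b) 0.
  have [-> ->] : a = 0 /\ b = 0 by lra.
  by rewrite !addr0 !mul0r xl0; lra.
have {c0}c0 : 0 < a + b by lra.
have h1 := gibbs a0 (mulr_gt0 c0 p0); have h2 := gibbs b0 (mulr_gt0 c0 q0).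
rewrite !lnM ?posrE// in h1 h2.
have -> : xl (a + b) = a * ln (a + b) + b * ln (a + b) by rewrite /xl mulrDl.
have : (a + b) * p + (a + b) * q = a + b by rewrite -mulrDr pq mulr1.
lra.
Qed.

End entropy_functions.

(** * The bracket, the function G and its Hamilton-Jacobi inequality *)

Section q_entropy.
Context {R : realType}.
Variable beta : R.

(* The q-number [z] with q = e^(-beta), rescaled so that [z] -> z as beta -> 0. *)
Definition brk (z : R) : R :=
  if beta == 0 then z else (1 - expR (- (beta * z))) / beta.

Lemma brk_ratio (z : R) : z != 0 -> brk z = z * expR (phi beta z).
Proof.
move=> z0; rewrite /brk /phi; have [->|b0] := eqVneq beta 0.
  by rewrite !mul0r invr0 mulr0 ln0// expR0 mulr1.
rewrite lnK ?posrE; last by rewrite ratio_gt0// mulf_neq0.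
by field; rewrite b0 z0.
Qed.

Lemma brk_gt0 (z : R) : 0 < z -> 0 < brk z.
Proof. by move=> z0; rewrite brk_ratio ?gt_eqF// mulr_gt0// expR_gt0. Qed.

Lemma brk0 : brk 0 = 0.
Proof. by rewrite /brk mulr0 oppr0 expR0 subrr mul0r if_same. Qed.

Lemma brkD (x y : R) : expR (- (beta * y)) * brk x + brk y = brk (x + y).
Proof.
rewrite /brk; have [->|b0] := eqVneq beta 0.
  by rewrite mul0r oppr0 expR0 mul1r.
by rewrite mulrDr opprD expRD; field.
Qed.

Lemma brk_ge0 (z : R) : 0 <= z -> 0 <= brk z.
Proof. by rewrite le_eqVlt => /predU1P[<-|/brk_gt0/ltW//]; rewrite brk0. Qed.

Lemma phi_brk (z : R) : 0 < z -> phi beta z = ln (brk z) - ln z.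
Proof.
move=> z0; rewrite brk_ratio ?gt_eqF// lnM ?posrE ?expR_gt0// expRK; lra.
Qed.

(** The G of the overview, [Fpress] being its F and [brk] its bracket. *)
Definition Gent (x : R) : R := xl x + Fpress beta x.

Lemma Gent0 : Gent 0 = 0. Proof. by rewrite /Gent xl0 Fpress0 addr0. Qed.

Lemma is_derive_Gent (x : R) : 0 < x ->
  is_derive x (1 : R) Gent (1 + ln (brk x)).
Proof.
move=> x0.
have d1 := is_deriveM (is_derive_id x (1 : R)) (is_derive1_ln x0).
have x1 : -1 < x by lra.
apply: (is_derive_eq (is_deriveD d1 (is_derive_Fpress beta x1))).
by rewrite /GRing.scale/= mulr1 divff ?gt_eqF// phi_brk//; lra.
Qed.

Lemma continuous_Fpress (x : R) : 0 <= x -> {for x, continuous (Fpress beta)}.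
Proof.
move=> x0; have x1 : -1 < x by lra.
have [dx _] := is_derive_Fpress beta x1.
by apply: differentiable_continuous; apply/derivable1_diffP.
Qed.

Lemma continuous_Gent (x : R) : 0 <= x -> {for x, continuous Gent}.
Proof.
by move=> x0; apply: cvgD; [exact: continuous_xl|exact: continuous_Fpress].
Qed.

Lemma continuous_affine (A a : R) : continuous (fun r : R => A + r * a).
Proof.
by move=> r; apply: cvgD; [exact: cvg_cst|apply: cvgM; [exact: cvg_id|exact: cvg_cst]].
Qed.

Lemma is_derive_affine (A a r : R) : is_derive r (1 : R) (fun r : R => A + r * a) a.
Proof.
have d := is_deriveD (is_derive_cst A r (1 : R))
  (is_deriveM (is_derive_id r (1 : R)) (is_derive_cst a r (1 : R))).
by apply: (is_derive_eq d); rewrite /GRing.scale/= mulr0 mulr1 !add0r.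
Qed.

Lemma continuous_Gent_affine (A a r : R) : 0 <= A + r * a ->
  {for r, continuous (fun r : R => Gent (A + r * a))}.
Proof.
move=> h; apply: continuous_comp; first exact: continuous_affine.
exact: continuous_Gent.
Qed.

Lemma is_derive_Gent_affine (A a r : R) : 0 < A + r * a ->
  is_derive r (1 : R) (fun r : R => Gent (A + r * a)) (a * (1 + ln (brk (A + r * a)))).
Proof.
move=> h; rewrite mulrC.
by have d := @is_derive1_comp _ Gent (fun r : R => A + r * a) _ _ _ (is_derive_Gent h) (is_derive_affine A a r); apply: (is_derive_eq d).
Qed.

(* Hamilton-Jacobi inequality for the value function G s + G t - G (s + t). *)
Lemma Gent_HJ (A B a b : R) : 0 < A -> 0 < B -> 0 <= a -> 0 <= b ->
  a * (1 + ln (brk A)) + b * (1 + ln (brk B)) - (a + b) * (1 + ln (brk (A + B)))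
  <= xl a + xl b - xl (a + b) + beta * (B * a).
Proof.
move=> A0 B0 a0 b0.
have pA := brk_gt0 A0; have pB := brk_gt0 B0.
have pC : 0 < brk (A + B) by rewrite brk_gt0// addr_gt0.
(* The addition formula [brkD] says exactly that these weights sum to 1. Equality in [log_sum]
   requires [a : b = p : q]. *)
pose p := expR (- (beta * B)) * brk A / brk (A + B).
pose q := brk B / brk (A + B).
have p0 : 0 < p by rewrite divr_gt0// mulr_gt0// expR_gt0.
have q0 : 0 < q by rewrite divr_gt0.
have pq : p + q = 1 by rewrite /p /q -mulrDl brkD divff// gt_eqF.
have := log_sum a0 b0 p0 q0 pq.
rewrite /p /q !ln_div ?posrE ?mulr_gt0 ?expR_gt0// lnM ?posrE ?expR_gt0// expRK.
lra.
Qed.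

(** [Gent_HJ] is integrated along the segment from [(A, B)] to [(A + a, B + b)]. At time [r] the
    second mass is [B + r b], so the energy integrates to [B a + a b / 2]: half of the tied pairs
    count as inverted. *)
Lemma Gent_step (A B a b : R) : 0 <= A -> 0 <= B -> 0 <= a -> 0 <= b ->
  Gent (A + a) + Gent (B + b) - Gent (A + B + (a + b))
  - (Gent A + Gent B - Gent (A + B))
  <= xl a + xl b - xl (a + b) + beta * (B * a + a * b / 2).
Proof.
move=> A0 B0 a0 b0.
have [Aa|Aa] := eqVneq (A + a) 0.
  have [-> ->] : A = 0 /\ a = 0 by lra.
  by rewrite !add0r Gent0 xl0; lra.
have [Bb|Bb] := eqVneq (B + b) 0.
  have [-> ->] : B = 0 /\ b = 0 by lra.
  by rewrite !addr0 Gent0 xl0; lra.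
pose K := xl a + xl b - xl (a + b).
(* The value function minus the claimed cost up to time [r]. The quadratic term has derivative
   [beta r a b], the growth of the energy rate along the segment. *)
pose f r := Gent (A + r * a) + Gent (B + r * b) - Gent (A + B + r * (a + b))
  - (0 + r * (K + beta * (B * a))) - beta * (a * b / 2) * r ^+ 2.
pose df r := a * (1 + ln (brk (A + r * a))) + b * (1 + ln (brk (B + r * b)))
  - (a + b) * (1 + ln (brk (A + B + r * (a + b)))) - (K + beta * (B * a))
  - beta * (a * b / 2) * (r *+ 2).
(* Even if a starting mass is 0, the masses are positive for [r > 0]; continuity takes care of
   [r = 0]. *)
have pos (X x r : R) : 0 <= X -> 0 <= x -> X + x != 0 -> 0 < r -> 0 < X + r * x.
  move=> X0 x0 Xx r0; have [X0'|X0'] := eqVneq X 0.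
    by rewrite X0' add0r mulr_gt0//; lra.
  by rewrite ltr_pwDl// ?mulr_ge0// ?(ltW r0)//; lra.
have dfP (r : R) : r \in `]0, 1[ -> is_derive r (1 : R) f (df r).
  rewrite in_itv/= => /andP[r0 r1].
  have sq : is_derive r (1 : R) (fun r : R => beta * (a * b / 2) * r ^+ 2)
      (beta * (a * b / 2) * (r *+ 2)).
    apply: (is_derive_eq (is_deriveZ (beta * (a * b / 2))
      (is_deriveX 2 (is_derive_id r (1 : R))))).
    by rewrite /GRing.scale/= expr1 mulr1 mulr_natl.
  rewrite /f /df; apply: is_deriveB sq; apply: is_deriveB (is_derive_affine _ _ _).
  apply: is_deriveB; last by apply: is_derive_Gent_affine; apply: pos => //; lra.
  by apply: is_deriveD; apply: is_derive_Gent_affine; apply: pos.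
have cf : {within `[0, 1], continuous f}.
  apply: continuous_in_subspaceT => r; rewrite inE/= in_itv/= => /andP[r0 r1].
  apply: cvgB; last first.
    by apply: cvgM; [exact: cvg_cst|exact: exprn_continuous].
  apply: cvgB; last exact: continuous_affine.
  apply: cvgB; last by apply: continuous_Gent_affine; rewrite addr_ge0 ?mulr_ge0 ?addr_ge0.
  by apply: cvgD; apply: continuous_Gent_affine; rewrite addr_ge0 ?mulr_ge0.
have [r] := MVT ltr01 dfP cf.
rewrite in_itv/= => /andP[r0 r1].
have -> : f 1 = Gent (A + a) + Gent (B + b) - Gent (A + B + (a + b)) - K
    - beta * (B * a + a * b / 2).
  by rewrite /f !mul1r expr1n; lra.
have -> : f 0 = Gent A + Gent B - Gent (A + B).
  by rewrite /f !mul0r expr0n/= !addr0 mulr0 !subr0.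
have : df r <= 0.
  have := Gent_HJ (pos _ _ _ A0 a0 Aa r0) (pos _ _ _ B0 b0 Bb r0) a0 b0.
  rewrite (_ : A + r * a + (B + r * b) = A + B + r * (a + b)); last by ring.
  rewrite -subr_le0; apply: le_trans; rewrite le_eqVlt; apply/predU1P; left.
  by rewrite /df /K mulr2n; field.
rewrite subr0 mulr1 /K; lra.
Qed.

End q_entropy.

Lemma brk_beta0 {R : realType} (z : R) : brk 0 z = z.
Proof. by rewrite /brk eqxx. Qed.

(** * The discrete inequality *)

Section finite_sums.
Context {R : realType}.
Implicit Types (a b : nat -> R) (p : nat -> nat -> R).

Lemma sum_ord_add (n m : nat) a :
  \sum_(k < n + m) a k = \sum_(k < n) a k + \sum_(k < m) a (n + k)%N.
Proof. by rewrite big_split_ord. Qed.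

Lemma sum_triangle (n : nat) (f : nat -> nat -> R) :
  \sum_(l < n) \sum_(m < l) f l m = \sum_(m < n) \sum_(l < n | (m < l)%N) f l m.
Proof.
under eq_bigr => l _ do rewrite (big_ord_widen n (fun m => f l m) (ltnW (ltn_ord l))).
by rewrite (exchange_big_dep predT).
Qed.

Lemma sumr_sqr_le (n : nat) a (d : R) : (forall k, (k < n)%N -> 0 <= a k <= d) ->
  \sum_(k < n) a k ^+ 2 <= d * \sum_(k < n) a k.
Proof.
move=> ad; rewrite mulr_sumr; apply: ler_sum => k _.
by have /andP[a0 a1] := ad k (ltn_ord k); rewrite expr2 ler_wpM2r.
Qed.

(** [gibbs] with the weights [w k A / V], where [A] and [V] are the two totals; the linear terms sum
    to [A - A = 0]. Thus merging cells into one of width [V] does not increase the sum of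
    [a ln (a / w)]. *)
Lemma sum_xl_ge (n : nat) a (w : nat -> R) : (forall k, 0 <= a k) ->
  (forall k, 0 < w k) ->
  xl (\sum_(k < n) a k) - (\sum_(k < n) a k) * ln (\sum_(k < n) w k)
  <= \sum_(k < n) (xl (a k) - a k * ln (w k)).
Proof.
move=> a0 w0; case: n => [|n]; first by rewrite !big_ord0 xl0; lra.
set A := \sum_(k < _) a k; set V := \sum_(k < _) w k.
have V0 : 0 < V.
  by rewrite /V big_ord_recl ltr_pwDl// sumr_ge0// => i _; exact: ltW.
have : 0 <= A by exact: sumr_ge0.
rewrite le_eqVlt => /predU1P[A0|A0].
  rewrite -A0 xl0 mul0r subrr big1// => k _.
  have : a k = 0.
    by apply/eqP; move/esym/eqP: A0; rewrite /A psumr_eq0// => /allP; apply; rewrite mem_index_enum.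
  by move=> ->; rewrite xl0 mul0r subrr.
have h (k : 'I_n.+1) : a k * ln A - a k * ln V + a k - w k * (A / V) <= xl (a k) - a k * ln (w k).
  have := gibbs (a0 k) (mulr_gt0 (w0 k) (divr_gt0 A0 V0)).
  by rewrite lnM ?posrE ?divr_gt0// ln_div ?posrE//; lra.
apply: (le_trans _ (ler_sum _ (fun k _ => h k))).
rewrite !sumrB big_split/= sumrB -!mulr_suml -/A -/V mulrCA divff ?gt_eqF// mulr1 /xl; lra.
Qed.

End finite_sums.

Section discrete_inequality.
Context {R : realType}.
Variable beta : R.
Implicit Types (a b : nat -> R) (p : nat -> nat -> R).

Local Notation G := (Gent beta).

(** [Gent_step] telescopes: the partial sums form a polygonal path from [(0, 0)], where the value
    function vanishes. *)
Lemma two_species (n : nat) a b : (forall k, 0 <= a k) -> (forall k, 0 <= b k) ->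
  G (\sum_(k < n) a k) + G (\sum_(k < n) b k)
    - G (\sum_(k < n) a k + \sum_(k < n) b k)
  <= \sum_(k < n) (xl (a k) + xl (b k) - xl (a k + b k))
     + beta * \sum_(k < n) a k * (\sum_(m < k) b m + b k / 2).
Proof.
move=> a0 b0; elim: n => [|n IH]; first by rewrite !big_ord0 !addr0 Gent0; lra.
rewrite !big_ord_recr/=.
have sa0 : 0 <= \sum_(k < n) a k by exact: sumr_ge0.
have sb0 : 0 <= \sum_(k < n) b k by exact: sumr_ge0.
have := Gent_step beta sa0 sb0 (a0 n) (b0 n).
move: (\sum_(k < n) a k) (\sum_(k < n) b k) IH => A B IH.
have -> : a n * (B + b n / 2) = B * a n + a n * b n / 2 by ring.
by rewrite [A + a n + _]addrACA mulrDr; lra.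
Qed.

(* Column l is merged with the union of the columns 0, ..., l - 1. *)
Lemma multi_species (n N : nat) p : (forall k l, 0 <= p k l) ->
  \sum_(l < N) G (\sum_(k < n) p k l) - G (\sum_(l < N) \sum_(k < n) p k l)
  <= \sum_(k < n) (\sum_(l < N) xl (p k l) - xl (\sum_(l < N) p k l))
     + beta * \sum_(l < N) \sum_(k < n)
         (\sum_(m < l) p k m) * (\sum_(i < k) p i l + p k l / 2).
Proof.
move=> p0; elim: N => [|N IH].
  rewrite !big_ord0 Gent0 subrr mulr0 addr0 big1// => k _.
  by rewrite !big_ord0 xl0 subrr.
have r0 k : 0 <= \sum_(m < N) p k m by exact: sumr_ge0.
have := @two_species n (fun k => \sum_(m < N) p k m) (p^~ N) r0 (p0^~ N).
move: IH; move: (Gent beta) => g IH.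
rewrite [\sum_(k < n) \sum_(m < N) p k m]exchange_big/=.
rewrite !big_ord_recr/= mulrDr.
under [X in _ -> _ <= X + _]eq_bigr => k _ do rewrite !big_ord_recr/=.
rewrite !sumrB !big_split/=.
move: IH; rewrite !sumrB.
lra.
Qed.

(** The grid energy without ties: the cell [(i, l)] lies to the left of and above the cell [(k, m)],
    and pairs on a common grid line are left out. *)
Definition strict_inv (n N : nat) p : R :=
  \sum_(l < N) \sum_(k < n) (\sum_(m < l) p k m) * (\sum_(i < k) p i l).

(** Grouping by the lower right cell of each pair gives the form that is compared with the mass of
    [upper_left]. *)
Lemma strict_invE (n N : nat) p : strict_inv n N p =
  \sum_(k < n) \sum_(l < N) p k l * \sum_(m < N | (l < m)%N) \sum_(i < k) p i m.
Proof.
rewrite /strict_inv exchange_big/=; apply: eq_bigr => k _.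
under eq_bigr do rewrite mulr_suml.
rewrite (sum_triangle N (fun l m => p k m * \sum_(i < k) p i l)).
by apply: eq_bigr => l _; rewrite mulr_sumr.
Qed.

(** An inverted pair lies in the first [n] slices of the first coordinate, or in the last [n], or
    has its upper left cell in the first group and its lower right cell in the second. *)
Lemma strict_inv_split (n N : nat) p :
  strict_inv (n + n) N p = strict_inv n N p + strict_inv n N (fun k => p (n + k)%N)
  + \sum_(l < N) (\sum_(k < n) p k l) * \sum_(m < l) \sum_(k < n) p (n + k)%N m.
Proof.
rewrite /strict_inv -!big_split/=; apply: eq_bigr => l _.
rewrite (sum_ord_add n n (fun k => (\sum_(m < l) p k m) * (\sum_(i < k) p i l))) -addrA.
congr (_ + _).
have E k : \sum_(i < n + k) p i l = \sum_(i < n) p i l + \sum_(i < k) p (n + i)%N l.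
  exact: (sum_ord_add n k (p^~ l)).
under [LHS]eq_bigr do rewrite E mulrDr.
rewrite big_split/= addrC; congr (_ + _).
by rewrite -mulr_suml mulrC exchange_big.
Qed.

(** The analogous decomposition in the second coordinate. The last product pairs the upper left
    block with the lower right block and becomes [t12 * t21]. *)
Lemma cross_split (n : nat) a b :
  \sum_(l < n + n) a l * \sum_(m < l) b m =
  \sum_(l < n) a l * (\sum_(m < l) b m)
  + \sum_(l < n) a (n + l)%N * (\sum_(m < l) b (n + m)%N)
  + (\sum_(l < n) a (n + l)%N) * \sum_(m < n) b m.
Proof.
rewrite (sum_ord_add n n (fun l => a l * \sum_(m < l) b m)) -addrA; congr (_ + _).
under [LHS]eq_bigr do rewrite sum_ord_add mulrDr.
by rewrite big_split/= addrC -mulr_suml.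
Qed.

(** Mean value theorem with [phi_bound]. Being quadratic in the mass, the bound summed over thin
    grid lines vanishes with the mesh. *)
Lemma Fpress_bound (m : R) : 0 <= m -> `|Fpress beta m| <= `|beta| * m ^+ 2.
Proof.
move=> m0.
have cF : {within `[0, m], continuous (Fpress beta)}.
  apply: continuous_in_subspaceT => x; rewrite inE/= in_itv/= => /andP[x0 _].
  exact: continuous_Fpress.
have dF (x : R) : x \in `]0, m[ -> is_derive x (1 : R) (Fpress beta) (phi beta x).
  by rewrite in_itv/= => /andP[x0 _]; apply: is_derive_Fpress; lra.
have [c] := MVT_segment m0 dF cF.
rewrite in_itv/= Fpress0 !subr0 => /andP[c0 cm] ->.
rewrite normrM (ger0_norm m0) expr2 mulrA ler_wpM2r//.
apply: (le_trans (phi_bound _ _)); rewrite normrM ler_wpM2l//.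
by rewrite ger0_norm.
Qed.

(** The sum of [multi_species] and of [sum_xl_ge] for the row sums, whose [xl] terms cancel. The
    pressures of single columns and the tied halves become the error, in absolute value because
    [beta] has no sign. *)
Lemma multi_species_strip (n N : nat) p (w : nat -> R) :
  (forall k l, 0 <= p k l) -> (forall k, 0 < w k) ->
  \sum_(l < N) xl (\sum_(k < n) p k l)
  - Fpress beta (\sum_(l < N) \sum_(k < n) p k l)
  - (\sum_(l < N) \sum_(k < n) p k l) * ln (\sum_(k < n) w k)
  <= \sum_(k < n) (\sum_(l < N) xl (p k l) - (\sum_(l < N) p k l) * ln (w k))
     + beta * strict_inv n N p
     + `|beta| * (\sum_(k < n) (\sum_(l < N) p k l) ^+ 2
                + \sum_(l < N) (\sum_(k < n) p k l) ^+ 2).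
Proof.
move=> p0 w0; have := @multi_species n N p p0.
have r0 k : 0 <= \sum_(l < N) p k l by exact: sumr_ge0.
have c0 l : 0 <= \sum_(k < n) p k l by exact: sumr_ge0.
have := @sum_xl_ge R n (fun k => \sum_(l < N) p k l) w r0 w0.
rewrite [\sum_(k < n) \sum_(l < N) p k l]exchange_big/=.
set t := \sum_(l < N) \sum_(k < n) p k l.
have -> : G t = xl t + Fpress beta t by [].
have : - (`|beta| * \sum_(l < N) (\sum_(k < n) p k l) ^+ 2) <=
    \sum_(l < N) Fpress beta (\sum_(k < n) p k l).
  rewrite mulr_sumr -sumrN; apply: ler_sum => l _.
  by rewrite lerNl (le_trans _ (Fpress_bound (c0 l)))// -normrN ler_norm.
rewrite /Gent big_split/=.
pose T := \sum_(l < N) \sum_(k < n) (\sum_(m < l) p k m) * (p k l / 2).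
have -> : \sum_(l < N) \sum_(k < n) (\sum_(m < l) p k m) * (\sum_(i < k) p i l + p k l / 2)
    = strict_inv n N p + T.
  rewrite /strict_inv /T -big_split; apply: eq_bigr => l _; rewrite -big_split.
  by apply: eq_bigr => k _; rewrite /= mulrDr.
have T0 : 0 <= T.
  by do 2 (apply: sumr_ge0 => ? _); rewrite mulr_ge0 ?divr_ge0 ?sumr_ge0.
(* Each tie is a product of two entries of one row, so the ties are dominated by the squared row
   sums. *)
have T1 : T <= \sum_(k < n) (\sum_(l < N) p k l) ^+ 2.
  rewrite /T exchange_big/=; apply: ler_sum => k _.
  rewrite expr2 mulr_suml; apply: ler_sum => l _.
  rewrite mulrC ler_pM ?divr_ge0 ?sumr_ge0//; first by have := p0 k l; lra.
  rewrite (big_ord_widen N (fun m => p k m) (ltnW (ltn_ord l))) big_mkcond/=.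
  by apply: ler_sum => m _; case: ifP.
have bT : beta * T <= `|beta| * \sum_(k < n) (\sum_(l < N) p k l) ^+ 2.
  by rewrite (le_trans (ler_norm _))// normrM (ger0_norm T0) ler_wpM2l.
rewrite !(big_split, sumrN)/= !mulrDr; lra.
Qed.

Lemma two_species_tie (n : nat) a b : (forall k, 0 <= a k) -> (forall k, 0 <= b k) ->
  G (\sum_(k < n) a k) + G (\sum_(k < n) b k)
    - G (\sum_(k < n) a k + \sum_(k < n) b k)
  <= \sum_(k < n) (xl (a k) + xl (b k) - xl (a k + b k))
     + beta * (\sum_(k < n) a k * \sum_(m < k) b m)
     + `|beta| * \sum_(k < n) (a k + b k) ^+ 2.
Proof.
move=> a0 b0; apply: (le_trans (two_species n a0 b0)).
have -> : \sum_(k < n) a k * (\sum_(m < k) b m + b k / 2)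
    = \sum_(k < n) a k * \sum_(m < k) b m + \sum_(k < n) a k * (b k / 2).
  by rewrite -big_split; apply: eq_bigr => k _; rewrite mulrDr.
rewrite mulrDr -!addrA lerD2l lerD2l.
have T0 : 0 <= \sum_(k < n) a k * (b k / 2).
  by apply: sumr_ge0 => k _; rewrite mulr_ge0 ?divr_ge0.
rewrite (le_trans (ler_norm _))// normrM (ger0_norm T0) ler_wpM2l//.
by apply: ler_sum => k _; have := a0 k; have := b0 k; nra.
Qed.

(** The left side is the bracket of [PhiE]. Six inequalities are added: one merging per vertical
    strip, one merging of the two vertical strips per horizontal strip, and one log-sum inequality
    for the heights per horizontal strip. *)
Lemma discrete_bound (n : nat) p (u v : nat -> R) (t11 t12 t21 t22 : R) :
  (forall k l, 0 <= p k l) -> (forall k, 0 < u k) -> (forall k, 0 < v k) ->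
  \sum_(k < n) \sum_(l < n) p k l = t11 ->
  \sum_(k < n) \sum_(l < n) p k (n + l)%N = t12 ->
  \sum_(k < n) \sum_(l < n) p (n + k)%N l = t21 ->
  \sum_(k < n) \sum_(l < n) p (n + k)%N (n + l)%N = t22 ->
  G t11 + G t12 + G t21 + G t22
  - Fpress beta (t11 + t12) - Fpress beta (t21 + t22)
  - Fpress beta (t11 + t21) - Fpress beta (t12 + t22)
  - (t11 + t12) * ln (\sum_(k < n) u k) - (t21 + t22) * ln (\sum_(k < n) u (n + k)%N)
  - (t11 + t21) * ln (\sum_(k < n) v k) - (t12 + t22) * ln (\sum_(k < n) v (n + k)%N)
  + beta * (t12 * t21)
  <= \sum_(k < n + n) \sum_(l < n + n) (xl (p k l) - p k l * (ln (u k) + ln (v l)))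
     + beta * strict_inv (n + n) (n + n) p
     + `|beta| * (\sum_(k < n + n) (\sum_(l < n + n) p k l) ^+ 2
                  + 2 * \sum_(l < n + n) (\sum_(k < n + n) p k l) ^+ 2).
Proof.
move=> p0 u0 v0 t11P t12P t21P t22P.
pose b1 l := \sum_(k < n) p k l; pose b2 l := \sum_(k < n) p (n + k)%N l.
have b10 l : 0 <= b1 l by exact: sumr_ge0.
have b20 l : 0 <= b2 l by exact: sumr_ge0.
have t11E : \sum_(l < n) b1 l = t11 by rewrite -t11P exchange_big.
have t12E : \sum_(l < n) b1 (n + l)%N = t12 by rewrite -t12P exchange_big.
have t21E : \sum_(l < n) b2 l = t21 by rewrite -t21P exchange_big.
have t22E : \sum_(l < n) b2 (n + l)%N = t22 by rewrite -t22P exchange_big.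
have m1E : \sum_(l < n + n) b1 l = t11 + t12 by rewrite sum_ord_add t11E t12E.
have m2E : \sum_(l < n + n) b2 l = t21 + t22 by rewrite sum_ord_add t21E t22E.
(* Inside a vertical strip the species are the slices of the second coordinate, and the first
   coordinate is time. *)
have M1 := @multi_species_strip n (n + n) p u p0 u0.
have M2 := @multi_species_strip n (n + n) (fun k => p (n + k)%N) (fun k => u (n + k)%N)
  (fun k l => p0 _ l) (fun k => u0 _).
rewrite -/b1 in M1; rewrite -/b2 in M2.
rewrite m1E in M1; rewrite m2E in M2.
(* Now the two vertical strips are the species, and the second coordinate is time. *)
have D1 := @two_species_tie n b1 b2 b10 b20.
have D2 := @two_species_tie n (fun l => b1 (n + l)%N) (fun l => b2 (n + l)%N)
  (fun l => b10 _) (fun l => b20 _).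
rewrite t11E t21E in D1; rewrite t12E t22E in D2.
have c0 l : 0 <= b1 l + b2 l by rewrite addr_ge0.
(* The terms [xl (b1 l + b2 l)] left by [D1] and [D2] cancel against these inequalities with the
   heights [v]. *)
have C1 := @sum_xl_ge R n (fun l => b1 l + b2 l) v c0 v0.
have C2 := @sum_xl_ge R n (fun l => b1 (n + l)%N + b2 (n + l)%N) (fun l => v (n + l)%N)
  (fun l => c0 _) (fun l => v0 _).
rewrite !big_split/= t11E t21E in C1; rewrite !big_split/= t12E t22E in C2.
have bE l : \sum_(k < n + n) p k l = b1 l + b2 l by exact: (sum_ord_add n n (p^~ l)).
have cs := cross_split n b1 b2; rewrite -/b1 -/b2 t12E t21E in cs.
rewrite strict_inv_split cs.
have -> : \sum_(l < n + n) (\sum_(k < n + n) p k l) ^+ 2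
    = \sum_(k < n) (b1 k + b2 k) ^+ 2 + \sum_(k < n) (b1 (n + k)%N + b2 (n + k)%N) ^+ 2.
  rewrite -(sum_ord_add n n (fun l => (b1 l + b2 l) ^+ 2)).
  by apply: eq_bigr => l _; rewrite bE.
have -> : \sum_(k < n + n) \sum_(l < n + n) (xl (p k l) - p k l * (ln (u k) + ln (v l)))
  = \sum_(k < n) (\sum_(l < n + n) xl (p k l) - (\sum_(l < n + n) p k l) * ln (u k))
  + \sum_(k < n) (\sum_(l < n + n) xl (p (n + k)%N l)
                   - (\sum_(l < n + n) p (n + k)%N l) * ln (u (n + k)%N))
  - (\sum_(l < n) (b1 l + b2 l) * ln (v l)
     + \sum_(l < n) (b1 (n + l)%N + b2 (n + l)%N) * ln (v (n + l)%N)).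
  rewrite -(sum_ord_add n n (fun k => \sum_(l < n + n) xl (p k l) -
    (\sum_(l < n + n) p k l) * ln (u k))) -(sum_ord_add n n (fun l => (b1 l + b2 l) * ln (v l))).
  have -> : \sum_(l < n + n) (b1 l + b2 l) * ln (v l)
      = \sum_(k < n + n) \sum_(l < n + n) p k l * ln (v l).
    by rewrite exchange_big; apply: eq_bigr => l _; rewrite /= -bE mulr_suml.
  rewrite -sumrB; apply: eq_bigr => k _; rewrite mulr_suml -!sumrB.
  by apply: eq_bigr => l _; rewrite mulrDr; ring.
rewrite (sum_ord_add n n (fun k => (\sum_(l < n + n) p k l) ^+ 2)).
have Eb1 : \sum_(l < n + n) xl (b1 l) = _ := sum_ord_add n n (fun l => xl (b1 l)).
have Eb2 : \sum_(l < n + n) xl (b2 l) = _ := sum_ord_add n n (fun l => xl (b2 l)).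
rewrite Eb1 in M1; rewrite Eb2 in M2.
(* The squares of the two parts of a column add up to at most the square of the column; together
   with the ties of [D1] and [D2] this gives the factor 2 in the error. *)
have Q : \sum_(l < n + n) b1 l ^+ 2 + \sum_(l < n + n) b2 l ^+ 2
    <= \sum_(k < n) (b1 k + b2 k) ^+ 2 + \sum_(k < n) (b1 (n + k)%N + b2 (n + k)%N) ^+ 2.
  rewrite -(sum_ord_add n n (fun l => (b1 l + b2 l) ^+ 2)) -big_split/=.
  apply: ler_sum => l _; have := mulr_ge0 (b10 l) (b20 l).
  by rewrite sqrrD mulr2n; lra.
have bQ := ler_wpM2l (normr_ge0 beta) Q.
rewrite !big_split/= in D1 D2; rewrite !sumrN in C1 C2 D1 D2.
have G1 : G (t11 + t21) = xl (t11 + t21) + Fpress beta (t11 + t21) by [].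
have G2 : G (t12 + t22) = xl (t12 + t22) + Fpress beta (t12 + t22) by [].
rewrite !mulrDr in M1 M2 D1 D2 bQ *.
lra.
Qed.

End discrete_inequality.

(** * Measures with a density *)

Section density.
Local Open Scope charge_scope.
Context d (T : measurableType d) {R : realType}.
Variables (mu : {sigma_finite_measure set T -> \bar R}) (nu : probability T R).
Variable g : T -> R.
Hypothesis mg : measurable_fun [set: T] g.
Hypothesis g0 : forall x, 0 <= g x.
Hypothesis nuE : forall A, measurable A -> nu A = (\int[mu]_(x in A) (g x)%:E)%E.

Lemma density_dominates : nu `<< mu.
Proof.
apply/null_content_dominatesP => A mA A0.
rewrite nuE//; apply: null_set_integral => //.
exact/measurable_funTS/measurable_EFinP.
Qed.

Local Notation rn := (Radon_Nikodym_SigmaFinite.f nu mu).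
Local Notation dnu := ('d (charge_of_finite_measure nu) '/d mu).

Lemma density_ae_eq_charge : ae_eq mu [set: T] dnu (EFin \o g).
Proof.
have numu := density_dominates.
apply: integral_ae_eq => //.
- exact: Radon_Nikodym_integrable.
- exact/measurable_EFinP.
- by move=> E _ mE; rewrite -Radon_Nikodym_integral// -nuE.
Qed.

(** Links two Radon-Nikodym derivatives: the one for measures comes with a change of variables
    formula, the one for charges occurs in [rel_entropy]. *)
Lemma density_ae_eq : ae_eq mu [set: T] rn (EFin \o g).
Proof.
apply: ae_eq_trans density_ae_eq_charge.
exact: (ae_eq_Radon_Nikodym_SigmaFinite density_dominates measurableT).
Qed.

Lemma density_change_of_variables (h : T -> \bar R) :
  measurable_fun [set: T] h -> (forall x, 0 <= h x)%E ->
  (\int[nu]_x h x = \int[mu]_x (h x * (g x)%:E))%E.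
Proof.
move=> mh h0; have numu := density_dominates.
rewrite -(Radon_Nikodym_SigmaFinite.change_of_variables numu h0 measurableT mh).
apply: ae_eq_integral => //.
- apply: emeasurable_funM => //.
  exact: measurable_int (Radon_Nikodym_SigmaFinite.f_integrable numu).
- by apply: emeasurable_funM => //; exact/measurable_EFinP.
- by apply: ae_eqe_mul2l; exact: density_ae_eq.
Qed.

Lemma density_gt0 : {ae nu, forall x, 0 < g x}.
Proof.
have mA : measurable [set x | g x = 0].
  by rewrite [X in measurable X](_ : _ = g @^-1` [set 0])//; rewrite -[X in measurable X]setTI; exact: mg.
exists [set x | g x = 0]; split => //.
  rewrite nuE//; rewrite -[RHS](integral0 mu [set x | g x = 0]).
  by apply: eq_integral => x; rewrite inE/= => ->.
by move=> x /=; rewrite lt_def g0 andbT => /negP/negPn/eqP.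
Qed.

Lemma measurable_lne_density : measurable_fun [set: T] (fun x => lne (dnu x)).
Proof.
have numu := density_dominates.
have mdnu : measurable_fun [set: T] (fine \o dnu).
  by apply: measurableT_comp => //; apply: measurable_int; exact: Radon_Nikodym_integrable.
have -> : (fun x => lne (dnu x)) =
    (fun x => if fine (dnu x) <= 0 then -oo%E else (ln (fine (dnu x)))%:E).
  apply/funext => x.
  by rewrite -{1}[dnu x]fineK// Radon_Nikodym_fin_num.
apply: measurable_fun_ifT => //.
  exact: measurable_fun_ler.
by apply/measurable_EFinP; exact: measurableT_comp mdnu.
Qed.

Lemma integral_lne_density :
  (\int[nu]_x lne (dnu x) = \int[nu]_x (ln (g x))%:E)%E.
Proof.
apply: ae_eq_integral => //.
- exact: measurable_lne_density.
- by apply/measurable_EFinP; exact: measurableT_comp mg.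
- have := null_dominates_ae_eq measurableT density_dominates density_ae_eq_charge.
  apply: filterS2 density_gt0 => x gx dgx _.
  by rewrite (dgx I); exact: lne_EFin.
Qed.

(** The inequality [ln w + 1 - w / g <= ln g] is integrated against [nu]; the integral of [w / g] is
    at most that of [w] against [mu], hence at most 1. This is the variational lower bound for the
    entropy, valid even if the right side is infinite. *)
Lemma gibbs_density (w : T -> R) : measurable_fun [set: T] w ->
  (forall x, 0 <= w x) -> (\int[mu]_x (w x)%:E <= 1)%E ->
  {ae nu, forall x, 0 < w x} -> nu.-integrable [set: T] (EFin \o (@ln R \o w)) ->
  (\int[nu]_x (ln (w x))%:E <= \int[nu]_x (ln (g x))%:E)%E.
Proof.
move=> mw w0 w1 wpos lnw.
(* [w / g] written through [expR] and [ln], hence measurable by composition; the two agree where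
   [g > 0], that is [nu]-almost everywhere. *)
pose h x := w x * expR (- ln (g x)).
have hE x : 0 < g x -> h x = w x / g x by move=> gx; rewrite /h expRN lnK.
have mh : measurable_fun [set: T] h.
  apply: measurable_funM => //; apply: measurableT_comp => //.
  by apply: measurableT_comp => //; exact: measurableT_comp mg.
have h0 x : 0 <= h x by rewrite mulr_ge0// expR_ge0.
have ih1 : (\int[nu]_x (h x)%:E <= 1)%E.
  rewrite density_change_of_variables//; last exact/measurable_EFinP.
  apply: (le_trans _ w1); apply: ge0_le_integral => //.
  - by move=> x _; rewrite mule_ge0// lee_fin.
  - by apply: emeasurable_funM; exact/measurable_EFinP.
  - exact/measurable_EFinP.
  - move=> x _; rewrite -EFinM lee_fin.
    have [->|gx] := eqVneq (g x) 0; first by rewrite mulr0.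
    by rewrite hE ?divfK// lt_def gx g0.
have ih : nu.-integrable [set: T] (EFin \o h).
  apply/integrableP; split; first exact/measurable_EFinP.
  under eq_integral do rewrite /= ger0_norm//.
  by apply: le_lt_trans ih1 _; rewrite ltry.
pose k x : \bar R := ((ln (w x))%:E + (1%:E - (h x)%:E))%E.
have i1 : nu.-integrable [set: T] (cst 1%E : T -> \bar R).
  exact: finite_measure_integrable_cst.
have i1h : nu.-integrable [set: T] (fun x => 1%:E - (h x)%:E)%E by exact: integrableB.
have ik : nu.-integrable [set: T] k by exact: integrableD.
apply: (@le_trans _ _ (\int[nu]_x k x)%E).
  have E1 : (\int[nu]_x (cst 1%E : T -> \bar R) x = 1)%E.
    by rewrite integral_cst// mul1e; exact: probability_setT.
  rewrite /k integralD// integralB// E1.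
  rewrite leeDl// sube_ge0//.
  by rewrite orbT.
have mlg : measurable_fun [set: T] (fun x => (ln (g x))%:E).
  by apply/measurable_EFinP; exact: measurableT_comp mg.
have mk := measurable_int _ ik.
have kle : {ae nu, forall x, (k x <= (ln (g x))%:E)%E}.
  apply: filterS2 wpos density_gt0 => x wx gx.
  rewrite /k -EFinB -EFinD lee_fin hE//.
  have := @le_ln1Dx R (w x / g x - 1); rewrite [1 + _]addrC subrK ln_div ?posrE//.
  by have := divr_gt0 wx gx; move: (w x / g x) => r r0 /(_ _); lra.
(* [ln g] may fail to be integrable, so positive and negative parts are compared separately. *)
rewrite integralE [leRHS]integralE leeB//.
- apply: ae_ge0_le_integral => //; try exact: measurable_funepos.
  by apply: filterS kle => x kx _; rewrite !funeposE ge_max !le_max kx lexx orbT.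
- apply: ae_ge0_le_integral => //; try exact: measurable_funeneg.
  apply: filterS kle => x kx _; rewrite !funenegE.
  by rewrite ge_max !le_max leeN2 kx lexx orbT.
Qed.

End density.

(** * Coarse-graining and the lower bound *)

Section slices.
Context {R : realType}.
Implicit Types (u : nat -> R).

Definition tau u (k : nat) : R := \sum_(i < k) u i.

(** Left-open slices match the blocks, whose first part is closed at [theta]. The coordinate lines
    through 0 that they miss are null once [nu] is dominated by [lambda2]. *)
Definition slice u (k : nat) : set R := `]tau u k, tau u k.+1]%classic.

Lemma tau0 u : tau u 0 = 0. Proof. by rewrite /tau big_ord0. Qed.

Lemma tauS u k : tau u k.+1 = tau u k + u k.
Proof. by rewrite /tau big_ord_recr. Qed.

Lemma tau_le u : (forall k, 0 < u k) -> {homo tau u : k l / (k <= l)%N >-> k <= l}.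
Proof.
move=> u0 k l; elim: l => [|l IH]; first by rewrite leqn0 => /eqP ->.
rewrite leq_eqVlt => /predU1P[->//|/IH kl].
by rewrite tauS; apply: (le_trans kl); rewrite lerDl ltW.
Qed.

Lemma slice_lt u k l x y : (forall k, 0 < u k) -> (k < l)%N ->
  slice u k x -> slice u l y -> x < y.
Proof.
move=> u0 kl; rewrite /slice/= !in_itv/= => /andP[_ xk] /andP[ly _].
by apply: le_lt_trans ly; apply: (le_trans xk); exact: tau_le.
Qed.

Lemma slice_inj u k l x : (forall k, 0 < u k) ->
  slice u k x -> slice u l x -> k = l.
Proof.
move=> u0 xk xl; have [kl|kl|//] := ltngtP k l.
- by have := slice_lt u0 kl xk xl; rewrite ltxx.
- by have := slice_lt u0 kl xl xk; rewrite ltxx.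
Qed.

Lemma measure_slices d (T : measurableType d) (m : {measure set T -> \bar R})
    (f : T -> R) u (S : set T) (k N : nat) : (forall k, 0 < u k) ->
  measurable_fun [set: T] f -> measurable S ->
  m (S `&` f @^-1` `]tau u k, tau u (k + N)%N]) =
  (\sum_(i < N) m (S `&` f @^-1` slice u (k + i)%N))%E.
Proof.
move=> u0 mf mS.
have mI (i : interval R) : measurable (S `&` f @^-1` [set` i]).
  by apply: measurableI => //; rewrite -[X in measurable X]setTI; exact: mf.
elim: N => [|N IH].
  rewrite big_ord0 addn0 [X in _ @^-1` X](_ : _ = set0) ?preimage_set0 ?setI0 ?measure0//.
  by apply/seteqP; split => x //=; rewrite in_itv/= => /andP[/lt_le_trans h /h]; rewrite ltxx.
have kN : tau u k <= tau u (k + N)%N by apply: tau_le => //; exact: leq_addr.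
have NN : tau u (k + N)%N <= tau u (k + N).+1 by exact: tau_le.
rewrite big_ord_recr/= -IH -measureU//; last 2 first.
- exact: mI.
- apply/seteqP; split => x //=; rewrite /slice/= !in_itv/= => -[[_ /andP[_ h1]] [_ /andP[h2 _]]].
  by have := lt_le_trans h2 h1; rewrite ltxx.
congr (m _); rewrite -setIUr -preimage_setU addnS; congr (_ `&` _ @^-1` _).
apply/seteqP; split => x /=; rewrite /slice/= !in_itv/=.
  by move=> /andP[-> ->]/=; have [|] := leP x (tau u (k + N)%N); [left|right].
move=> [/andP[-> h]|/andP[h ->]]; first by rewrite (le_trans h).
by rewrite andbT (le_lt_trans kN).
Qed.

Lemma lambda_itv (a b : R) : 0 <= a -> a <= b -> b <= 1 ->
  lambda `]a, b]%classic = (b - a)%:E.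
Proof.
move=> a0 ab b1; rewrite /lambda /mrestr.
rewrite (_ : _ `&` _ = `]a, b]%classic); last first.
  apply/seteqP; split => x /=; rewrite !in_itv/=; first by case.
  by move=> /andP[ax xb]; rewrite ax xb; split => //; rewrite (le_trans a0 (ltW ax)) (le_trans xb b1).
rewrite lebesgue_measure_itv/= lte_fin; case: ltP => [_|ba]; first by rewrite EFinB.
by have -> : b - a = 0 by lra.
Qed.

Lemma lambda2_setX (A B : set R) : measurable A -> measurable B ->
  lambda2 (A `*` B) = (lambda A * lambda B)%E.
Proof. by move=> mA mB; exact: product_measure1E. Qed.

Lemma lambda2_slice u v k l N : (forall k, 0 < u k) -> (forall k, 0 < v k) ->
  tau u N = 1 -> tau v N = 1 -> (k < N)%N -> (l < N)%N ->
  lambda2 (slice u k `*` slice v l) = (u k * v l)%:E.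
Proof.
move=> u0 v0 u1 v1 kN lN; rewrite lambda2_setX; [|exact: measurable_itv..].
have P (w : nat -> R) (i : nat) : (forall k, 0 < w k) -> tau w N = 1 -> (i < N)%N ->
    lambda (slice w i) = (w i)%:E.
  move=> w0 w1 iN; rewrite lambda_itv.
  - by rewrite tauS addrAC subrr add0r.
  - by rewrite -(tau0 w); exact: tau_le.
  - exact: tau_le.
  - by rewrite -w1; exact: tau_le.
by rewrite !P// EFinM.
Qed.

Lemma lambda2_unit : lambda2 (`]0, 1] `*` `]0, 1] : set (R * R)) = 1%E.
Proof.
rewrite lambda2_setX; [|exact: measurable_itv..].
by rewrite lambda_itv// subr0 mule1.
Qed.

End slices.

(** * Masses of grid cells, step functions and coarse-grained entropy *)

Section grid.
Context {R : realType}.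
Variables (nu : prob2 R) (u v : nat -> R) (N : nat).
Hypotheses (u0 : forall k, 0 < u k) (v0 : forall k, 0 < v k).
Hypotheses (u1 : tau u N = 1) (v1 : tau v N = 1).
Hypothesis nul : nu `<< lambda2.

Definition cell k l : set (R * R) := slice u k `*` slice v l.
Definition mass k l : R := fine (nu (cell k l)).

Lemma measurable_cell k l : measurable (cell k l).
Proof. by apply: measurableX; exact: measurable_itv. Qed.

Lemma massE k l : nu (cell k l) = (mass k l)%:E.
Proof. by rewrite fineK// fin_num_measure//; exact: measurable_cell. Qed.

Lemma mass_ge0 k l : 0 <= mass k l. Proof. exact/fine_ge0/measure_ge0. Qed.

Lemma measure_rect (S : set (R * R)) (i j n m : nat) : measurable S ->
  nu (S `&` (`]tau u i, tau u (i + n)%N] `*` `]tau v j, tau v (j + m)%N])) =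
  (\sum_(k < n) \sum_(l < m) nu (S `&` cell (i + k)%N (j + l)%N))%E.
Proof.
move=> mS.
have mf : measurable_fun [set: measurableTypeR R * measurableTypeR R] fst by exact: measurable_fst.
have mg : measurable_fun [set: measurableTypeR R * measurableTypeR R] snd by exact: measurable_snd.
have mp (A : set R) : measurable A -> measurable (S `&` fst @^-1` A).
  by move=> mA; apply: measurableI => //; rewrite -[X in measurable X]setTI; exact: mf.
have mp' (A : set R) : measurable A -> measurable (S `&` snd @^-1` A).
  by move=> mA; apply: measurableI => //; rewrite -[X in measurable X]setTI; exact: mg.
rewrite [X in nu X](_ : _ = (S `&` snd @^-1` `]tau v j, tau v (j + m)%N]) `&`
  fst @^-1` `]tau u i, tau u (i + n)%N]); last first.
  by apply/seteqP; split => x /=; [move=> [? []]|move=> [[? ?] ?]].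
rewrite (measure_slices _ _ _ u0 mf); last by apply: mp'; exact: measurable_itv.
apply: eq_bigr => k _.
rewrite (_ : _ `&` fst @^-1` slice u (i + k)%N = (S `&` fst @^-1` slice u (i + k)%N) `&`
  snd @^-1` `]tau v j, tau v (j + m)%N]); last first.
  by apply/seteqP; split => x /=; move=> [[? ?] ?].
rewrite (measure_slices _ _ _ v0 mg); last by apply: mp; exact: measurable_itv.
apply: eq_bigr => l _; congr (nu _).
by apply/seteqP; split => x /=; [move=> [[? ?] ?]|move=> [? []]].
Qed.

Lemma measure_unit (S : set (R * R)) : measurable S ->
  nu S = nu (S `&` (`]0, 1] `*` `]0, 1])).
Proof.
move=> mS; set C := _ `*` _.
have mC : measurable C by apply: measurableX; exact: measurable_itv.
have nC : nu (~` C) = 0%E.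
  apply: (null_content_dominatesP _ _).1 nul _ (measurableC mC) _.
  by have := probability_setC lambda2 mC; rewrite lambda2_unit subee.
have mD : measurable (S `\` C) by exact: measurableD.
have -> : nu S = (nu (S `\` C) + nu (S `&` C))%E := measureDI nu mS mC.
have -> : nu (S `\` C) = 0%E.
  by apply: (@subset_measure0 _ _ _ nu _ (~` C)) => //; exact: measurableC.
by rewrite add0e.
Qed.

Lemma measure_cells (S : set (R * R)) : measurable S ->
  nu S = (\sum_(k < N) \sum_(l < N) nu (S `&` cell k l))%E.
Proof.
move=> mS; rewrite measure_unit//.
have -> : `]0, 1]%classic `*` `]0, 1]%classic =
    `]tau u 0, tau u (0 + N)%N]%classic `*` `]tau v 0, tau v (0 + N)%N]%classic :> set (R * R).
  by rewrite !add0n u1 v1 !tau0.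
by rewrite measure_rect.
Qed.

Lemma sum_mass i j n m : (\sum_(k < n) \sum_(l < m) mass (i + k)%N (j + l)%N)%:E =
  nu (`]tau u i, tau u (i + n)%N] `*` `]tau v j, tau v (j + m)%N]).
Proof.
have := @measure_rect [set: R * R] i j n m measurableT; rewrite setTI => ->.
rewrite -sumEFin; apply: eq_bigr => k _; rewrite -sumEFin; apply: eq_bigr => l _.
by rewrite setTI massE.
Qed.

Lemma mass_row k : (\sum_(l < N) mass k l)%:E = nu (slice u k `*` `]0, 1]).
Proof.
have := sum_mass k 0 1 N; rewrite big_ord1 addn1 addn0 add0n tau0 v1 => <-.
by under [in RHS]eq_bigr do rewrite add0n.
Qed.

Lemma mass_col l : (\sum_(k < N) mass k l)%:E = nu (`]0, 1] `*` slice v l).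
Proof.
have := sum_mass 0 l N 1; rewrite addn1 add0n tau0 u1 => <-.
by under [in RHS]eq_bigr do rewrite big_ord1 addn0 add0n.
Qed.

Lemma mass_total : \sum_(k < N) \sum_(l < N) mass k l = 1.
Proof.
apply: EFin_inj; have := sum_mass 0 0 N N.
under eq_bigr do under eq_bigr do rewrite !add0n.
by move=> ->; rewrite !add0n !tau0 u1 v1 -[X in nu X]setTI -measure_unit// probability_setT.
Qed.

(** Zero off the cells; with [ln 0 = 0] the logarithm of a step function is again a step
    function. *)
Definition step (c : nat -> nat -> R) (q : R * R) : R :=
  \sum_(k < N) \sum_(l < N) c k l * \1_(cell k l) q.

Lemma stepE c k l q : (k < N)%N -> (l < N)%N -> cell k l q -> step c q = c k l.
Proof.
move=> kN lN [qk ql]; rewrite /step (bigD1 (Ordinal kN))//= (bigD1 (Ordinal lN))//=.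
rewrite indicE mem_set// mulr1 big1 ?addr0 => [|j jl]; last first.
  rewrite indicE memNset ?mulr0// => -[_ /(slice_inj v0 ql) lj].
  by move: jl; rewrite -val_eqE/= -lj eqxx.
rewrite big1 ?addr0// => i ik; rewrite big1// => j _.
rewrite indicE memNset ?mulr0// => -[/(slice_inj u0 qk) ki _].
by move: ik; rewrite -val_eqE/= -ki eqxx.
Qed.

Lemma step_out c q : (forall k l, (k < N)%N -> (l < N)%N -> ~ cell k l q) -> step c q = 0.
Proof.
move=> qN; rewrite /step big1// => k _; rewrite big1// => l _.
by rewrite indicE memNset ?mulr0//; exact: qN.
Qed.

Lemma cellP q : (exists k l, [/\ (k < N)%N, (l < N)%N & cell k l q]) \/
  (forall k l, (k < N)%N -> (l < N)%N -> ~ cell k l q).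
Proof.
have [[k [l [kN lN kl]]]|h] := pselect (exists k l, [/\ (k < N)%N, (l < N)%N & cell k l q]).
  by left; exists k, l.
by right => k l kN lN kl; apply: h; exists k, l.
Qed.

Lemma step_comp (f : R -> R) c q : f 0 = 0 ->
  f (step c q) = step (fun k l => f (c k l)) q.
Proof.
move=> f0; have [[k [l [kN lN kl]]]|h] := cellP q.
  by rewrite !(stepE _ kN lN kl).
by rewrite !step_out.
Qed.

Lemma measurable_step c : measurable_fun [set: R * R] (step c).
Proof.
apply: measurable_sum => k; apply: measurable_sum => l.
apply: measurable_funM => //.
by apply: measurable_indic; exact: measurable_cell.
Qed.

Lemma integrable_step (m : {finite_measure set (measurableTypeR R * measurableTypeR R)%type -> \bar R}) c :
  m.-integrable [set: R * R] (EFin \o step c).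
Proof.
have -> : EFin \o step c = (fun q => \sum_(k < N) \sum_(l < N) (c k l * \1_(cell k l) q)%:E)%E.
  by apply/funext => q; rewrite /= /step -sumEFin; apply: eq_bigr => k _; rewrite -sumEFin.
apply: integrable_sum => // k _; apply: integrable_sum => // l _.
under eq_fun do rewrite EFinM.
by apply: integrableZl => //; apply: integrable_indic => //; exact: measurable_cell.
Qed.

Lemma integral_step (m : {finite_measure set (measurableTypeR R * measurableTypeR R)%type -> \bar R}) c :
  (\int[m]_q (step c q)%:E = (\sum_(k < N) \sum_(l < N) c k l * fine (m (cell k l)))%:E)%E.
Proof.
have ic k l : m.-integrable [set: R * R] (fun q => (c k l * \1_(cell k l) q)%:E).
  under eq_fun do rewrite EFinM.
  by apply: integrableZl => //; apply: integrable_indic => //; exact: measurable_cell.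
under eq_integral => q _.
  rewrite /step -sumEFin; under eq_bigr do rewrite -sumEFin; over.
rewrite integral_sum//; last by move=> k; apply: integrable_sum => // l _; exact: ic.
rewrite -sumEFin; apply: eq_bigr => k _.
rewrite integral_sum//.
rewrite -sumEFin; apply: eq_bigr => l _.
under eq_integral do rewrite EFinM.
rewrite integralZl//; last by apply: integrable_indic => //; exact: measurable_cell.
rewrite integral_indic//; last exact: measurable_cell.
by rewrite setIT EFinM fineK// fin_num_measure//; exact: measurable_cell.
Qed.

Lemma lambda2_cell k l : (k < N)%N -> (l < N)%N -> fine (lambda2 (cell k l)) = u k * v l.
Proof. by move=> kN lN; rewrite (lambda2_slice u0 v0 u1 v1 kN lN). Qed.

(** [gibbs_density] with [w] the density of the coarse-grained measure, equal to
    [mass k l / (u k * v l)] on each cell and of total mass 1. *)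
Lemma grid_entropy_bound :
  ((\sum_(k < N) \sum_(l < N) (xl (mass k l) - mass k l * (ln (u k) + ln (v l))))%:E
  <= - rel_entropy nu lambda2)%E.
Proof.
rewrite /rel_entropy asboolT// oppeK.
pose f := Radon_Nikodym_SigmaFinite.f nu lambda2.
have f_fin x : f x \is a fin_num by exact: Radon_Nikodym_SigmaFinite.f_fin_num.
have f_ge0 x : (0 <= f x)%E by exact: Radon_Nikodym_SigmaFinite.f_ge0.
have mf : measurable_fun [set: R * R] (fine \o f).
  apply: measurableT_comp => //.
  exact: measurable_int (Radon_Nikodym_SigmaFinite.f_integrable nul).
have fE A : measurable A -> nu A = (\int[lambda2]_(x in A) ((fine \o f) x)%:E)%E.
  move=> mA; rewrite (Radon_Nikodym_SigmaFinite.f_integral nul mA).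
  by apply: eq_integral => x _; rewrite /= fineK.
have fine_ge0 x : 0 <= (fine \o f) x by exact: fine_ge0.
rewrite (@integral_lne_density _ _ _ lambda2 nu _ mf fine_ge0 fE).
pose w := step (fun k l => mass k l / (u k * v l)).
have lnwE q : ln (w q) = step (fun k l => ln (mass k l / (u k * v l))) q.
  by rewrite /w step_comp// ln0.
have -> : \sum_(k < N) \sum_(l < N) (xl (mass k l) - mass k l * (ln (u k) + ln (v l))) =
  \sum_(k < N) \sum_(l < N) ln (mass k l / (u k * v l)) * fine (nu (cell k l)).
  apply: eq_bigr => k _; apply: eq_bigr => l _; rewrite -/(mass k l).
  have := mass_ge0 k l; rewrite le_eqVlt => /predU1P[<-|m0].
    by rewrite xl0 mul0r mulr0 subrr.
  rewrite ln_div ?posrE ?mulr_gt0// lnM ?posrE// /xl; ring.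
rewrite -(integral_step nu (fun k l => ln (mass k l / (u k * v l)))).
under eq_integral do rewrite -lnwE.
apply: (@gibbs_density _ _ _ lambda2 nu _ mf fine_ge0 fE).
- exact: measurable_step.
- move=> q; rewrite /w; have [[k [l [kN lN kl]]]|h] := cellP q; last by rewrite step_out.
  by rewrite (stepE _ kN lN kl) divr_ge0 ?mass_ge0// mulr_ge0// ltW.
- rewrite integral_step lee_fin -mass_total.
  apply: ler_sum => k _; apply: ler_sum => l _.
  by rewrite lambda2_cell// divfK// mulf_neq0// gt_eqF.
(* A cell on which [w] vanishes has [nu]-mass 0, so [w > 0] holds [nu]-almost everywhere. *)
- exists [set q | w q <= 0]; split.
  + rewrite -[X in measurable X]setTI.
    rewrite [X in _ `&` X](_ : _ = w @^-1` `]-oo, 0]); first exact: measurable_step.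
    by apply/seteqP; split => x /=; rewrite in_itv.
  + rewrite measure_cells; last first.
      rewrite -[X in measurable X]setTI.
      rewrite [X in _ `&` X](_ : _ = w @^-1` `]-oo, 0]); first exact: measurable_step.
      by apply/seteqP; split => x /=; rewrite in_itv.
    rewrite big1// => k _; rewrite big1// => l _.
    have := mass_ge0 k l; rewrite le_eqVlt => /predU1P[m0|m0].
      apply: (@subset_measure0 _ _ _ nu _ (cell k l)) => //.
      * apply: measurableI; last exact: measurable_cell.
        rewrite -[X in measurable X]setTI.
        rewrite [X in _ `&` X](_ : _ = w @^-1` `]-oo, 0]); first exact: measurable_step.
        by apply/seteqP; split => x /=; rewrite in_itv.
      * exact: measurable_cell.
      * by have := massE k l; rewrite -m0.
    rewrite [X in nu X](_ : _ = set0) ?measure0//.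
    apply/seteqP; split => q //= [+ kl]; rewrite /w (stepE _ _ _ kl)//.
    by apply/negP; rewrite -ltNge divr_gt0// mulr_gt0.
  + by move=> q /= /negP; rewrite -leNgt.
- have -> : (EFin \o (@ln R \o w)) = EFin \o step (fun k l => ln (mass k l / (u k * v l))).
    by apply/funext => q; rewrite /= lnwE.
  exact: integrable_step.
Qed.

End grid.

(** * The energy as an integral of upper left masses *)

Section energy.
Context {R : realType}.
Variable nu : prob2 R.
Hypothesis nuD : nu unit_square = 1%E.

Local Notation T2 := (measurableTypeR R * measurableTypeR R)%type.

Definition upper_left (q : R * R) : set (R * R) := [set p | p.1 < q.1 /\ q.2 < p.2].
Definition lower_right (q : R * R) : set (R * R) := [set p | q.1 < p.1 /\ p.2 < q.2].

Lemma measurable_upper_left q : measurable (upper_left q).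
Proof.
rewrite (_ : upper_left q = `]-oo, q.1[ `*` `]q.2, +oo[).
  by apply: measurableX; exact: measurable_itv.
by apply/seteqP; split => x; rewrite /upper_left/= !in_itv/= andbT.
Qed.

Lemma measurable_lower_right q : measurable (lower_right q).
Proof.
rewrite (_ : lower_right q = `]q.1, +oo[ `*` `]-oo, q.2[).
  by apply: measurableX; exact: measurable_itv.
by apply/seteqP; split => x; rewrite /lower_right/= !in_itv/= andbT.
Qed.

Lemma measurable_unit_square : measurable (unit_square : set (R * R)).
Proof. by apply: measurableX; exact: measurable_itv. Qed.

Lemma integral_unit_square (f : R * R -> \bar R) : measurable_fun [set: T2] (f : T2 -> \bar R) ->
  (forall x, 0 <= f x)%E ->
  (\int[nu]_(x in unit_square) f x = \int[nu]_x f x)%E.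
Proof.
move=> mf f0; have mC := measurable_unit_square.
have nC : nu (~` unit_square) = 0%E.
  by have := probability_setC nu mC; rewrite nuD subee.
rewrite [RHS](ge0_negligible_integral _ _ _ _ nC)//; last exact: measurableC.
by rewrite setTD setCK.
Qed.

Lemma measurable_inv_pairs : measurable [set z : T2 * T2 | upper_left z.2 z.1].
Proof.
have m11 : measurable_fun [set: T2 * T2] (fun z : T2 * T2 => z.1.1) by exact: measurableT_comp.
have m12 : measurable_fun [set: T2 * T2] (fun z : T2 * T2 => z.1.2) by exact: measurableT_comp.
have m21 : measurable_fun [set: T2 * T2] (fun z : T2 * T2 => z.2.1) by exact: measurableT_comp.
have m22 : measurable_fun [set: T2 * T2] (fun z : T2 * T2 => z.2.2) by exact: measurableT_comp.
rewrite (_ : [set z | _] = [set z : T2 * T2 | z.1.1 < z.2.1] `&` [set z : T2 * T2 | z.2.2 < z.1.2]).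
  have mlt (f g : T2 * T2 -> measurableTypeR R) : measurable_fun [set: T2 * T2] f ->
      measurable_fun [set: T2 * T2] g -> measurable [set z | f z < g z].
    move=> mf mg; rewrite (_ : [set z | _] = [set: T2 * T2] `&`
        (fun z => g z - f z : measurableTypeR R) @^-1` `]0, +oo[).
      by apply: measurable_funB => //; exact: measurable_itv.
    by apply/seteqP; split => z /=; rewrite in_itv/= andbT subr_gt0//; case.
  by apply: measurableI; exact: mlt.
by apply/seteqP; split => z.
Qed.

Lemma upper_left_section q : upper_left q = ysection [set z : T2 * T2 | upper_left z.2 z.1] q.
Proof. by apply/seteqP; split => p; rewrite /ysection/= inE. Qed.

Lemma lower_right_section q : lower_right q = xsection [set z : T2 * T2 | upper_left z.2 z.1] q.
Proof. by apply/seteqP; split => p; rewrite /xsection/= inE. Qed.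

Lemma measurable_upper_left_mass : measurable_fun [set: T2] (fun q : T2 => nu (upper_left q)).
Proof.
under eq_fun do rewrite upper_left_section.
exact: measurable_fun_ysection measurable_inv_pairs.
Qed.

Lemma measurable_lower_right_mass : measurable_fun [set: T2] (fun q : T2 => nu (lower_right q)).
Proof.
under eq_fun do rewrite lower_right_section.
exact: measurable_fun_xsection measurable_inv_pairs.
Qed.

(** Both sides are the mass, under the product of [nu] with itself, of the pairs whose first point
    is to the upper left of the second, computed by sections in either order. *)
Lemma upper_left_lower_right : (\int[nu]_q nu (upper_left q) = \int[nu]_q nu (lower_right q))%E.
Proof.
under eq_integral do rewrite upper_left_section.
under [RHS]eq_integral do rewrite lower_right_section.
apply/esym; apply: (@product_measure_unique _ _ _ _ _ nu nu (nu \x^ nu)%E).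
  by move=> A B mA mB; exact: product_measure2E.
exact: measurable_inv_pairs.
Qed.

Lemma inv_kernelE p q :
  inv_kernel p q = \1_(upper_left q) p + \1_(lower_right q) p :> R.
Proof.
rewrite /inv_kernel !indicE; case: p q => [p1 p2] [q1 q2] /=.
have mU : ((p1, p2) \in upper_left (q1, q2)) = (p1 < q1) && (q2 < p2).
  by apply/idP/idP; rewrite inE => /andP.
have mL : ((p1, p2) \in lower_right (q1, q2)) = (q1 < p1) && (p2 < q2).
  by apply/idP/idP; rewrite inE => /andP.
rewrite mU mL; have [h1|h1|->] := ltgtP p1 q1; have [h2|h2|->] := ltgtP p2 q2 => /=;
  rewrite ?subrr ?mul0r ?mulr0 ?ltxx ?addr0 ?add0r//.
- by rewrite ifF//; apply/negbTE; rewrite -leNgt ltW// nmulr_rgt0 subr_lt0.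
- by rewrite ifT// pmulr_llt0 ?subr_gt0// subr_lt0.
- by rewrite ifT// pmulr_rlt0 ?subr_gt0// subr_lt0.
- by rewrite ifF//; apply/negbTE; rewrite -leNgt ltW// mulr_gt0 ?subr_gt0.
Qed.

(** The kernel is the sum of the two orientations of an inverted pair, which have equal integrals;
    this absorbs the factor 1/2. *)
Lemma energyE : energy nu = (\int[nu]_q nu (upper_left q))%E.
Proof.
have mU := measurable_upper_left_mass; have mL := measurable_lower_right_mass.
rewrite /energy.
have inner q : (\int[nu]_(p in unit_square) (inv_kernel p q)%:E)%E =
    (nu (upper_left q) + nu (lower_right q))%E.
  have mu : measurable_fun [set: T2] (fun p : T2 => (\1_(upper_left q) p : R)%:E).
    by apply/measurable_EFinP; apply: measurable_indic; exact: measurable_upper_left.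
  have ml : measurable_fun [set: T2] (fun p : T2 => (\1_(lower_right q) p : R)%:E).
    by apply/measurable_EFinP; apply: measurable_indic; exact: measurable_lower_right.
  under eq_integral do rewrite inv_kernelE EFinD.
  rewrite integral_unit_square; last 2 first.
  - exact: emeasurable_funD.
  - by move=> p; rewrite adde_ge0// lee_fin.
  rewrite ge0_integralD//; try by move=> p _; rewrite lee_fin.
  rewrite !integral_indic//; [|exact: measurable_lower_right|exact: measurable_upper_left].
  by rewrite !setIT.
under eq_integral do rewrite inner.
rewrite integral_unit_square; last 2 first.
- exact: emeasurable_funD.
- by move=> q; rewrite adde_ge0.
rewrite ge0_integralD// -upper_left_lower_right -mule2n -mule_natl muleA -EFinM.
by rewrite mulVf// mul1e.
Qed.

End energy.

(** * Comparison of the energy with the grid inversions *)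

Section grid_energy.
Context {R : realType}.
Variables (nu : prob2 R) (u v : nat -> R) (N : nat).
Hypotheses (u0 : forall k, 0 < u k) (v0 : forall k, 0 < v k).
Hypotheses (u1 : tau u N = 1) (v1 : tau v N = 1).
Hypothesis nul : nu `<< lambda2.
Hypothesis nuD : nu unit_square = 1%E.

Local Notation p := (mass nu u v).
Local Notation cell := (cell u v).

Let low k l : R := \sum_(m < N | (l < m)%N) \sum_(i < k) p i m.
Let row k : R := \sum_(l < N) p k l.
Let col l : R := \sum_(k < N) p k l.

(** A cell strictly to the left of and above the cell of [q] lies inside [upper_left q]. Any other
    cell that meets [upper_left q] shares a slice with the cell of [q], which costs at most
    [row k + col l]. *)
Lemma upper_left_cell k l q : (k < N)%N -> (l < N)%N -> cell k l q ->
  ((low k l)%:E <= nu (upper_left q) <= (low k l + (row k + col l))%:E)%E.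
Proof.
move=> kN lN [qk ql].
have mU := measurable_upper_left q.
have p0 i j : 0 <= p i j by exact: mass_ge0.
pose a i m := fine (nu (upper_left q `&` cell i m)).
have mUc i m : measurable (upper_left q `&` cell i m).
  by apply: measurableI => //; exact: measurable_cell.
have aE i m : nu (upper_left q `&` cell i m) = (a i m)%:E.
  by rewrite fineK// fin_num_measure//; exact: mUc.
have a0 i m : 0 <= a i m by exact/fine_ge0/measure_ge0.
have ap i m : a i m <= p i m.
  have mc := measurable_cell u v i m; have mi := mUc i m.
  by rewrite -lee_fin -aE -massE; apply: le_measure; rewrite ?inE//; exact: subIsetr.
have -> : nu (upper_left q) = (\sum_(i < N) \sum_(m < N) a i m)%:E.
  rewrite (measure_cells u0 v0 u1 v1 nul)//.
  by rewrite -sumEFin; apply: eq_bigr => i _; rewrite -sumEFin; apply: eq_bigr => m _.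
have lowE : low k l = \sum_(i < N) \sum_(m < N) (if (i < k)%N && (l < m)%N then p i m else 0).
  rewrite /low big_mkcond/= [RHS]exchange_big/=; apply: eq_bigr => m _.
  case: ifP => lm; last by rewrite big1// => i _; rewrite andbF.
  rewrite (big_ord_widen N (fun i => p i m) (ltnW kN)) big_mkcond/=.
  by apply: eq_bigr => i _; rewrite andbT.
have rowE : row k = \sum_(i < N) \sum_(m < N) (if i == k :> nat then p i m else 0).
  rewrite /row [RHS](bigD1 (Ordinal kN))//= [X in _ = _ + X]big1 ?addr0 => [|i ik]; last first.
    by rewrite big1// => m _; case: eqP => // h; move: ik; rewrite -val_eqE/= h eqxx.
  by apply: eq_bigr => m _; rewrite eqxx.
have colE : col l = \sum_(i < N) \sum_(m < N) (if m == l :> nat then p i m else 0).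
  rewrite /col; apply: eq_bigr => i _.
  rewrite (bigD1 (Ordinal lN))//= eqxx big1 ?addr0// => m ml.
  by case: eqP => // h; move: ml; rewrite -val_eqE/= h eqxx.
rewrite !lee_fin lowE rowE colE -!big_split/=; apply/andP; split.
  apply: ler_sum => i _; apply: ler_sum => m _; case: ifP => // /andP[ik lm].
  rewrite -lee_fin -aE -massE (_ : upper_left q `&` cell i m = cell i m)//.
  apply/seteqP; split => x [] // xi xm; split => //; split.
  - exact: (slice_lt u0 ik xi qk).
  - exact: (slice_lt v0 lm ql xm).
apply: ler_sum => i _; rewrite -!big_split/=; apply: ler_sum => m _.
have [ik|ik|ik] := ltngtP i k => /=.
- have [lm|lm|lm] := ltngtP l m => /=.
  + by rewrite !addr0 ap.
  + rewrite !addr0 /a (_ : _ `&` _ = set0) ?measure0//.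
    apply/seteqP; split => x //= [[_ xq] [_ xm]].
    by have := lt_trans xq (slice_lt v0 lm xm ql); rewrite ltxx.
  + by rewrite add0r add0r ap.
- rewrite add0r add0r; apply: (@le_trans _ _ 0); last by case: ifP.
  rewrite /a (_ : _ `&` _ = set0) ?measure0//.
  apply/seteqP; split => x //= [[xq _] [xi _]].
  by have := lt_trans xq (slice_lt u0 ik qk xi); rewrite ltxx.
- by rewrite add0r (le_trans (ap _ _))// lerDl; case: ifP.
Qed.

Lemma slice_cover (w : nat -> R) (M : nat) x : (forall k, 0 < w k) ->
  0 < x <= tau w M -> exists2 k, (k < M)%N & slice w k x.
Proof.
move=> w0; elim: M => [|M IH] /andP[x0 xM].
  by move: xM; rewrite tau0 => /(lt_le_trans x0); rewrite ltxx.
have [h|h] := leP x (tau w M).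
  by have [|k kM xk] := IH; [rewrite x0 h|exists k => //; exact: ltnW].
by exists M => //; rewrite /slice/= in_itv/= h xM.
Qed.

Lemma ae_cell : {ae nu, forall q, exists k l, [/\ (k < N)%N, (l < N)%N & cell k l q]}.
Proof.
have mC : measurable (`]0, 1] `*` `]0, 1] : set (R * R)).
  by apply: measurableX; exact: measurable_itv.
exists (~` (`]0, 1] `*` `]0, 1])); split; first exact: measurableC.
- apply: (null_content_dominatesP _ _).1 nul _ (measurableC mC) _.
  by have := probability_setC lambda2 mC; rewrite lambda2_unit subee.
- move=> q /= h [q1 q2]; apply: h; move: q1 q2; rewrite /= !in_itv/= => q1 q2.
  have [|k kN qk] := @slice_cover u N q.1 u0; first by rewrite u1.
  have [|l lN ql] := @slice_cover v N q.2 v0; first by rewrite v1.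
  by exists k, l.
Qed.

(** [upper_left_cell] integrated over [nu]: the errors [row k + col l], weighted by [p k l], sum to
    the squares of the line masses. *)
Lemma grid_energy_bounds :
  ((strict_inv N N p)%:E <= energy nu <=
   (strict_inv N N p + (\sum_(k < N) row k ^+ 2 + \sum_(l < N) col l ^+ 2))%:E)%E.
Proof.
rewrite energyE//.
have mU := measurable_upper_left_mass nu.
have p0 i j : 0 <= p i j by exact: mass_ge0.
have low0 k l : 0 <= low k l by apply: sumr_ge0 => *; exact: sumr_ge0.
have row0 k : 0 <= row k by exact: sumr_ge0.
have col0 l : 0 <= col l by exact: sumr_ge0.
have stp_ge0 (c : nat -> nat -> R) q : (forall k l, 0 <= c k l) -> 0 <= step u v N c q.
  move=> c0; apply: sumr_ge0 => k _; apply: sumr_ge0 => l _.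
  by rewrite mulr_ge0.
have sI : strict_inv N N p = \sum_(k < N) \sum_(l < N) low k l * fine (nu (cell k l)).
  by rewrite strict_invE; apply: eq_bigr => k _; apply: eq_bigr => l _; rewrite mulrC.
apply/andP; split.
- rewrite sI -(integral_step u v N nu low).
  apply: ae_ge0_le_integral => //.
  + by move=> q _; rewrite lee_fin; exact: stp_ge0.
  + by apply/measurable_EFinP; exact: measurable_step.
  + apply: (filterS (F := almost_everywhere nu) _ ae_cell) => q [k [l [kN lN kl]]] _.
    rewrite (stepE u0 v0 _ kN lN kl).
    by have /andP[] := upper_left_cell kN lN kl.
- have -> : strict_inv N N p + (\sum_(k < N) row k ^+ 2 + \sum_(l < N) col l ^+ 2)
      = \sum_(k < N) \sum_(l < N) (low k l + (row k + col l)) * fine (nu (cell k l)).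
    under [RHS]eq_bigr do under eq_bigr do rewrite mulrDl mulrDl.
    under [RHS]eq_bigr do rewrite !big_split/=.
    rewrite !big_split/= sI; congr (_ + (_ + _)).
      by apply: eq_bigr => k _; rewrite -mulr_sumr expr2.
    by rewrite exchange_big/=; apply: eq_bigr => l _; rewrite -mulr_sumr expr2.
  rewrite -(integral_step u v N nu (fun k l => low k l + (row k + col l))).
  apply: ae_ge0_le_integral => //.
  + by move=> q _; rewrite lee_fin; apply: stp_ge0 => k l; rewrite !addr_ge0.
  + by apply/measurable_EFinP; exact: measurable_step.
  + apply: (filterS (F := almost_everywhere nu) _ ae_cell) => q [k [l [kN lN kl]]] _.
    rewrite (stepE u0 v0 _ kN lN kl).
    by have /andP[] := upper_left_cell kN lN kl.
Qed.

End grid_energy.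

(** * Areas of the blocks and Phi in terms of G and F *)

Section phi_formula.
Context {R : realType}.
Implicit Types (theta beta : R).

Lemma sum_I2 (f : 'I_2 -> R) : \sum_i f i = f 0 + f 1.
Proof.
rewrite big_ord_recl big_ord1; congr (_ + f _).
exact/val_inj.
Qed.

Lemma sum_I22 (f : 'I_2 -> 'I_2 -> R) :
  \sum_i \sum_j f i j = f 0 0 + f 0 1 + (f 1 0 + f 1 1).
Proof. by rewrite !sum_I2. Qed.

Lemma lambda_itv01 (b : bool) theta : 0 <= theta <= 1 ->
  lambda [set` Interval (BSide b (0 : R)) (BRight theta)] = theta%:E.
Proof.
move=> /andP[t0 t1]; rewrite /lambda /mrestr (setIidl _).
  rewrite lebesgue_measure_itv/= lte_fin; case: ltP => h; first by rewrite oppr0 adde0.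
  by congr EFin; lra.
move=> x /=; rewrite !in_itv/= => /andP[x0 xt]; rewrite (le_trans xt)// andbT.
by case: b x0 => // /ltW.
Qed.

Lemma lambda_Lpart (i : 'I_2) theta : 0 < theta < 1 ->
  lambda (Lpart i theta) = (if i == 0 then theta else 1 - theta)%:E.
Proof.
move=> /andP[t0 t1]; rewrite /Lpart; case: ifP => _.
  by rewrite lambda_itv01// !ltW.
by rewrite lambda_itv// ltW.
Qed.

Lemma measurable_Lpart (i : 'I_2) theta : measurable (Lpart i theta).
Proof. by rewrite /Lpart; case: ifP => _; exact: measurable_itv. Qed.

Lemma area_Lambda theta1 theta2 (i j : 'I_2) : 0 < theta1 < 1 -> 0 < theta2 < 1 ->
  area (Lambda theta1 theta2 i j) =
  (if i == 0 then theta1 else 1 - theta1) * (if j == 0 then theta2 else 1 - theta2).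
Proof.
move=> h1 h2; rewrite /area /Lambda lambda2_setX; [|exact: measurable_Lpart..].
by rewrite !lambda_Lpart// -EFinM.
Qed.

Lemma xl_div (t w : R) : 0 <= t -> 0 < w -> t * ln (t / w) = xl t - t * ln w.
Proof.
rewrite le_eqVlt => /predU1P[<- w0|t0 w0]; first by rewrite xl0 !mul0r subrr.
by rewrite ln_div ?posrE// mulrBr.
Qed.

(** The logarithm of an area splits into two one-dimensional ones, collected along the row and
    column sums of [t], while [t ln t] and [t p(beta t)] combine into [Gent]. This is the shape
    produced by [discrete_bound]. *)
Lemma PhiE beta theta1 theta2 (t : 'M[R]_2) :
  0 < theta1 < 1 -> 0 < theta2 < 1 -> (forall i j, 0 <= t i j) ->
  Phi beta theta1 theta2 t = pressure beta +
  (Gent beta (t 0 0) + Gent beta (t 0 1) + Gent beta (t 1 0) + Gent beta (t 1 1)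
  - Fpress beta (t 0 0 + t 0 1) - Fpress beta (t 1 0 + t 1 1)
  - Fpress beta (t 0 0 + t 1 0) - Fpress beta (t 0 1 + t 1 1)
  - (t 0 0 + t 0 1) * ln theta1 - (t 1 0 + t 1 1) * ln (1 - theta1)
  - (t 0 0 + t 1 0) * ln theta2 - (t 0 1 + t 1 1) * ln (1 - theta2)
  + beta * (t 0 1 * t 1 0)).
Proof.
move=> h1 h2 t0.
have [/andP[a0 a1] /andP[b0 b1]] := (h1, h2).
have a1' : 0 < 1 - theta1 by lra.
have b1' : 0 < 1 - theta2 by lra.
rewrite /Phi.
have aE i j := area_Lambda i j h1 h2.
rewrite (sum_I22 (fun i j => t i j * ln (t i j / area (Lambda theta1 theta2 i j)))).
rewrite (sum_I22 (fun i j => t i j * pressure (beta * t i j))).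
rewrite !aE.
rewrite eqxx.
rewrite [1 == 0 :> 'I_2](_ : _ = false)//.
rewrite !xl_div// ?mulr_gt0//.
rewrite !lnM ?posrE//.
rewrite /Gent /Fpress; ring.
Qed.

End phi_formula.

(** * Refinement of the grid and the lower bound *)

Section lower_bound.
Context {R : realType}.
Variables (beta theta1 theta2 : R) (t : 'M[R]_2).
Hypotheses (h1 : 0 < theta1 < 1) (h2 : 0 < theta2 < 1).
Variable nu : prob2 R.
Hypothesis nuW : W theta1 theta2 t nu.

(** Finite energy keeps [rate] from being an undetermined difference of infinities: it is [+oo]
    whenever the entropy is [-oo], for either sign of [beta]. *)
Lemma energy_fin : energy nu \is a fin_num.
Proof.
have [nuD _] := nuW.
rewrite energyE// ge0_fin_numE; last by apply: integral_ge0.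
apply: (@le_lt_trans _ _ (\int[nu]_q (cst 1%E : R * R -> \bar R) q)%E).
  apply: ge0_le_integral => //; first exact: measurable_upper_left_mass.
  by move=> q _; apply: probability_le1; exact: measurable_upper_left.
rewrite integral_cst// mul1e.
exact: le_lt_trans (probability_le1 nu measurableT) (ltry 1).
Qed.

(** With [n] equal slices on each side, [theta] is a grid point and the blocks are unions of cells,
    up to the coordinate lines through 0. *)
Definition mesh (theta : R) (n k : nat) : R :=
  if (k < n)%N then theta / n%:R else (1 - theta) / n%:R.

Lemma mesh_gt0 theta n k : 0 < theta < 1 -> (0 < n)%N -> 0 < mesh theta n k.
Proof.
move=> /andP[t0 t1] n0; have n0' : 0 < n%:R :> R by rewrite ltr0n.
by rewrite /mesh; case: ifP => _; rewrite divr_gt0//; lra.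
Qed.

Lemma mesh_le theta n k : 0 < theta < 1 -> (0 < n)%N -> mesh theta n k <= n%:R^-1.
Proof.
move=> /andP[t0 t1] n0; have n0' : 0 < n%:R :> R by rewrite ltr0n.
by rewrite /mesh; case: ifP => _; rewrite -[leRHS]mul1r ler_wpM2r ?invr_ge0 ?ltW//; lra.
Qed.

Lemma tau_mesh1 theta n : (0 < n)%N -> tau (mesh theta n) n = theta.
Proof.
move=> n0; have n0' : n%:R != 0 :> R by rewrite pnatr_eq0 -lt0n.
rewrite /tau (eq_bigr (fun=> theta / n%:R)) => [|i _]; last by rewrite /mesh ltn_ord.
by rewrite sumr_const card_ord -[LHS]mulr_natr divfK.
Qed.

Lemma sum_mesh2 theta n : (0 < n)%N ->
  \sum_(k < n) mesh theta n (n + k)%N = 1 - theta.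
Proof.
move=> n0; have n0' : n%:R != 0 :> R by rewrite pnatr_eq0 -lt0n.
rewrite (eq_bigr (fun=> (1 - theta) / n%:R)) => [|i _]; last first.
  by rewrite /mesh ltnNge leq_addr.
by rewrite sumr_const card_ord -[LHS]mulr_natr divfK.
Qed.

Lemma tau_mesh2 theta n : (0 < n)%N -> tau (mesh theta n) (n + n) = 1.
Proof.
move=> n0; rewrite /tau (sum_ord_add n n) -/(tau _ _) tau_mesh1// sum_mesh2//.
by rewrite addrC subrK.
Qed.

(** The epsilon-delta form of absolute continuity holds for the variation of the charge attached to
    [nu], and this variation bounds [nu]. *)
Lemma dominated_small : nu `<< lambda2 -> forall e : R, 0 < e ->
  exists2 d : R, 0 < d & forall A, measurable A -> (lambda2 A < d%:E)%E -> (nu A < e%:E)%E.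
Proof.
move=> nul e e0.
have [P [M PM]] := Hahn_decomposition (charge_of_finite_measure nu).
have [d [d0 H]] := charge_variation_continuous PM nul e0.
exists d => // A mA Ad; apply: le_lt_trans (H A mA Ad).
have := abse_charge_variation PM mA; apply: le_trans.
by rewrite gee0_abs//; exact: measure_ge0.
Qed.

(** Of the five units of error, [discrete_bound] costs three (rows once, columns twice), and
    replacing the energy by the grid inversions costs two. *)
Lemma grid_rate_bound (e : R) : nu `<< lambda2 -> 0 < e ->
  ((Phi beta theta1 theta2 t - `|beta| * (e *+ 5))%:E <= rate beta nu)%E.
Proof.
move=> nul e0; have [nuD nuL] := nuW.
have [d d0 H] := dominated_small nul e0.
(* A grid line is at most [n^-1] wide, so [n^-1 < d] forces its [nu]-mass below [e]. *)
have [n n0 nd] : exists2 n : nat, (0 < n)%N & n%:R^-1 < d.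
  exists (Num.truncn d^-1).+1 => //.
  rewrite -[ltRHS]invrK ltf_pV2 ?posrE ?invr_gt0//.
  by have := @truncnS_gt _ d^-1; exact.
pose u := mesh theta1 n; pose v := mesh theta2 n; pose N := (n + n)%N.
have u0 k : 0 < u k by exact: mesh_gt0.
have v0 k : 0 < v k by exact: mesh_gt0.
have u1 : tau u N = 1 by exact: tau_mesh2.
have v1 : tau v N = 1 by exact: tau_mesh2.
pose p := mass nu u v.
have p0 k l : 0 <= p k l by exact: mass_ge0.
have block i j (A B : set R) : `]tau u i, tau u (i + n)%N]%classic = A `&` `]0, 1] ->
    `]tau v j, tau v (j + n)%N]%classic = B `&` `]0, 1] ->
    measurable A -> measurable B ->
    (\sum_(k < n) \sum_(l < n) p (i + k)%N (j + l)%N)%:E = nu (A `*` B).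
  move=> EA EB mA mB; have mAB : measurable (A `*` B) by exact: measurableX.
  rewrite (sum_mass _ u0 v0) EA EB (measure_unit nul mAB).
  by congr (nu _); apply/seteqP; split => x /=; [move=> [[? ?] [? ?]]|move=> [[? ?] [? ?]]].
have [/andP[a0 a1] /andP[b0 b1]] := (h1, h2).
have EL (w : R) (x : nat -> R) : 0 < w < 1 -> tau x n = w -> tau x (n + n)%N = 1 ->
    `]tau x 0, tau x (0 + n)%N]%classic = Lpart 0 w `&` `]0, 1] /\
    `]tau x n, tau x (n + n)%N]%classic = Lpart 1 w `&` `]0, 1].
  move=> /andP[w0 w1] xn xN; rewrite tau0 add0n xn xN /Lpart/=; split.
    apply/seteqP; split => y /=; rewrite !in_itv/=.
      by move=> /andP[y0 yw]; rewrite y0 yw (ltW y0) (le_trans yw (ltW w1)).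
    by move=> [/andP[_ ->] /andP[-> _]].
  apply/seteqP; split => y /=; rewrite !in_itv/=.
    by move=> /andP[y0 yw]; rewrite y0 yw (lt_trans w0 y0).
  by move=> [/andP[-> _] /andP[_ ->]].
have [ux0 ux1] := EL _ u h1 (tau_mesh1 theta1 n0) u1.
have [vx0 vx1] := EL _ v h2 (tau_mesh1 theta2 n0) v1.
have B (i j : 'I_2) (i' j' : nat) : `]tau u i', tau u (i' + n)%N]%classic = Lpart i theta1 `&` `]0, 1] ->
    `]tau v j', tau v (j' + n)%N]%classic = Lpart j theta2 `&` `]0, 1] ->
    \sum_(k < n) \sum_(l < n) p (i' + k)%N (j' + l)%N = t i j.
  move=> Ei Ej; apply: EFin_inj.
  by rewrite (block _ _ _ _ Ei Ej) ?nuL//; exact: measurable_Lpart.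
have := discrete_bound beta p0 u0 v0 (B 0 0 0%N 0%N ux0 vx0) (B 0 1 0%N n ux0 vx1)
  (B 1 0 n 0%N ux1 vx0) (B 1 1 n n ux1 vx1).
have -> : \sum_(k < n) u k = theta1 by exact: tau_mesh1.
have -> : \sum_(k < n) v k = theta2 by exact: tau_mesh1.
rewrite !sum_mesh2// -/N.
have row_le k : (k < N)%N -> 0 <= \sum_(l < N) p k l <= e.
  move=> kN; apply/andP; split; first exact: sumr_ge0.
  rewrite -lee_fin (mass_row _ u0 v0 v1) ltW// H//.
    by apply: measurableX; exact: measurable_itv.
  rewrite lambda2_setX; [|exact: measurable_itv..].
  rewrite (lambda_itv01 false) ?ler01 ?lexx// mule1 lambda_itv ?tauS//.
  - by rewrite addrAC subrr add0r lte_fin (le_lt_trans _ nd)// mesh_le.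
  - by rewrite -(tau0 u); exact: tau_le.
  - by rewrite lerDl ltW.
  - by rewrite -tauS -u1; exact: tau_le.
have col_le l : (l < N)%N -> 0 <= \sum_(k < N) p k l <= e.
  move=> lN; apply/andP; split; first exact: sumr_ge0.
  rewrite -lee_fin (mass_col _ u0 v0 u1) ltW// H//.
    by apply: measurableX; exact: measurable_itv.
  rewrite lambda2_setX; [|exact: measurable_itv..].
  rewrite (lambda_itv01 false) ?ler01 ?lexx// mul1e lambda_itv ?tauS//.
  - by rewrite addrAC subrr add0r lte_fin (le_lt_trans _ nd)// mesh_le.
  - by rewrite -(tau0 v); exact: tau_le.
  - by rewrite lerDl ltW.
  - by rewrite -tauS -v1; exact: tau_le.
have tot : \sum_(k < N) \sum_(l < N) p k l = 1 by exact: mass_total.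
(* Each line mass is at most [e], and the line masses sum to 1. *)
have row2 : \sum_(k < N) (\sum_(l < N) p k l) ^+ 2 <= e.
  by rewrite (le_trans (sumr_sqr_le row_le))// tot mulr1.
have col2 : \sum_(l < N) (\sum_(k < N) p k l) ^+ 2 <= e.
  by rewrite (le_trans (sumr_sqr_le col_le))// exchange_big/= tot mulr1.
have := grid_energy_bounds u0 v0 u1 v1 nul nuD.
have := grid_entropy_bound u0 v0 u1 v1 nul.
rewrite -/p -/N /rate -(fineK energy_fin).
set S := rel_entropy _ _; set K := \sum_(k < N) \sum_(l < N) _.
set E := fine _; set s := strict_inv _ _ _.
rewrite !lee_fin => KS /andP[sE Es] HD.
rewrite PhiE//; last first.
  by move=> i j; rewrite -lee_fin -nuL; exact: measure_ge0.
apply: (@le_trans _ _ (K%:E + beta%:E * E%:E + (pressure beta)%:E)%E); last first.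
  by rewrite leeD2r// leeD2r.
rewrite -EFinM -!EFinD lee_fin.
(* The bracket of [PhiE] is made opaque; what remains is linear in it and in the error terms. *)
move: HD; set X := (X in X <= _) => HD; rewrite -/X; move: X HD => X HD.
have b0' := normr_ge0 beta.
have bE : beta * s - beta * E <= `|beta| * (e *+ 2).
  rewrite -mulrBr (le_trans (ler_norm _))// normrM ler_wpM2l//.
  rewrite ler_norml mulr2n; apply/andP; split; lra.
have bq : `|beta| * (\sum_(k < N) (\sum_(l < N) p k l) ^+ 2
    + 2 * \sum_(l < N) (\sum_(k < N) p k l) ^+ 2) <= `|beta| * (e *+ 3).
  by rewrite ler_wpM2l// !mulrS; lra.
have -> : `|beta| * (e *+ 5) = `|beta| * (e *+ 2) + `|beta| * (e *+ 3).
  by rewrite -mulrDr -mulrnDr.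
lra.
Qed.

Lemma rate_ge_Phi : ((Phi beta theta1 theta2 t)%:E <= rate beta nu)%E.
Proof.
have [nul|nul] := pselect (nu `<< lambda2); last first.
  rewrite /rate /rel_entropy asboolF//= -(fineK energy_fin) -EFinM.
  by rewrite !addye ?leey.
apply/lee_addgt0Pr => e e0.
(* The summand 1 keeps the divisor positive when [beta = 0]. *)
have c0 : 0 < (`|beta| + 1) *+ 5 by rewrite pmulrn_lgt0// ltr_wpDl.
pose q := e / ((`|beta| + 1) *+ 5).
have q0 : 0 < q by rewrite divr_gt0.
have eE : e = q * ((`|beta| + 1) *+ 5) by rewrite divfK// gt_eqF.
move: (Phi _ _ _ _) (grid_rate_bound nul q0) => P.
move: (rate _ _) => r.
rewrite EFinB leeBlDr// => /le_trans; apply.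
rewrite leeD2l// lee_fin [leRHS]eE !mulrnAr lerMn2r/= mulrDr mulr1 mulrC lerDl.
exact: ltW.
Qed.

End lower_bound.

(** * The law of a vertical strip *)

Ltac unscale := rewrite ?fctE /GRing.scale/= ?fctE /GRing.scale/=.

Section block_density.
Context {R : realType}.
Variable beta : R.

Local Notation brk := (brk beta).

Lemma is_derive_exp_affine (x : R) :
  is_derive x (1 : R) (fun z : R => expR (- (beta * z))) (- beta * expR (- (beta * x))).
Proof.
have d : is_derive x (1 : R) (fun z : R => - (beta * z)) (- beta).
  have := is_deriveN (is_deriveZ beta (is_derive_id x (1 : R))).
  by rewrite /GRing.scale/= mulr1.
have e := @is_derive1_comp _ (@expR R) (fun z : R => - (beta * z)) x _ _
  (is_derive_expR (- (beta * x))) d.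
by apply: (is_derive_eq e); rewrite mulrC.
Qed.

Lemma is_derive_brk (x : R) : is_derive x (1 : R) brk (expR (- (beta * x))).
Proof.
rewrite /brk; have [b0|b0] := eqVneq beta 0.
  rewrite b0 mul0r oppr0 expR0.
  by apply: (is_derive_eq (is_derive_id x (1 : R))).
have e := is_deriveZ beta^-1 (is_deriveB (is_derive_cst (1 : R) x (1 : R)) (is_derive_exp_affine x)).
have -> : (fun z : R => (1 - expR (- (beta * z))) / beta) =
    (beta^-1 \*: (cst 1 - (fun z : R => expR (- (beta * z))))).
  by apply/funext => z; rewrite mulrC.
by apply: (is_derive_eq e); rewrite /GRing.scale/=; field.
Qed.

Lemma is_derive_continuous (f : R -> R) (x df : R) :
  is_derive x (1 : R) f df -> {for x, continuous f}.
Proof.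
by move=> [dx _]; apply: differentiable_continuous; apply/derivable1_diffP.
Qed.

Lemma continuous_brk : continuous brk.
Proof. by move=> x; exact: is_derive_continuous (is_derive_brk x). Qed.

Lemma expRbrk (z : R) : expR (- (beta * z)) = 1 - beta * brk z.
Proof.
rewrite /brk; have [->|b0] := eqVneq beta 0; first by rewrite !mul0r oppr0 expR0 addr0.
by field.
Qed.

Lemma brk_le (x y : R) : 0 <= x -> x <= y -> brk x <= brk y.
Proof.
move=> x0 xy; rewrite -(subrK x y) -brkD lerDr mulr_ge0 ?expR_ge0//.
by rewrite brk_ge0// subr_ge0.
Qed.

Definition den (m u v : R) : R := 1 - beta * brk u * brk v / brk m.

(** With [r = [v] / [m]] in [0, 1] the denominator is the convex combination
    [(1 - r) + r e^(-beta u)], whose two values are at least [e^(-|beta| m)]. Uniformity in [u] and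
    [v] later makes the density bounded. *)
Lemma den_lb (m u v : R) : 0 < m -> 0 <= u <= m -> 0 <= v <= m ->
  expR (- `|beta|* m) <= den m u v.
Proof.
move=> m0 /andP[u0 um] /andP[v0 vm].
have B0 := brk_gt0 beta m0.
pose r := brk v / brk m.
have r01 : 0 <= r <= 1.
  by rewrite divr_ge0 ?brk_ge0 ?(ltW m0)//= ler_pdivrMr// mul1r brk_le.
have -> : den m u v = (1 - r) + r * expR (- (beta * u)).
  by rewrite /den expRbrk /r; ring.
have e1 : expR (- `|beta| * m) <= 1.
  by rewrite -[leRHS]expR0 ler_expR mulNr oppr_le0 mulr_ge0// ltW.
have e2 : expR (- `|beta| * m) <= expR (- (beta * u)).
  rewrite ler_expR mulNr lerN2 (le_trans (ler_norm _))// normrM (ger0_norm u0).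
  by rewrite ler_wpM2l.
move: r01 => /andP[r0 r1].
have := ler_wpM2l r0 e2.
have : (1 - r) * expR (- `|beta| * m) <= (1 - r) * 1 by rewrite ler_wpM2l// subr_ge0.
lra.
Qed.

Lemma den_gt0 (m u v : R) : 0 < m -> 0 <= u <= m -> 0 <= v <= m -> 0 < den m u v.
Proof. by move=> m0 um vm; apply: lt_le_trans (den_lb m0 um vm); exact: expR_gt0. Qed.

(* The distribution function N and its derivatives d/dv N and d^2/dudv N; the
   latter is the density of the Mallows limit of total mass m, with uniform
   marginals on [0, m]. *)
Definition Ncdf (m u v : R) : R :=
  if beta == 0 then u * v / m else - ln (den m u v) / beta.
Definition Ncdf_v (m u v : R) : R := brk u * expR (- (beta * v)) / (brk m * den m u v).
Definition Ncdf_uv (m u v : R) : R :=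
  expR (- (beta * u)) * expR (- (beta * v)) / (brk m * den m u v ^+ 2).

Lemma denC (m u v : R) : den m u v = den m v u.
Proof. by rewrite /den [beta * _ * _]mulrAC. Qed.

Lemma NcdfC (m u v : R) : Ncdf m u v = Ncdf m v u.
Proof. by rewrite /Ncdf denC [u * v]mulrC. Qed.

Lemma is_derive_den (m u v : R) :
  is_derive v (1 : R) (fun v : R => den m u v) (- (beta * brk u * expR (- (beta * v)) / brk m)).
Proof.
have e := is_deriveB (is_derive_cst (1 : R) v (1 : R))
  (is_deriveZ (beta * brk u / brk m) (is_derive_brk v)).
have -> : (fun v : R => den m u v) = cst 1 - (beta * brk u / brk m) \*: brk.
  by apply/funext => z; rewrite /den/=; congr (1 - _); rewrite /GRing.scale/= mulrAC.
by apply: (is_derive_eq e); rewrite /GRing.scale/=; ring.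
Qed.

Lemma is_derive_Ncdf (m u v : R) : 0 < m -> 0 < den m u v ->
  is_derive v (1 : R) (fun v : R => Ncdf m u v) (Ncdf_v m u v).
Proof.
move=> m0 d0; have B0 := brk_gt0 beta m0; rewrite /Ncdf /Ncdf_v.
have [b0|b0] := eqVneq beta 0.
  have e := is_deriveZ (u / m) (is_derive_id v (1 : R)).
  have -> : (fun v : R => u * v / m) = (u / m) \*: id.
    by apply/funext => z; rewrite mulrAC.
  apply: (is_derive_eq e); rewrite /GRing.scale/= mulr1 /den b0 !mul0r oppr0 expR0 addr0.
  by rewrite !brk_beta0 !mulr1.
have e := is_deriveZ (- beta^-1) (@is_derive1_comp _ (@ln R) (fun v : R => den m u v) v _ _
  (is_derive1_ln d0) (is_derive_den m u v)).
have -> : (fun v : R => - ln (den m u v) / beta) = (- beta^-1) \*: (@ln R \o (fun v : R => den m u v)).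
  by apply/funext => z; unscale; ring.
apply: (is_derive_eq e); rewrite /GRing.scale/=; field.
by rewrite b0 !gt_eqF.
Qed.

Lemma is_derive_Ncdf_v (m u v : R) : 0 < m -> 0 < den m u v ->
  is_derive u (1 : R) (fun u : R => Ncdf_v m u v) (Ncdf_uv m u v).
Proof.
move=> m0 d0; have B0 := brk_gt0 beta m0.
have dd : is_derive u (1 : R) (fun u : R => den m u v)
    (- (beta * brk v * expR (- (beta * u)) / brk m)).
  have := is_derive_den m v u; rewrite (_ : (fun u : R => den m v u) = (fun u : R => den m u v))//.
  by apply/funext => z; rewrite denC.
have dn : den m u v != 0 by rewrite gt_eqF.
have e := is_deriveZ (expR (- (beta * v)) / brk m)
  (is_deriveM (is_derive_brk u) (@is_deriveV R (fun u : R => den m u v) u _ 1 dn dd)).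
have -> : (fun u : R => Ncdf_v m u v) =
    (expR (- (beta * v)) / brk m) \*: (brk * (fun u : R => (den m u v)^-1)).
  by apply/funext => z; unscale; rewrite /Ncdf_v invfM; ring.
apply: (is_derive_eq e); rewrite /GRing.scale/= /Ncdf_uv.
set D := den m u v in dn *.
(* Trading the product [[u] [v]] for [1 - D] leaves an identity that is rational in [D]. *)
have h : beta * brk u * brk v / brk m = 1 - D by rewrite /D /den; ring.
transitivity (expR (- (beta * v)) * expR (- (beta * u)) / brk m *
    (D^-1 + beta * brk u * brk v / brk m * D ^- 2)); first by ring.
by rewrite h; field; rewrite dn gt_eqF.
Qed.

Lemma Ncdf_v0 (m v : R) : Ncdf_v m 0 v = 0.
Proof. by rewrite /Ncdf_v brk0 !mul0r. Qed.

(** For [u = m] the denominator collapses to [1 - beta [v] = e^(-beta v)]: the second marginal is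
    uniform on [[0, m]]. *)
Lemma Ncdf_vm (m v : R) : 0 < m -> Ncdf_v m m v = 1.
Proof.
move=> m0; have B0 := brk_gt0 beta m0; rewrite /Ncdf_v.
have -> : den m m v = expR (- (beta * v)).
  by rewrite expRbrk /den; field; rewrite gt_eqF.
by rewrite divff// mulf_neq0 ?gt_eqF// expR_gt0.
Qed.

Lemma Ncdf_m (m u : R) : 0 < m -> Ncdf m u m = u.
Proof.
move=> m0; have B0 := brk_gt0 beta m0; rewrite /Ncdf.
have [b0|b0] := eqVneq beta 0; first by rewrite mulfK// gt_eqF.
have -> : den m u m = expR (- (beta * u)).
  by rewrite expRbrk /den; field; rewrite gt_eqF.
by rewrite expRK opprK mulrC mulKf.
Qed.

Lemma Ncdf_0 (m u : R) : Ncdf m u 0 = 0.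
Proof.
rewrite /Ncdf mulr0 mul0r /den brk0 mulr0 mul0r subr0 ln1 oppr0 mul0r.
by case: ifP.
Qed.

Lemma Ncdf_uv_ge0 (m u v : R) : 0 <= m -> 0 <= Ncdf_uv m u v.
Proof. move=> m0; apply: divr_ge0; apply: mulr_ge0;
  [exact: expR_ge0|exact: expR_ge0|exact: brk_ge0|exact: sqr_ge0]. Qed.

Lemma ln_Ncdf_uv (m u v : R) : 0 < m -> 0 < den m u v ->
  ln (Ncdf_uv m u v) = - ln (brk m) - beta * (u + v - 2 * Ncdf m u v).
Proof.
move=> m0 d0; have B0 := brk_gt0 beta m0.
rewrite /Ncdf_uv ln_div ?posrE ?mulr_gt0 ?expR_gt0 ?exprn_gt0//.
rewrite (lnM (x := expR _)) ?posrE ?expR_gt0// lnM ?posrE ?exprn_gt0// !expRK lnXn// /Ncdf.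
have [b0|b0] := eqVneq beta 0.
  have -> : den m u v = 1 by rewrite /den b0 !mul0r subr0.
  by rewrite ln1 b0 mul0rn; ring.
by field.
Qed.

(** This is [z] times the derivative of [phi], that is [z e^(-beta z) / [z] - 1] for [z > 0];
    writing it through [phi (- z)] extends it continuously to 0. *)
Definition chi (z : R) : R := expR (- phi beta (- z)) - 1.

Lemma chi0 : chi 0 = 0.
Proof. by rewrite /chi oppr0 phi0 oppr0 expR0 subrr. Qed.

Lemma brkN (z : R) : brk (- z) = - (expR (beta * z) * brk z).
Proof.
have := brkD beta (- z) z; rewrite addNr brk0 => /eqP; rewrite addr_eq0 => /eqP h.
have e : expR (beta * z) * expR (- (beta * z)) = 1 by rewrite -expRD subrr expR0.
by rewrite -[LHS]mul1r -e -mulrA h mulrN.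
Qed.

Lemma chiE (z : R) : 0 < z -> chi z = z * expR (- (beta * z)) / brk z - 1.
Proof.
move=> z0; have B0 := brk_gt0 beta z0; rewrite /chi; congr (_ - 1).
have := brk_ratio beta (_ : - z != 0); rewrite oppr_eq0 gt_eqF// => /(_ isT).
rewrite brkN mulNr => /oppr_inj h.
have p0 := expR_gt0 (phi beta (- z)); have e0 := expR_gt0 (beta * z).
rewrite !expRN; apply: (mulIf (_ : expR (phi beta (- z)) != 0)); first by rewrite gt_eqF.
rewrite mulVf ?gt_eqF//.
have -> : expR (phi beta (- z)) = expR (beta * z) * brk z / z.
  by rewrite h mulrC mulKf// gt_eqF.
by field; rewrite !gt_eqF.
Qed.

Lemma continuous_chi : continuous chi.
Proof.
move=> z; apply: cvgB; last exact: cvg_cst.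
apply: continuous_comp; last exact: continuous_expR.
apply: continuousN; apply: continuous_comp; last exact: continuous_phi.
exact: opp_continuous.
Qed.

(* Primitive in u of beta * Ncdf_uv m u v * (v - Ncdf m u v), found by parts. *)
Definition Nprim (m u v : R) : R :=
  Ncdf_v m u v * (beta * (v - Ncdf m u v) + 1) - Ncdf m u v * (expR (- (beta * v)) / brk v).

Lemma is_derive_Nprim (m u v : R) : 0 < m -> 0 < v -> 0 < den m u v ->
  is_derive u (1 : R) (fun u : R => Nprim m u v)
    (beta * (Ncdf_uv m u v * (v - Ncdf m u v))).
Proof.
move=> m0 v0 d0; have Bm := brk_gt0 beta m0; have Bv := brk_gt0 beta v0.
have dNv := is_derive_Ncdf_v m0 d0.
have dN : is_derive u (1 : R) (fun u : R => Ncdf m u v) (Ncdf_v m v u).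
  rewrite (_ : (fun u : R => Ncdf m u v) = (fun u : R => Ncdf m v u)).
    by apply: is_derive_Ncdf => //; rewrite denC.
  by apply/funext => z; rewrite NcdfC.
have d1 := is_deriveD (is_deriveZ beta (is_deriveB (is_derive_cst v u (1 : R)) dN))
  (is_derive_cst (1 : R) u (1 : R)).
have d2 := is_deriveB (is_deriveM dNv d1) (is_deriveZ (expR (- (beta * v)) / brk v) dN).
have -> : (fun u : R => Nprim m u v) =
  (fun u : R => Ncdf_v m u v) * (beta \*: (cst v - (fun u : R => Ncdf m u v)) + cst 1)
  - (expR (- (beta * v)) / brk v) \*: (fun u : R => Ncdf m u v).
  by apply/funext => z; unscale; rewrite /Nprim [_ * Ncdf _ _ _]mulrC.
apply: (is_derive_eq d2); unscale.
have dn : den m u v != 0 by rewrite gt_eqF.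
suff h : Ncdf_uv m u v = Ncdf_v m v u * (beta * Ncdf_v m u v + expR (- (beta * v)) / brk v).
  move: (Ncdf_v m v u) (Ncdf_v m u v) (Ncdf_uv m u v) (Ncdf m u v) (expR _ / _) h.
  by move=> Nu Nv Nuv N' c ->; ring.
rewrite /Ncdf_uv /Ncdf_v [den m v u]denC.
set D := den m u v in dn *.
have h : beta * brk u * brk v / brk m = 1 - D by rewrite /D /den; ring.
transitivity (expR (- (beta * u)) * expR (- (beta * v)) / (brk m * D) *
    (beta * brk u * brk v / brk m / D + 1)); last by field; rewrite dn !gt_eqF.
by rewrite h; field; rewrite dn gt_eqF.
Qed.

(** At [u = 0] both [N] and [N_v] vanish; at [u = m] one has [N = v] and [N_v = 1]. *)
Lemma Nprim_diff (m v : R) : 0 < m -> 0 < v -> Nprim m m v - Nprim m 0 v = - chi v.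
Proof.
move=> m0 v0; rewrite /Nprim Ncdf_vm// Ncdf_v0 !(NcdfC _ _ v) Ncdf_m// Ncdf_0 chiE//.
by rewrite subrr; ring.
Qed.

End block_density.

(** * The optimal path *)

Section path.
Context {R : realType}.
Variables (beta s t : R).
Hypotheses (s0 : 0 <= s) (t0 : 0 <= t).

Local Notation brk := (brk beta).
Local Notation G := (Gent beta).

(** At masses [(A, B)] equality in [Gent_HJ] asks for speeds in the ratio [e^(-beta B) [A] : [B]].
    Along a solution this ratio is [P e^(-beta C) : Q], and the present [P] and [Q] make the path
    end at [(s, t)]: by the addition formula [P + Q = e^(beta s) [s + t]], while [pathD (s + t) =
    [s + t]]. *)
Definition pathP : R := expR (beta * s) * brk s.
Definition pathQ : R := brk t.
Definition pathD (C : R) : R := pathP * expR (- (beta * C)) + pathQ.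
Definition rate1 (C : R) : R := pathP * expR (- (beta * C)) / pathD C.
Definition rate2 (C : R) : R := pathQ / pathD C.

(* The optimal monotone path from (0, 0) to (s, t) in the two-species problem,
   parametrized by C = path1 C + path2 C. *)
Definition path1 (C : R) : R :=
  if beta == 0 then s * C / (s + t) else ln ((pathP + pathQ) / pathD C) / beta.
Definition path2 (C : R) : R := C - path1 C.

Lemma pathP_ge0 : 0 <= pathP. Proof. by rewrite mulr_ge0 ?expR_ge0// brk_ge0. Qed.

Lemma pathQ_ge0 : 0 <= pathQ. Proof. exact: brk_ge0. Qed.

Lemma pathPQ : pathP + pathQ = expR (beta * s) * brk (s + t).
Proof.
rewrite addrC [s + t]addrC -brkD mulrDr mulrA -expRD subrr expR0 mul1r addrC.
by rewrite /pathP /pathQ addrC.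
Qed.

Lemma pathD0 : pathD 0 = pathP + pathQ.
Proof. by rewrite /pathD mulr0 oppr0 expR0 mulr1. Qed.

Lemma pathDM : pathD (s + t) = brk (s + t).
Proof.
rewrite -(brkD _ s t) /pathD /pathP /pathQ; congr (_ + _).
by rewrite mulrAC -expRD; congr (expR _ * _); ring.
Qed.

Lemma pathD_ge0 C : 0 <= pathD C.
Proof. by rewrite addr_ge0 ?pathQ_ge0// mulr_ge0 ?expR_ge0// pathP_ge0. Qed.

Lemma rate1_ge0 C : 0 <= rate1 C.
Proof.
apply: divr_ge0; last exact: pathD_ge0.
by rewrite mulr_ge0 ?expR_ge0 ?pathP_ge0.
Qed.

Lemma rate2_ge0 C : 0 <= rate2 C.
Proof. by apply: divr_ge0; [exact: pathQ_ge0|exact: pathD_ge0]. Qed.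

Section positive.
Hypothesis M0 : 0 < s + t.

Lemma pathPQ_gt0 : 0 < pathP + pathQ.
Proof. by rewrite pathPQ mulr_gt0 ?expR_gt0 ?brk_gt0. Qed.

Lemma pathD_gt0 C : 0 < pathD C.
Proof.
have P0 := pathP_ge0; have Q0 := pathQ_ge0; have PQ := pathPQ_gt0.
have e := expR_gt0 (- (beta * C)).
rewrite /pathD; have [Pz|Pz] := eqVneq pathP 0; first by rewrite Pz mul0r; lra.
have P0' : 0 < pathP by rewrite lt_def Pz.
by rewrite ltr_pwDl// mulr_gt0.
Qed.

Lemma rateD C : rate1 C + rate2 C = 1.
Proof. by rewrite -mulrDl divff// gt_eqF// pathD_gt0. Qed.

Lemma is_derive_pathD C :
  is_derive C (1 : R) pathD (- (beta * pathP * expR (- (beta * C)))).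
Proof.
have e := is_deriveD (is_deriveZ pathP (is_derive_exp_affine beta C))
  (is_derive_cst pathQ C (1 : R)).
by apply: (is_derive_eq e); unscale; ring.
Qed.

Lemma is_derive_path1 C : is_derive C (1 : R) path1 (rate1 C).
Proof.
have D0 := pathD_gt0 C; have PQ := pathPQ_gt0.
rewrite /path1; have [b0|b0] := eqVneq beta 0.
  have e := is_deriveZ (s / (s + t)) (is_derive_id C (1 : R)).
  have -> : (fun C : R => s * C / (s + t)) = (s / (s + t)) \*: id.
    by apply/funext => z; unscale; rewrite mulrAC.
  apply: (is_derive_eq e); unscale.
  rewrite /rate1 /pathD /pathP /pathQ b0 !mul0r oppr0 expR0 !brk_beta0.
  by rewrite !mul1r !mulr1.
have e := is_deriveZ (- beta^-1) (@is_derive1_comp _ (@ln R) pathD C _ _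
  (is_derive1_ln D0) (is_derive_pathD C)).
have e2 := is_deriveD (is_derive_cst (ln (pathP + pathQ) / beta) C (1 : R)) e.
have -> : (fun C : R => ln ((pathP + pathQ) / pathD C) / beta) =
    cst (ln (pathP + pathQ) / beta) + (- beta^-1) \*: (@ln R \o pathD).
  by apply/funext => z; unscale; rewrite ln_div ?posrE ?pathD_gt0//; ring.
apply: (is_derive_eq e2); unscale; rewrite /rate1; field.
by rewrite b0 gt_eqF.
Qed.

Lemma expR_path1 C : expR (beta * path1 C) = (pathP + pathQ) / pathD C.
Proof.
have D0 := pathD_gt0 C; have PQ := pathPQ_gt0.
rewrite /path1; have [b0|b0] := eqVneq beta 0; last first.
  by rewrite mulrC divfK// lnK// posrE divr_gt0.
rewrite b0 mul0r expR0 /pathD b0 mul0r oppr0 expR0 mulr1 divff// gt_eqF//.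
Qed.

Lemma path1_0 : path1 0 = 0.
Proof.
rewrite /path1; case: ifP => _; first by rewrite mulr0 mul0r.
by rewrite pathD0 divff ?ln1 ?mul0r// gt_eqF// pathPQ_gt0.
Qed.

Lemma path1_M : path1 (s + t) = s.
Proof.
rewrite /path1; have [b0|b0] := eqVneq beta 0; first by rewrite mulfK// gt_eqF.
rewrite pathDM pathPQ mulfK ?gt_eqF ?brk_gt0// expRK mulrC mulKf//.
Qed.

Lemma rate1E C : rate1 C = pathP / (pathP + pathQ) * expR (- (beta * path2 C)).
Proof.
have D0 := pathD_gt0 C; have PQ := pathPQ_gt0.
have -> : - (beta * path2 C) = - (beta * C) + beta * path1 C by rewrite /path2; ring.
by rewrite expRD expR_path1 /rate1; field; rewrite !gt_eqF.
Qed.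

(** Together with [rate1E] this says [rate1 = e^(-beta path2) [path1] / [C]], the weight [p] in the
    proof of [Gent_HJ]; [brk_path2] does the same for [q]. So [log_sum] is an equality along the
    path. *)
Lemma brk_path1 C : brk (path1 C) = pathP / (pathP + pathQ) * brk C.
Proof.
have D0 := pathD_gt0 C; have PQ := pathPQ_gt0.
have [b0|b0] := eqVneq beta 0.
  rewrite /path1 /pathP /pathQ b0 eqxx !brk_beta0 mul0r expR0 mul1r; ring.
apply: (mulfI b0).
have h : expR (- (beta * path1 C)) = pathD C / (pathP + pathQ).
  by rewrite expRN expR_path1 invf_div.
move: h; rewrite expRbrk => /eqP; rewrite subr_eq addrC -subr_eq => /eqP <-.
rewrite mulrCA -[beta * brk C](subKr 1) -expRbrk /pathD; field; rewrite gt_eqF//.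
Qed.

Lemma brk_path2 C : brk (path2 C) = rate2 C * brk C.
Proof.
have D0 := pathD_gt0 C; have PQ := pathPQ_gt0.
have := brkD beta (path2 C) (path1 C); rewrite subrK brk_path1 expRN expR_path1 => h.
have -> : rate2 C * brk C = (pathP + pathQ) / pathD C *
    (brk C - pathP / (pathP + pathQ) * brk C).
  by rewrite /rate2; field; rewrite !gt_eqF.
rewrite -[X in _ = _ * (X - _)]h addrK mulrA divff ?mul1r//.
by rewrite mulf_neq0 ?invr_eq0 ?gt_eqF.
Qed.

Lemma path1_continuous : continuous path1.
Proof. by move=> C; exact: is_derive_continuous (is_derive_path1 C). Qed.

Lemma path1_MVT (a b : R) : a <= b -> exists2 r, 0 <= r <= 1 & path1 b - path1 a = r * (b - a).
Proof.
move=> ab.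
have [c _ ->] := MVT_segment ab (fun x _ => is_derive_path1 x)
  (continuous_subspaceT path1_continuous).
exists (rate1 c) => //; rewrite rate1_ge0 -(rateD c) lerDl; exact: rate2_ge0.
Qed.

(** The speed of [path1] lies in [0, 1], so both components are nondecreasing and lie between their
    end values. *)
Lemma path_bounds C : 0 <= C <= s + t -> (0 <= path1 C <= s) && (0 <= path2 C <= t).
Proof.
move=> /andP[C0 CM].
have [r /andP[r0 r1]] := path1_MVT C0; rewrite path1_0 !subr0 => e1.
have [q /andP[q0 q1]] := path1_MVT CM; rewrite path1_M => e2.
have a1 : 0 <= r * C by rewrite mulr_ge0.
have a2 : 0 <= (1 - r) * C by rewrite mulr_ge0// subr_ge0.
have a3 : 0 <= q * (s + t - C) by rewrite mulr_ge0// subr_ge0.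
have a4 : 0 <= (1 - q) * (s + t - C) by rewrite mulr_ge0// subr_ge0.
by rewrite /path2; lra.
Qed.

Lemma path1_gt0 C : 0 < s -> 0 < C <= s + t -> 0 < path1 C.
Proof.
move=> sp /andP[C0 CM].
have /andP[/andP[h _] _] : (0 <= path1 C <= s) && (0 <= path2 C <= t).
  by apply: path_bounds; rewrite ltW.
rewrite lt_def h andbT; apply/eqP => z.
have := brk_path1 C; rewrite z brk0 => /esym/eqP; apply/negP.
rewrite gt_eqF// mulr_gt0 ?brk_gt0// divr_gt0 ?pathPQ_gt0//.
by rewrite mulr_gt0 ?expR_gt0 ?brk_gt0.
Qed.

Lemma path2_gt0 C : 0 < t -> 0 < C <= s + t -> 0 < path2 C.
Proof.
move=> tp /andP[C0 CM].
have /andP[_ /andP[h _]] : (0 <= path1 C <= s) && (0 <= path2 C <= t).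
  by apply: path_bounds; rewrite ltW.
rewrite lt_def h andbT; apply/eqP => z.
have := brk_path2 C; rewrite z brk0 => /esym/eqP; apply/negP.
by rewrite gt_eqF// mulr_gt0 ?brk_gt0// divr_gt0 ?pathD_gt0// brk_gt0.
Qed.

Lemma is_derive_path2 C : is_derive C (1 : R) path2 (rate2 C).
Proof.
have e := is_deriveB (is_derive_id C (1 : R)) (is_derive_path1 C).
by apply: (is_derive_eq e); rewrite -(rateD C) addrAC subrr add0r.
Qed.

Definition path_cost (C : R) : R := G (path1 C) + G (path2 C) - G C.

(* Along the optimal path the Hamilton-Jacobi inequality [Gent_HJ] is an equality. *)
Lemma is_derive_path_cost C : 0 < C < s + t -> is_derive C (1 : R) path_cost
  (xl (rate1 C) + xl (rate2 C) + beta * (path2 C * rate1 C)).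
Proof.
move=> /andP[C0 CM]; have C0M : 0 < C <= s + t by rewrite C0 ltW.
have PQ := pathPQ_gt0; have BC := brk_gt0 beta C0.
(* If [s = 0] or [t = 0], the path stays on an axis and its cost is identically 0. The logarithms
   further down need both masses positive. *)
have [sz|sz] := eqVneq s 0.
  have Pz : pathP = 0 by rewrite /pathP sz brk0 mulr0.
  have p1 x : path1 x = 0.
    rewrite /path1 sz !mul0r /pathD Pz mul0r add0r divff ?ln1 ?mul0r ?if_same//.
    by move: PQ; rewrite Pz add0r => /gt_eqF ->.
  have r1 : rate1 C = 0 by rewrite /rate1 Pz !mul0r.
  have r2 : rate2 C = 1 by have := rateD C; rewrite r1 add0r.
  rewrite r1 r2 xl0 /xl ln1 !mulr0 !addr0.
  rewrite (_ : path_cost = cst 0); last first.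
    by apply/funext => x; rewrite /path_cost /path2 p1 subr0 Gent0 add0r subrr.
  exact: is_derive_cst.
have [tz|tz] := eqVneq t 0.
  have Qz : pathQ = 0 by rewrite /pathQ tz brk0.
  have r2 : rate2 C = 0 by rewrite /rate2 Qz !mul0r.
  have r1 : rate1 C = 1 by have := rateD C; rewrite r2 addr0.
  have p1 x : path1 x = x.
    rewrite /path1 tz addr0; have [b0|b0] := eqVneq beta 0.
      by rewrite mulrAC divff// mul1r.
    rewrite /pathD Qz !addr0 invfM mulrA divff; last by move: PQ; rewrite Qz addr0 => /gt_eqF ->.
    by rewrite mul1r -expRN opprK expRK mulrC mulKf.
  rewrite r1 r2 xl0 /xl ln1 /path2 p1 subrr !mul0r !mulr0 !addr0.
  rewrite (_ : path_cost = cst 0); last first.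
    by apply/funext => x; rewrite /path_cost /path2 p1 subrr Gent0 addr0 subrr.
  exact: is_derive_cst.
have sp : 0 < s by rewrite lt_def sz.
have tp : 0 < t by rewrite lt_def tz.
have P0 : 0 < pathP by rewrite mulr_gt0 ?expR_gt0 ?brk_gt0.
have Q0 : 0 < pathQ by rewrite brk_gt0.
have r1 : 0 < rate1 C by rewrite divr_gt0 ?pathD_gt0// mulr_gt0 ?expR_gt0.
have r2 : 0 < rate2 C by rewrite divr_gt0 ?pathD_gt0.
have p1 := path1_gt0 sp C0M; have p2 := path2_gt0 tp C0M.
have d1 := @is_derive1_comp _ G path1 C _ _ (is_derive_Gent beta p1) (is_derive_path1 C).
have d2 := @is_derive1_comp _ G path2 C _ _ (is_derive_Gent beta p2) (is_derive_path2 C).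
have d := is_deriveB (is_deriveD d1 d2) (is_derive_Gent beta C0).
apply: (is_derive_eq d).
(* With [l2], the logarithmic form of the equality case: the common term [ln [C]] cancels against
   the derivative of [G C]. *)
have l1 : ln (brk (path1 C)) = ln (rate1 C) + beta * path2 C + ln (brk C).
  have -> : ln (rate1 C) = ln (pathP / (pathP + pathQ)) - beta * path2 C.
    by rewrite rate1E lnM ?posrE ?divr_gt0 ?expR_gt0// expRK.
  by rewrite brk_path1 lnM ?posrE ?divr_gt0//; ring.
have l2 : ln (brk (path2 C)) = ln (rate2 C) + ln (brk C).
  by rewrite brk_path2 lnM ?posrE.
rewrite l1 l2 /xl.
have -> : rate2 C = 1 - rate1 C by rewrite -(rateD C) addrAC subrr add0r.
ring.
Qed.

End positive.
End path.

(** * Integrals across a vertical strip *)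

Section strip.
Context {R : realType}.
Variables (beta m x0 x1 : R).
Hypotheses (m0 : 0 < m) (x01 : x0 < x1).

Local Notation Nuv := (Ncdf_uv beta m).
Local Notation Nv := (Ncdf_v beta m).
Local Notation N := (Ncdf beta m).
Local Notation slope := (m / (x1 - x0)).

(** Affine rescaling of [[x0, x1]] to the mass scale [[0, m]], on which [Ncdf] has uniform
    marginals; it also serves as the clock [C] of the paths. *)
Definition lin (x : R) : R := (x - x0) * slope.

Lemma slope_gt0 : 0 < slope. Proof. by rewrite divr_gt0// subr_gt0. Qed.

Lemma lin_bounds x : x0 <= x <= x1 -> 0 <= lin x <= m.
Proof.
move=> /andP[a b]; have x10 : 0 < x1 - x0 by rewrite subr_gt0.
rewrite /lin mulr_ge0 ?subr_ge0 ?(ltW slope_gt0)//= mulrCA ger_pMr// ler_pdivrMr//; lra.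
Qed.

Lemma lin_x0 : lin x0 = 0. Proof. by rewrite /lin subrr mul0r. Qed.

Lemma lin_x1 : lin x1 = m.
Proof. by rewrite /lin mulrCA divff ?mulr1// gt_eqF// subr_gt0. Qed.

Lemma is_derive_lin x : is_derive x (1 : R) lin slope.
Proof.
have e := is_deriveM (is_deriveB (is_derive_id x (1 : R)) (is_derive_cst x0 x (1 : R)))
  (is_derive_cst slope x (1 : R)).
by apply: (is_derive_eq e); unscale; ring.
Qed.

Lemma continuous_lin : continuous lin.
Proof. by move=> x; exact: is_derive_continuous (is_derive_lin x). Qed.

Lemma continuous_den v : continuous (fun u : R => den beta m u v).
Proof.
move=> u; rewrite (_ : (fun u : R => den beta m u v) = (fun u : R => den beta m v u)).
  exact: is_derive_continuous (is_derive_den beta m v u).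
by apply/funext => z; rewrite denC.
Qed.

Lemma continuous_Ncdf_uv (u v : R) : 0 < den beta m u v ->
  {for u, continuous (fun u : R => Nuv u v)}.
Proof.
move=> d0; have B0 := brk_gt0 beta m0; rewrite /Ncdf_uv.
apply: cvgM.
  apply: cvgM; last exact: cvg_cst.
  exact: is_derive_continuous (is_derive_exp_affine beta u).
apply: cvgV; first by rewrite mulf_neq0// ?expf_neq0// gt_eqF.
apply: cvgM; first exact: cvg_cst.
rewrite -[X in X @ _](_ : (fun u : R => den beta m u v * den beta m u v) = _); last first.
  by apply/funext => z; rewrite expr2.
by apply: cvgM; exact: continuous_den.
Qed.

Lemma is_derive_Ncdf_u (u v : R) : 0 < den beta m u v ->
  is_derive u (1 : R) (fun u : R => N u v) (Nv v u).
Proof.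
move=> d0; rewrite (_ : (fun u : R => N u v) = (fun u : R => N v u)).
  by apply: is_derive_Ncdf => //; rewrite denC.
by apply/funext => z; rewrite NcdfC.
Qed.

(** In the mass coordinate the primitive is [a N_v + g Nprim]. The factor [a + g beta (v - N)] is
    what log-density plus energy reduce to in [strip_cost_integral]. *)
Lemma strip_integral (a g v x : R) : 0 < v <= m -> x0 <= x <= x1 ->
  (\int[lebesgue_measure]_(z in `[x0, x])
    (slope * (Nuv (lin z) v * (a + g * (beta * (v - N (lin z) v)))))%:E)%E
  = (a * Nv (lin x) v + g * (Nprim beta m (lin x) v - Nprim beta m 0 v))%:E.
Proof.
move=> /andP[v0 vm] /andP[xl xr].
have vb : 0 <= v <= m by rewrite ltW.
have dz z : x0 <= z <= x -> 0 < den beta m (lin z) v.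
  by move=> /andP[z0 zx]; apply: den_gt0 => //; apply: lin_bounds; rewrite z0 (le_trans zx).
pose F z := a * Nv (lin z) v + g * Nprim beta m (lin z) v.
have dF z : x0 <= z <= x -> is_derive z (1 : R) F
    (slope * (Nuv (lin z) v * (a + g * (beta * (v - N (lin z) v))))).
  move=> zx; have D0 := dz _ zx.
  have e1 := @is_derive1_comp _ (fun u : R => Nv u v) lin z _ _
    (is_derive_Ncdf_v m0 D0) (is_derive_lin z).
  have e2 := @is_derive1_comp _ (fun u : R => Nprim beta m u v) lin z _ _
    (is_derive_Nprim m0 v0 D0) (is_derive_lin z).
  have e := is_deriveD (is_deriveZ a e1) (is_deriveZ g e2).
  by apply: (is_derive_eq e); unscale; ring.
have dF' z : z \in `]x0, x[ -> is_derive z (1 : R) F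
    (slope * (Nuv (lin z) v * (a + g * (beta * (v - N (lin z) v))))).
  by rewrite in_itv/= => /andP[z0 zx]; apply: dF; rewrite !ltW.
have cF : {within `[x0, x], continuous F}.
  apply: continuous_in_subspaceT => z; rewrite inE/= in_itv/= => zx.
  exact: is_derive_continuous (dF z zx).
have cf : {within `[x0, x], continuous (fun z =>
    slope * (Nuv (lin z) v * (a + g * (beta * (v - N (lin z) v)))))}.
  apply: continuous_in_subspaceT => z; rewrite inE/= in_itv/= => zx.
  have D0 := dz _ zx.
  have cN : {for z, continuous (fun z => N (lin z) v)}.
    apply: (@continuous_comp _ _ _ lin (fun u : R => N u v)); first exact: continuous_lin.
    exact: is_derive_continuous (is_derive_Ncdf_u D0).
  have cNuv : {for z, continuous (fun z => Nuv (lin z) v)}.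
    apply: (@continuous_comp _ _ _ lin (fun u : R => Nuv u v)); first exact: continuous_lin.
    exact: continuous_Ncdf_uv.
  apply: cvgM; first exact: cvg_cst.
  apply: cvgM; first exact: cNuv.
  apply: cvgD; first exact: cvg_cst.
  apply: cvgM; first exact: cvg_cst.
  apply: cvgM; first exact: cvg_cst.
  by apply: cvgB; [exact: cvg_cst|exact: cN].
rewrite (integral_is_derive xl dF' cF cf); congr EFin.
by rewrite /F lin_x0 Ncdf_v0; ring.
Qed.

End strip.

Section primitive_chi.
Context {R : realType}.
Variable beta : R.

(** A primitive of [chi] found by parts: [z phi'(z)] integrates to [z phi z] minus the integral of
    [phi], which is [Fpress]. *)
Definition Qchi (z : R) : R := z * phi beta z - Fpress beta z.

Lemma Qchi0 : Qchi 0 = 0. Proof. by rewrite /Qchi mul0r Fpress0 subrr. Qed.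

Lemma continuous_Qchi (z : R) : 0 <= z -> {for z, continuous Qchi}.
Proof.
move=> z0; apply: cvgB; last exact: continuous_Fpress.
by apply: cvgM; [exact: cvg_id|exact: continuous_phi].
Qed.

Lemma is_derive_Qchi (z : R) : 0 < z -> is_derive z (1 : R) Qchi (chi beta z).
Proof.
move=> z0; have B0 := brk_gt0 beta z0.
have e := is_deriveB (is_deriveM (is_derive_id z (1 : R))
  (@is_derive1_comp _ (@ln R) (brk beta) z _ _ (is_derive1_ln B0) (is_derive_brk beta z)))
  (is_derive_Gent beta z0).
have e2 : is_derive z (1 : R) (fun z : R => z * ln (brk beta z) - Gent beta z) (chi beta z).
  apply: (is_derive_eq e); unscale; rewrite chiE//.
  by field; rewrite gt_eqF.
apply: near_eq_is_derive e2; near=> y.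
have y0 : 0 < y by near: y; exact: lt_nbhsr.
by rewrite /Qchi phi_brk// /Gent /xl; ring.
Unshelve. all: by end_near. Qed.

End primitive_chi.

(** * The two strip masses inside one horizontal strip *)

Section piece.
Context {R : realType}.
Variables (beta s t y0 y1 : R).
Hypotheses (s0 : 0 <= s) (t0 : 0 <= t) (y01 : y0 < y1).

Local Notation slope := ((s + t) / (y1 - y0)).
Local Notation C := (lin (s + t) y0 y1).

(** Densities in the second coordinate of the left (1) and right (2) vertical strips for [y] between
    [y0] and [y1]; their sum is the constant [slope]. *)
Definition pb1 (y : R) : R := slope * rate1 beta s t (C y).
Definition pb2 (y : R) : R := slope * rate2 beta s t (C y).
Definition pB1 (y : R) : R := path1 beta s t (C y).
Definition pB2 (y : R) : R := path2 beta s t (C y).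

Lemma piece_slope_ge0 : 0 <= slope.
Proof. by apply: divr_ge0; [exact: addr_ge0|rewrite subr_ge0 ltW]. Qed.

Lemma pb1_ge0 y : 0 <= pb1 y.
Proof. by rewrite mulr_ge0 ?piece_slope_ge0 ?rate1_ge0. Qed.

Lemma pb2_ge0 y : 0 <= pb2 y.
Proof. by rewrite mulr_ge0 ?piece_slope_ge0 ?rate2_ge0. Qed.

Lemma piece_degenerate : s + t = 0 -> [/\ s = 0, t = 0, slope = 0,
  (forall y, pB1 y = 0) & (forall y, pB2 y = 0)].
Proof.
move=> M0; have s00 : s = 0 by move: s0 t0 M0; lra.
have t00 : t = 0 by move: s0 t0 M0; lra.
have c0 y : C y = 0 by rewrite /lin M0 mul0r mulr0.
have p0 y : pB1 y = 0.
  rewrite /pB1 /path1; case: ifP => _; first by rewrite s00 !mul0r.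
  by rewrite /pathP /pathQ s00 t00 brk0 mulr0 addr0 mul0r ln0// mul0r.
split => //; first by rewrite M0 mul0r.
by move=> y; rewrite /pB2 /path2 -/(pB1 y) p0 c0 subrr.
Qed.

Lemma sum_gt0 : s + t != 0 -> 0 < s + t.
Proof. by move=> h; rewrite lt_def h addr_ge0. Qed.

Lemma is_derive_pB1 y : is_derive y (1 : R) pB1 (pb1 y).
Proof.
have [M0|M0] := eqVneq (s + t) 0.
  have [_ _ c0 p0 _] := piece_degenerate M0.
  rewrite /pb1 c0 mul0r (_ : pB1 = cst 0); first exact: is_derive_cst.
  exact/funext.
have e := @is_derive1_comp _ (path1 beta s t) C y _ _
  (is_derive_path1 beta s0 t0 (sum_gt0 M0) (C y)) (is_derive_lin (s + t) y0 y1 y).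
by apply: (is_derive_eq e); rewrite mulrC.
Qed.

Lemma is_derive_pB2 y : is_derive y (1 : R) pB2 (pb2 y).
Proof.
have [M0|M0] := eqVneq (s + t) 0.
  have [_ _ c0 _ p0] := piece_degenerate M0.
  rewrite /pb2 c0 mul0r (_ : pB2 = cst 0); first exact: is_derive_cst.
  exact/funext.
have e := @is_derive1_comp _ (path2 beta s t) C y _ _
  (is_derive_path2 beta s0 t0 (sum_gt0 M0) (C y)) (is_derive_lin (s + t) y0 y1 y).
by apply: (is_derive_eq e); rewrite mulrC.
Qed.

Lemma continuous_pB1 : continuous pB1.
Proof. by move=> y; exact: is_derive_continuous (is_derive_pB1 y). Qed.

Lemma continuous_pB2 : continuous pB2.
Proof. by move=> y; exact: is_derive_continuous (is_derive_pB2 y). Qed.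

Lemma continuous_rates : 0 < s + t ->
  continuous (rate1 beta s t) /\ continuous (rate2 beta s t).
Proof.
move=> M0.
have cD x : {for x, continuous (pathD beta s t)}.
  exact: is_derive_continuous (is_derive_pathD beta s t x).
have D0 x : pathD beta s t x != 0 by rewrite gt_eqF// pathD_gt0.
split => x.
  apply: cvgM; last by apply: cvgV; [exact: D0|exact: cD].
  apply: cvgM; first exact: cvg_cst.
  exact: is_derive_continuous (is_derive_exp_affine beta x).
by apply: cvgM; [exact: cvg_cst|apply: cvgV; [exact: D0|exact: cD]].
Qed.

Lemma continuous_pb1 : continuous pb1.
Proof.
have [M0|M0] := eqVneq (s + t) 0.
  have [_ _ c0 _ _] := piece_degenerate M0.
  by rewrite /pb1 c0 => y; under eq_fun do rewrite mul0r; exact: cvg_cst.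
have [c1 _] := continuous_rates (sum_gt0 M0).
move=> y; apply: cvgM; first exact: cvg_cst.
by apply: (continuous_comp (@continuous_lin _ _ _ _ y)); exact: c1.
Qed.

Lemma continuous_pb2 : continuous pb2.
Proof.
have [M0|M0] := eqVneq (s + t) 0.
  have [_ _ c0 _ _] := piece_degenerate M0.
  by rewrite /pb2 c0 => y; under eq_fun do rewrite mul0r; exact: cvg_cst.
have [_ c1] := continuous_rates (sum_gt0 M0).
move=> y; apply: cvgM; first exact: cvg_cst.
by apply: (continuous_comp (@continuous_lin _ _ _ _ y)); exact: c1.
Qed.

Lemma pB_y0 : pB1 y0 = 0 /\ pB2 y0 = 0.
Proof.
have [M0|M0] := eqVneq (s + t) 0; first by have [_ _ _ p1 p2] := piece_degenerate M0.
by rewrite /pB1 /pB2 /path2 lin_x0 path1_0 ?subrr// sum_gt0.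
Qed.

Lemma pB_y1 : pB1 y1 = s /\ pB2 y1 = t.
Proof.
have [M0|M0] := eqVneq (s + t) 0.
  by have [-> -> _ p1 p2] := piece_degenerate M0.
rewrite /pB1 /pB2 /path2 lin_x1// path1_M ?sum_gt0//; split => //; ring.
Qed.

Lemma pB_bounds y : y0 <= y <= y1 -> (0 <= pB1 y <= s) && (0 <= pB2 y <= t).
Proof.
move=> yb; have [M0|M0] := eqVneq (s + t) 0.
  by have [_ _ _ p1 p2] := piece_degenerate M0; rewrite p1 p2 !lexx s0 t0.
by apply: path_bounds; rewrite ?sum_gt0//; apply: lin_bounds; rewrite ?sum_gt0.
Qed.

Lemma lin_gt0 y : s + t != 0 -> y0 < y <= y1 -> 0 < C y <= s + t.
Proof.
move=> M0 /andP[yl yr]; have M0' := sum_gt0 M0.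
have /andP[_ ->] : 0 <= C y <= s + t by apply: lin_bounds => //; rewrite ltW.
by rewrite andbT mulr_gt0 ?subr_gt0// divr_gt0// subr_gt0.
Qed.

Lemma pB1_gt0 y : y0 < y <= y1 -> pb1 y != 0 -> 0 < pB1 y.
Proof.
move=> yb b0.
have M0 : s + t != 0 by apply: contraNneq b0 => /piece_degenerate[_ _ c0 _ _]; rewrite /pb1 c0 mul0r.
apply: path1_gt0; rewrite ?sum_gt0//; last exact: lin_gt0.
rewrite lt_def s0 andbT; apply: contraNneq b0 => sz.
by rewrite /pb1 /rate1 /pathP sz brk0 mulr0 !mul0r mulr0.
Qed.

Lemma pB2_gt0 y : y0 < y <= y1 -> pb2 y != 0 -> 0 < pB2 y.
Proof.
move=> yb b0.
have M0 : s + t != 0 by apply: contraNneq b0 => /piece_degenerate[_ _ c0 _ _]; rewrite /pb2 c0 mul0r.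
apply: path2_gt0; rewrite ?sum_gt0//; last exact: lin_gt0.
rewrite lt_def t0 andbT; apply: contraNneq b0 => tz.
by rewrite /pb2 /rate2 /pathQ tz brk0 mul0r mulr0.
Qed.

(** [Qchi] is differentiated at positive points only. If [off + B y = 0], then [off = 0] and the
    last hypothesis makes [B] identically 0, so the composite is constant. *)
Lemma is_derive_Qchi_pB (off : R) (B b : R -> R) y : 0 <= off ->
  (forall z, is_derive z (1 : R) B (b z)) ->
  0 <= B y -> (B y = 0 -> forall z, B z = 0) ->
  is_derive y (1 : R) (fun y : R => Qchi beta (off + B y)) (b y * chi beta (off + B y)).
Proof.
move=> o0 dB B0 Bz.
have [h|h] := eqVneq (off + B y) 0.
  have By : B y = 0 by lra.
  have bB := Bz By; have o00 : off = 0 by lra.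
  rewrite h chi0 mulr0 (_ : (fun y => _) = cst 0); first exact: is_derive_cst.
  by apply/funext => z; rewrite bB o00 addr0 Qchi0.
have p0 : 0 < off + B y by rewrite lt_def h addr_ge0.
have d : is_derive y (1 : R) (fun y : R => off + B y) (b y).
  have e := is_deriveD (is_derive_cst off y (1 : R)) (dB y).
  by apply: (is_derive_eq e); rewrite add0r.
have e := @is_derive1_comp _ (Qchi beta) (fun y : R => off + B y) y _ _ (is_derive_Qchi beta p0) d.
by apply: (is_derive_eq e); rewrite mulrC.
Qed.

Lemma pB1_eq0 y : y0 < y <= y1 -> pB1 y = 0 -> forall z, pB1 z = 0.
Proof.
move=> yb By z; have [M0|M0] := eqVneq (s + t) 0.
  by have [_ _ _ p1 _] := piece_degenerate M0.
have M0' := sum_gt0 M0.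
have sz : s = 0.
  apply/eqP/negPn/negP => sn; have sp : 0 < s by rewrite lt_def sn.
  have := path1_gt0 beta s0 t0 M0' sp (lin_gt0 M0 yb).
  by rewrite -/(pB1 y) By ltxx.
have := path1_MVT beta s0 t0 M0'.
rewrite /pB1 /path1; case: ifP => _ _; first by rewrite sz !mul0r.
rewrite /pathD /pathP sz brk0 mulr0 mul0r add0r divff ?ln1 ?mul0r//.
by have := pathPQ_gt0 beta M0'; rewrite /pathP sz brk0 mulr0 add0r => /gt_eqF ->.
Qed.

Lemma pB2_eq0 y : y0 < y <= y1 -> pB2 y = 0 -> forall z, pB2 z = 0.
Proof.
move=> yb By z; have [M0|M0] := eqVneq (s + t) 0.
  by have [_ _ _ _ p2] := piece_degenerate M0.
have M0' := sum_gt0 M0.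
have tz : t = 0.
  apply/eqP/negPn/negP => sn; have sp : 0 < t by rewrite lt_def sn.
  have := path2_gt0 beta s0 t0 M0' sp (lin_gt0 M0 yb).
  by rewrite -/(pB2 y) By ltxx.
have r2 x : rate2 beta s t x = 0 by rewrite /rate2 /pathQ tz brk0 mul0r.
have d x : is_derive x (1 : R) pB2 0.
  by have := is_derive_pB2 x; rewrite /pb2 r2 mulr0.
by rewrite (is_derive_0_is_cst z y0 d); have [_ ->] := pB_y0.
Qed.

(** The path cost pairs left mass at [y] with right mass below, the integrand of the rate pairs
    right mass at [y] with left mass above. The two differ by the derivative of
    [beta pB2 (s - pB1)], which vanishes at both ends. The last term is the entropy of the rescaling
    by [slope]. *)
Definition piece_prim (y : R) : R :=
  path_cost beta s t (C y) + beta * (pB2 y * (s - pB1 y)) + C y * ln slope.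

Lemma xlM (c r : R) : 0 <= c -> 0 <= r -> xl (c * r) = c * xl r + c * r * ln c.
Proof.
rewrite le_eqVlt => /predU1P[<-|c0]; first by rewrite !mul0r xl0 add0r.
rewrite le_eqVlt => /predU1P[<-|r0]; first by rewrite mulr0 xl0 mulr0 mul0r add0r.
by rewrite /xl lnM ?posrE//; ring.
Qed.

Lemma is_derive_piece_prim y : y0 < y < y1 -> is_derive y (1 : R) piece_prim
  (xl (pb1 y) + xl (pb2 y) + beta * (pb2 y * (s - pB1 y))).
Proof.
move=> /andP[yl yr]; have [M0|M0] := eqVneq (s + t) 0.
  have [s00 t00 c0 p1 p2] := piece_degenerate M0.
  have -> : xl (pb1 y) + xl (pb2 y) + beta * (pb2 y * (s - pB1 y)) = 0.
    by rewrite /pb1 /pb2 c0 !mul0r xl0 mulr0 !addr0.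
  rewrite (_ : piece_prim = cst 0); first exact: is_derive_cst.
  apply/funext => z; rewrite /piece_prim p2 mul0r mulr0 addr0.
  rewrite /path_cost -/(pB1 z) -/(pB2 z) p1 p2 /lin M0 mul0r mulr0 mul0r.
  by rewrite Gent0 !addr0 subrr.
have M0' := sum_gt0 M0.
have yb : y0 < y <= y1 by rewrite yl ltW.
have Cb : 0 < C y < s + t.
  have /andP[-> _] /= := lin_gt0 M0 yb.
  rewrite /lin mulrCA gtr_pMr// ltr_pdivrMr ?subr_gt0//; lra.
have e1 := @is_derive1_comp _ (path_cost beta s t) C y _ _
  (is_derive_path_cost beta s0 t0 M0' Cb) (is_derive_lin (s + t) y0 y1 y).
have e2 := is_deriveZ beta (is_deriveM (is_derive_pB2 y)
  (is_deriveB (is_derive_cst s y (1 : R)) (is_derive_pB1 y))).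
have e3 := is_deriveM (is_derive_lin (s + t) y0 y1 y) (is_derive_cst (ln slope) y (1 : R)).
have e := is_deriveD (is_deriveD e1 e2) e3.
apply: (is_derive_eq e); unscale.
have c0 := piece_slope_ge0.
have r1 := rate1_ge0 beta s0 t0 (C y); have r2 := rate2_ge0 beta s0 t0 (C y).
rewrite /pb1 /pb2 (xlM c0 r1) (xlM c0 r2).
have -> : rate2 beta s t (C y) = 1 - rate1 beta s t (C y).
  by rewrite -(rateD beta s0 t0 M0' (C y)) addrAC subrr add0r.
rewrite -/(pB2 y); ring.
Qed.

Lemma continuous_piece_prim y : y0 <= y <= y1 -> {for y, continuous piece_prim}.
Proof.
move=> yb; have /andP[/andP[a1 _] /andP[a2 _]] := pB_bounds yb.
have cC : 0 <= C y.
  have [M0|M0] := eqVneq (s + t) 0; first by rewrite /lin M0 mul0r mulr0.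
  by have /andP[] := lin_bounds (sum_gt0 M0) y01 yb.
apply: cvgD; last by apply: cvgM; [exact: continuous_lin|exact: cvg_cst].
apply: cvgD.
  apply: cvgB; last first.
    by apply: (continuous_comp (@continuous_lin _ _ _ _ y)); exact: continuous_Gent.
  apply: cvgD.
    by apply: (continuous_comp (@continuous_pB1 y)); exact: continuous_Gent.
  by apply: (continuous_comp (@continuous_pB2 y)); exact: continuous_Gent.
apply: cvgM; first exact: cvg_cst.
apply: cvgM; first exact: continuous_pB2.
by apply: cvgB; [exact: cvg_cst|exact: continuous_pB1].
Qed.

Lemma piece_prim_diff : piece_prim y1 - piece_prim y0 =
  Gent beta s + Gent beta t - Gent beta (s + t) + (s + t) * ln slope.
Proof.
have [e1 e2] := pB_y0; have [f1 f2] := pB_y1.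
rewrite /piece_prim /path_cost -!/(pB1 _) -!/(pB2 _) e1 e2 f1 f2 lin_x0 lin_x1//.
rewrite Gent0; ring.
Qed.

End piece.

Section change_of_variables.
Context d (T : measurableType d) {R : realType}.
Variables (mu : {sigma_finite_measure set T -> \bar R}) (nu : probability T R).
Variable g : T -> R.
Hypothesis mg : measurable_fun [set: T] g.
Hypothesis g0 : forall x, 0 <= g x.
Hypothesis nuE : forall A, measurable A -> nu A = (\int[mu]_(x in A) (g x)%:E)%E.

Lemma density_change_of_variables_signed (h : T -> \bar R) :
  measurable_fun [set: T] h -> (\int[nu]_x h x = \int[mu]_x (h x * (g x)%:E))%E.
Proof.
move=> mh; rewrite integralE [RHS]integralE.
have g0E x : (0 <= (g x)%:E)%E by rewrite lee_fin.
rewrite !(density_change_of_variables mg nuE)//; last 2 first.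
- exact: measurable_funeneg.
- exact: measurable_funepos.
congr (_ - _)%E; apply: eq_integral => x _.
  by rewrite funeposE [RHS]funeposE maxe_pMl ?mul0e.
by rewrite funenegE [RHS]funenegE maxe_pMl ?mul0e ?mulNe.
Qed.

End change_of_variables.

Section density_measure.
Context d (T : measurableType d) {R : realType}.
Variables (mu : {measure set T -> \bar R}) (g : T -> R).
Hypotheses (mg : measurable_fun [set: T] g) (g0 : forall x, 0 <= g x).
Hypothesis g1 : (\int[mu]_x (g x)%:E = 1)%E.

Definition density_measure (A : set T) : \bar R := (\int[mu]_(x in A) (g x)%:E)%E.

Let density_measure0 : density_measure set0 = 0%E.
Proof. exact: integral_set0. Qed.

Let density_measure_ge0 A : (0 <= density_measure A)%E.
Proof. by apply: integral_ge0 => x _; rewrite lee_fin. Qed.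

Let density_measure_sigma_additive : semi_sigma_additive density_measure.
Proof.
apply: semi_sigma_additive_nng_induced; first exact/measurable_EFinP.
by move=> x; rewrite lee_fin.
Qed.

HB.instance Definition _ := isMeasure.Build _ _ _ density_measure
  density_measure0 density_measure_ge0 density_measure_sigma_additive.

HB.instance Definition _ := Measure_isProbability.Build _ _ _ density_measure g1.

Lemma density_probability : exists nu : probability T R,
  forall A, nu A = (\int[mu]_(x in A) (g x)%:E)%E.
Proof. by exists density_measure. Qed.

End density_measure.

(** * Iterated integrals over the unit square *)

Section lebesgue_unit.
Context {R : realType}.
Local Notation leb := (@lebesgue_measure R).
Local Notation T2 := (measurableTypeR R * measurableTypeR R)%type.

Lemma integral_lambda (D : set R) (f : R -> \bar R) : measurable D ->
  measurable_fun [set: R] f ->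
  (\int[lambda]_(x in D) f x = \int[leb]_(x in D `&` `[0%R, 1%R]) f x)%E.
Proof.
move=> mD mf; have mC := measurable_itv `[(0 : R), 1].
rewrite -[in LHS](setUIDK D `[0, 1]%classic) integral_setU//; first last.
- by apply/disj_setPS => x [[_ ?] [_ ?]].
- exact: measurable_funTS.
- exact: measurableD.
- exact: measurableI.
rewrite [X in (_ + X)%E](_ : _ = 0%E); last first.
  apply: null_set_integral; first exact: measurableD.
    exact: measurable_funTS.
  change (leb ((D `\` `[0, 1]) `&` `[0, 1]) = 0%E); rewrite (_ : _ `&` _ = set0) ?measure0//.
  by apply/seteqP; split => x // [[_ ?] ?].
rewrite adde0; apply: eq_measure_integral => A mA AD.
by change (leb (A `&` `[0, 1]) = leb A); rewrite (setIidl _)// => x /AD[].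
Qed.

Lemma integral_rectangle (g : R * R -> R) (X Y : set R) :
  measurable_fun [set: T2] g -> (forall z, 0 <= g z) -> measurable X -> measurable Y ->
  (\int[lambda2]_(z in X `*` Y) (g z)%:E =
   \int[leb]_(y in Y `&` `[0%R, 1%R]) \int[leb]_(x in X `&` `[0%R, 1%R]) (g (x, y))%:E)%E.
Proof.
move=> mg g0 mX mY; have mgE : measurable_fun [set: T2] (EFin \o g) by exact/measurable_EFinP.
have mXY : measurable (X `*` Y : set T2) by exact: measurableX.
(* Restricted in the first variable only, so that its integral over [x] is measurable in [y] on the
   whole line. *)
pose gX := (EFin \o g) \_ (X `*` [set: R]).
have mgX : measurable_fun [set: T2] gX.
  apply/(measurable_restrictT _ _).1; first exact: measurableX.
  exact: measurable_funTS.
have gX0 z : (0 <= gX z)%E by rewrite /gX patchE; case: ifP => _ //=; rewrite lee_fin.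
have sect y : (\int[lambda]_x gX (x, y) = \int[leb]_(x in X `&` `[0%R, 1%R]) (g (x, y))%:E)%E.
  rewrite -integral_lambda//; last first.
    by apply: (@measurableT_comp _ _ _ _ _ _ (EFin \o g) _ (fun x => (x, y))).
  rewrite [RHS]integral_mkcond; apply: eq_integral => x _.
  rewrite /gX !patchE; congr (if _ then _ else _).
  by apply/idP/idP; rewrite !inE/= => h //; case: h.
have mG : measurable_fun [set: R] (fun y => \int[lambda]_x gX (x, y))%E.
  exact: (@measurable_fun_fubini_tonelli_G _ _ _ _ _ lambda gX).
transitivity (\int[lambda]_(y in Y) \int[lambda]_x gX (x, y))%E; last first.
  rewrite (integral_lambda mY mG); apply: eq_integral => y _; exact: sect.
rewrite [LHS]integral_mkcond.
have gXY0 z : (0 <= ((EFin \o g) \_ (X `*` Y)) z)%E.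
  by rewrite patchE; case: ifP => _ //=; rewrite lee_fin.
have mgXY : measurable_fun [set: T2] ((EFin \o g) \_ (X `*` Y)).
  by apply/(measurable_restrictT _ _).1 => //; exact: measurable_funTS.
apply: etrans (@fubini_tonelli2 _ _ _ _ _ lambda lambda _ mgXY gXY0) _.
rewrite [RHS]integral_mkcond; apply: eq_integral => y _.
rewrite [RHS]patchE /fubini_G; have [yY|yY] := boolP (y \in Y).
  apply: eq_integral => x _; rewrite /gX !patchE; congr (if _ then _ else _).
  by rewrite inE in yY; apply/idP/idP; rewrite !inE/= => -[].
rewrite integral0_eq// => x _; rewrite patchE ifF//; apply: contraNF yY.
by rewrite !inE => -[].
Qed.

Lemma integral_lambda2 (f : R * R -> R) : measurable_fun [set: T2] f ->
  lambda2.-integrable [set: T2] (EFin \o f) ->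
  (\int[lambda2]_z (f z)%:E =
   \int[leb]_(y in `[0%R, 1%R]) \int[leb]_(x in `[0%R, 1%R]) (f (x, y))%:E)%E.
Proof.
move=> mf intf; have mfE : measurable_fun [set: T2] (EFin \o f) by exact/measurable_EFinP.
have inner y : (\int[lambda]_x (f (x, y))%:E = \int[leb]_(x in `[0%R, 1%R]) (f (x, y))%:E)%E.
  rewrite integral_lambda ?setTI//.
  by apply: (@measurableT_comp _ _ _ _ _ _ (EFin \o f) _ (fun x => (x, y))).
rewrite -(@integral21_prod_meas1 _ _ _ _ _ lambda lambda (EFin \o f) intf) /fubini_G/=.
under eq_integral do rewrite inner.
rewrite integral_lambda ?setTI//.
have -> : (fun y => \int[leb]_(x in `[0%R, 1%R]) (f (x, y))%:E)%E =
    ((fun y => \int[lambda]_x (EFin \o f)^\+ (x, y)) \-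
     (fun y => \int[lambda]_x (EFin \o f)^\- (x, y)))%E.
  apply/funext => y; rewrite -inner [LHS]integralE.
  by congr (_ - _)%E; apply: eq_integral => x _;
    [rewrite funeposE [RHS]funeposE|rewrite funenegE [RHS]funenegE].
apply: emeasurable_funB.
- apply: (@measurable_fun_fubini_tonelli_G _ _ _ _ _ lambda ((EFin \o f)^\+)%E) => //.
  exact: measurable_funepos.
- apply: (@measurable_fun_fubini_tonelli_G _ _ _ _ _ lambda ((EFin \o f)^\-)%E) => //.
  exact: measurable_funeneg.
Qed.

(** A bound on the square suffices, since the complement is null for [lambda2]. *)
Lemma integrable_lambda2 (f : R * R -> R) (M : R) : measurable_fun [set: T2] f ->
  (forall z, unit_square z -> `|f z| <= M) -> lambda2.-integrable [set: T2] (EFin \o f).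
Proof.
move=> mf fM; have mC := @measurable_unit_square R.
have mCc : measurable (~` unit_square : set T2) by exact: measurableC.
have l1 : lambda2 (unit_square : set T2) = 1%E.
  rewrite /unit_square lambda2_setX; [|exact: measurable_itv..].
  by rewrite lambda_itv01 ?ler01 ?lexx// mule1.
have n0 : lambda2 (~` unit_square : set T2) = 0%E.
  by have := @probability_setC _ _ _ lambda2 _ mC; rewrite l1 subee.
apply/(negligible_integrable mCc _ _ n0) => //; first exact/measurable_EFinP.
rewrite setTD setCK; apply: measurable_bounded_integrable => //.
- by have : (lambda2 (unit_square : set T2) < +oo)%E by rewrite l1 ltry.
- exact: measurable_funTS.
- exists M; split; first exact: num_real.
  by move=> x Mx z zC /=; exact: le_trans (fM z zC) (ltW Mx).
Qed.

End lebesgue_unit.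

Section glue.
Context {R : realType}.
Local Notation leb := (@lebesgue_measure R).

(** The point [c] goes to the first branch, as in [Lpart]. *)
Definition glue (c : R) (T : Type) (f1 f2 : R -> T) (y : R) : T := if y <= c then f1 y else f2 y.

Lemma integral_itv_split (f : R -> \bar R) (a c b : R) : a <= c <= b ->
  measurable_fun [set: R] f ->
  (\int[leb]_(x in `[a, b]) f x =
   \int[leb]_(x in `[a, c]) f x + \int[leb]_(x in `]c, b]) f x)%E.
Proof.
move=> /andP[ac cb] mf.
rewrite (@itv_bndbnd_setU _ _ (BLeft a) (BRight c) (BRight b)); [|by rewrite bnd_simp..].
rewrite integral_setU//; first exact: measurable_funTS.
apply/disj_setPS => x [] /=; rewrite !in_itv/= => /andP[_ xc] /andP[cx _].
by have := le_lt_trans xc cx; rewrite ltxx.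
Qed.

Lemma measurable_glue c d (T : measurableType d) (f1 f2 : R -> T) : measurable_fun [set: R] f1 ->
  measurable_fun [set: R] f2 -> measurable_fun [set: R] (glue c f1 f2).
Proof. by move=> m1 m2; apply: measurable_fun_ifT => //; exact: measurable_fun_ler. Qed.

End glue.

(** * The density of the minimizer in a vertical strip *)

Section strip_density.
Context {R : realType}.
Variables (beta m x0 x1 v b : R).
Hypotheses (m0 : 0 <= m) (x01 : x0 < x1) (b0 : 0 <= b) (vm : 0 <= v <= m).
Hypothesis bm : b != 0 -> 0 < m.

Local Notation slope := (m / (x1 - x0)).
Local Notation C := (lin m x0 x1).
Local Notation leb := (@lebesgue_measure R).

(** The density [Ncdf_uv] pulled back to the plane: at a given height, [v] is the value of the
    distribution function and [b] its derivative, so [slope] and [b] are the Jacobian factors. *)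
Definition strip_density (x : R) : R := slope * Ncdf_uv beta m (C x) v * b.

Lemma strip_slope_ge0 : 0 <= slope.
Proof. by apply: divr_ge0; rewrite // subr_ge0 ltW. Qed.

Lemma strip_density_ge0 x : 0 <= strip_density x.
Proof. by rewrite mulr_ge0// mulr_ge0 ?strip_slope_ge0// Ncdf_uv_ge0. Qed.

Lemma strip_density_integral x : x0 <= x <= x1 ->
  (\int[leb]_(z in `[x0, x]) (strip_density z)%:E)%E = (b * Ncdf_v beta m (C x) v)%:E.
Proof.
move=> /andP[xl xr]; have [bz|bn] := eqVneq b 0.
  by rewrite bz mul0r integral0_eq// => z _; rewrite /strip_density bz mulr0.
have mp := bm bn.
have dz z : x0 <= z <= x -> 0 < den beta m (C z) v.
  by move=> /andP[z0 zx]; apply: den_gt0 => //; apply: lin_bounds; rewrite // z0 (le_trans zx).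
pose F z := b * Ncdf_v beta m (C z) v.
have dF z : x0 <= z <= x -> is_derive z (1 : R) F (strip_density z).
  move=> zx; have e := is_deriveZ b (@is_derive1_comp _ (fun u : R => Ncdf_v beta m u v) C z _ _
    (is_derive_Ncdf_v mp (dz _ zx)) (is_derive_lin m x0 x1 z)).
  by apply: (is_derive_eq e); unscale; rewrite /strip_density; ring.
have dF' z : z \in `]x0, x[ -> is_derive z (1 : R) F (strip_density z).
  by rewrite in_itv/= => /andP[z0 zx]; apply: dF; rewrite !ltW.
have cF : {within `[x0, x], continuous F}.
  apply: continuous_in_subspaceT => z; rewrite inE/= in_itv/= => zx.
  exact: is_derive_continuous (dF z zx).
have cf : {within `[x0, x], continuous strip_density}.
  apply: continuous_in_subspaceT => z; rewrite inE/= in_itv/= => zx.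
  apply: cvgM; last exact: cvg_cst.
  apply: cvgM; first exact: cvg_cst.
  apply: (@continuous_comp _ _ _ C (fun u : R => Ncdf_uv beta m u v)).
    exact: continuous_lin.
  by apply: continuous_Ncdf_uv => //; exact: dz.
rewrite (integral_is_derive xl dF' cF cf); congr EFin.
by rewrite /F lin_x0 Ncdf_v0 mulr0 subr0.
Qed.

Lemma strip_cost_integral (c : R) : (b != 0 -> 0 < v) ->
  (\int[leb]_(z in `[x0, x1]) (xl (strip_density z) +
     beta * ((c + C z - Ncdf beta m (C z) v) * strip_density z))%:E)%E =
  (b * ln (slope / brk beta m) + xl b + b * chi beta v + beta * c * b)%:E.
Proof.
move=> v0; have [bz|bn] := eqVneq b 0.
  rewrite bz xl0 !mul0r mulr0 !addr0 integral0_eq// => z _.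
  by rewrite /strip_density bz !mulr0 xl0 addr0.
have mp := bm bn; have vp := v0 bn.
have vv : 0 < v <= m by rewrite vp; case/andP: vm.
have bp : 0 < b by rewrite lt_def bn.
have sp : 0 < slope by rewrite divr_gt0// subr_gt0.
have Bp := brk_gt0 beta mp.
(* By [ln_Ncdf_uv] the log-density contains [- beta (u + v - 2 N)]. Adding the energy
   [beta (c + u - N)] cancels [u] and leaves [- beta (v - N)], hence the coefficient [- b]. *)
have := strip_integral beta mp x01
  (b * (ln slope + ln b - ln (brk beta m) + beta * c)) (- b) vv (_ : x0 <= x1 <= x1).
rewrite lexx ltW// => /(_ isT); rewrite lin_x1// Ncdf_vm// Nprim_diff// => h.
transitivity ((b * (ln slope + ln b - ln (brk beta m) + beta * c) * 1 + - b * - chi beta v)%:E).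
  rewrite -h; apply: eq_integral => z; rewrite inE/= in_itv/= => zb; congr EFin.
  have d0 : 0 < den beta m (C z) v by apply: den_gt0 => //; exact: lin_bounds.
  have np : 0 < Ncdf_uv beta m (C z) v.
    by rewrite divr_gt0 ?mulr_gt0 ?expR_gt0 ?exprn_gt0.
  have lD : ln (strip_density z) = ln slope + ln (Ncdf_uv beta m (C z) v) + ln b.
    have sN : 0 < slope * Ncdf_uv beta m (C z) v by exact: mulr_gt0.
    by rewrite [LHS](lnM sN bp) (lnM sp np).
  by rewrite /xl lD ln_Ncdf_uv// /strip_density; ring.
by congr EFin; rewrite (ln_div sp Bp) /xl; ring.
Qed.

Lemma strip_density_le (K : R) x : b <= K -> x0 <= x <= x1 ->
  strip_density x <= slope * (expR (`|beta| * (2 * m)) /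
    (brk beta m * expR (- `|beta| * m) ^+ 2)) * K.
Proof.
move=> bK xb; have [bz|bn] := eqVneq b 0.
  have K0 : 0 <= K by exact: le_trans b0 bK.
  rewrite {1}/strip_density bz mulr0; apply: mulr_ge0 => //.
  apply: mulr_ge0; first exact: strip_slope_ge0.
  apply: divr_ge0; first exact: expR_ge0.
  by apply: mulr_ge0; [exact: brk_ge0|rewrite exprn_ge0 ?expR_ge0].
have mp := bm bn; have Bp := brk_gt0 beta mp.
have uu := lin_bounds mp x01 xb.
have dl := den_lb beta mp uu vm; have d0 := den_gt0 beta mp uu vm.
have el := expR_gt0 (- `|beta| * m).
apply: ler_pM => //; first by rewrite mulr_ge0 ?strip_slope_ge0 ?Ncdf_uv_ge0.
rewrite ler_wpM2l ?strip_slope_ge0// /Ncdf_uv ler_pM//.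
- by rewrite invr_ge0 mulr_ge0 ?exprn_ge0// ltW.
- rewrite -expRD ler_expR; move: uu vm => /andP[u0 um] /andP[w0 wm].
  have := ler_norm (- beta); rewrite normrN => h.
  have h2 : - beta * (C x + v) <= `|beta| * (C x + v) by rewrite ler_wpM2r// addr_ge0.
  have h3 : `|beta| * (C x + v) <= `|beta| * (2 * m) by rewrite ler_wpM2l//; lra.
  by lra.
- rewrite lef_pV2 ?posrE ?mulr_gt0 ?exprn_gt0//.
  by rewrite ler_pM2l// lerXn2r// nnegrE ltW.
Qed.

End strip_density.

Section piece_integral.
Context {R : realType}.
Variables (beta s t y0 y1 : R).
Hypotheses (s0 : 0 <= s) (t0 : 0 <= t) (y01 : y0 < y1).

Local Notation pb1 := (pb1 beta s t y0 y1).
Local Notation pb2 := (pb2 beta s t y0 y1).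
Local Notation pB1 := (pB1 beta s t y0 y1).
Local Notation pB2 := (pB2 beta s t y0 y1).

(** In the application [o1] and [o2] are the masses of the two vertical strips below [y0], and [w]
    is the full mass of the left one. The left mass above [y] splits as
    [(w - o1 - s) + (s - pB1 y)]: the first part multiplies [pB2] in the primitive, the second is
    contained in [piece_prim]. *)
Lemma piece_cost_integral (k1 k2 o1 o2 w : R) : 0 <= o1 -> 0 <= o2 ->
  (\int[lebesgue_measure]_(y in `[y0, y1])
    ((pb1 y * k1 + xl (pb1 y) + pb1 y * chi beta (o1 + pB1 y)) +
     (pb2 y * k2 + xl (pb2 y) + pb2 y * chi beta (o2 + pB2 y)
      + beta * (w - (o1 + pB1 y)) * pb2 y))%:E)%E =
  (k1 * s + k2 * t + (Qchi beta (o1 + s) - Qchi beta o1) + (Qchi beta (o2 + t) - Qchi beta o2)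
   + (Gent beta s + Gent beta t - Gent beta (s + t) + (s + t) * ln ((s + t) / (y1 - y0)))
   + beta * (w - o1 - s) * t)%:E.
Proof.
move=> o10 o20.
pose F y := k1 * pB1 y + k2 * pB2 y + Qchi beta (o1 + pB1 y) + Qchi beta (o2 + pB2 y)
  + piece_prim beta s t y0 y1 y + beta * (w - o1 - s) * pB2 y.
pose f y := (pb1 y * k1 + xl (pb1 y) + pb1 y * chi beta (o1 + pB1 y)) +
     (pb2 y * k2 + xl (pb2 y) + pb2 y * chi beta (o2 + pB2 y)
      + beta * (w - (o1 + pB1 y)) * pb2 y).
have d1 (y : R) : is_derive y (1 : R) pB1 (pb1 y) by exact: is_derive_pB1.
have d2 (y : R) : is_derive y (1 : R) pB2 (pb2 y) by exact: is_derive_pB2.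
have c1 : continuous pB1 by exact: continuous_pB1.
have c2 : continuous pB2 by exact: continuous_pB2.
have cb1 : continuous pb1 by exact: continuous_pb1.
have cb2 : continuous pb2 by exact: continuous_pb2.
have dF y : y \in `]y0, y1[ -> is_derive y (1 : R) F (f y).
  rewrite in_itv/= => yb; have yc : y0 <= y <= y1 by case/andP: yb => *; rewrite !ltW.
  have yo : y0 < y <= y1 by case/andP: yb => -> /ltW.
  have /andP[/andP[p1 _] /andP[p2 _]] := pB_bounds beta s0 t0 y01 yc.
  have e1 := is_derive_Qchi_pB beta o10 d1 p1 (pB1_eq0 s0 t0 y01 yo).
  have e2 := is_derive_Qchi_pB beta o20 d2 p2 (pB2_eq0 s0 t0 y01 yo).
  have e3 := is_derive_piece_prim beta s0 t0 y01 yb.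
  have e := is_deriveD (is_deriveD (is_deriveD (is_deriveD (is_deriveD
    (is_deriveZ k1 (d1 y)) (is_deriveZ k2 (d2 y))) e1) e2) e3)
    (is_deriveZ (beta * (w - o1 - s)) (d2 y)).
  by apply: (is_derive_eq e); unscale; rewrite /f; ring.
have cF : {within `[y0, y1], continuous F}.
  apply: continuous_in_subspaceT => y; rewrite inE/= in_itv/= => yb.
  have /andP[/andP[p1 _] /andP[p2 _]] := pB_bounds beta s0 t0 y01 yb.
  have q (o : R) (B : R -> R) : 0 <= o -> 0 <= B y -> continuous B ->
      {for y, continuous (fun y => Qchi beta (o + B y))}.
    move=> o0 B0 cB.
    apply: (@continuous_comp _ _ _ (fun y => o + B y) (Qchi beta)).
      by apply: cvgD; [exact: cvg_cst|exact: cB].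
    by apply: continuous_Qchi; exact: addr_ge0.
  apply: cvgD; last by apply: cvgM; [exact: cvg_cst|exact: c2].
  apply: cvgD; last exact: continuous_piece_prim.
  apply: cvgD; last exact: q.
  apply: cvgD; last exact: q.
  by apply: cvgD; apply: cvgM; [exact: cvg_cst|exact: c1|exact: cvg_cst|exact: c2].
have cf : {within `[y0, y1], continuous f}.
  apply: continuous_subspaceT => y.
  have q (o : R) (B : R -> R) : continuous B -> {for y, continuous (fun y => chi beta (o + B y))}.
    move=> cB.
    apply: (@continuous_comp _ _ _ (fun y => o + B y) (chi beta)).
      by apply: cvgD; [exact: cvg_cst|exact: cB].
    exact: continuous_chi.
  have x (g : R -> R) : continuous g -> {for y, continuous (fun y => xl (g y))}.
    by move=> cg; apply: (@continuous_comp _ _ _ g xl); [exact: cg|exact: continuous_xl].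
  apply: cvgD.
    apply: cvgD; last by apply: cvgM; [exact: cb1|exact: q].
    by apply: cvgD; [apply: cvgM; [exact: cb1|exact: cvg_cst]|exact: x].
  apply: cvgD.
    apply: cvgD; last by apply: cvgM; [exact: cb2|exact: q].
    by apply: cvgD; [apply: cvgM; [exact: cb2|exact: cvg_cst]|exact: x].
  apply: cvgM; last exact: cb2.
  apply: cvgM; first exact: cvg_cst.
  apply: cvgB; first exact: cvg_cst.
  by apply: cvgD; [exact: cvg_cst|exact: c1].
rewrite (integral_is_derive (ltW y01) dF cF cf); congr EFin.
have := piece_prim_diff beta s0 t0 y01.
have [e1 e2] := pB_y0 beta y0 y1 s0 t0; have [f1 f2] := pB_y1 beta s0 t0 y01.
rewrite /F e1 e2 f1 f2 !addr0 => <-; ring.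
Qed.

End piece_integral.

(** * The minimizer *)

Section measurability.
Context {R : realType} d (T : measurableType d).
Implicit Types (f u v : T -> R).

Lemma measurable_inv : measurable_fun [set: R] (fun x : R => x^-1).
Proof.
have -> : (fun x : R => x^-1) = (fun x => if 0 <= x then x `^ (- 1) else - ((- x) `^ (- 1))).
  apply/funext => x; case: ifPn => [x0|]; first by rewrite powR_inv1.
  by rewrite -ltNge => /ltW x0; rewrite powR_inv1 ?oppr_ge0// invrN opprK.
apply: measurable_fun_ifT.
- exact: measurable_fun_ler.
- exact: measurable_powR.
- have mN : measurable_fun [set: R] (fun x : R => - x) by exact/measurable_funN/measurable_id.
  apply: (@measurable_funN _ _ _ _ (fun x : R => (- x) `^ (- 1))).
  apply: (@measurableT_comp _ _ _ _ _ _ (fun x : R => x `^ (- 1)) _ (fun x : R => - x)) => //.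
Qed.

Lemma measurable_funV f : measurable_fun [set: T] f ->
  measurable_fun [set: T] (fun x => (f x)^-1).
Proof. by move=> mf; apply: measurableT_comp mf; exact: measurable_inv. Qed.

Variables (beta m : R).

Let measurable_brk f : measurable_fun [set: T] f ->
  measurable_fun [set: T] (fun x => brk beta (f x)).
Proof.
move=> mf; apply: measurableT_comp mf.
by apply: continuous_measurable_fun; exact: continuous_brk.
Qed.

Let measurable_exp f : measurable_fun [set: T] f ->
  measurable_fun [set: T] (fun x => expR (- (beta * f x))).
Proof.
move=> mf; apply: measurableT_comp => //; apply: measurableT_comp => //.
by apply: measurable_funM => //; exact: measurable_cst.
Qed.

Let measurable_den u v : measurable_fun [set: T] u -> measurable_fun [set: T] v ->
  measurable_fun [set: T] (fun x => den beta m (u x) (v x)).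
Proof.
move=> mu mv; apply: measurable_funB; first exact: measurable_cst.
apply: measurable_funM; last exact: measurable_cst.
apply: measurable_funM; last exact: measurable_brk.
by apply: measurable_funM; [exact: measurable_cst|exact: measurable_brk].
Qed.

Lemma measurable_Ncdf_v u v : measurable_fun [set: T] u -> measurable_fun [set: T] v ->
  measurable_fun [set: T] (fun x => Ncdf_v beta m (u x) (v x)).
Proof.
move=> mu mv; apply: measurable_funM.
  by apply: measurable_funM; [exact: measurable_brk|exact: measurable_exp].
apply: measurable_funV; apply: measurable_funM; first exact: measurable_cst.
exact: measurable_den.
Qed.

Lemma measurable_Ncdf_uv u v : measurable_fun [set: T] u -> measurable_fun [set: T] v ->
  measurable_fun [set: T] (fun x => Ncdf_uv beta m (u x) (v x)).
Proof.
move=> mu mv; apply: measurable_funM.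
  by apply: measurable_funM; exact: measurable_exp.
apply: measurable_funV; apply: measurable_funM; first exact: measurable_cst.
by apply: measurable_funX; exact: measurable_den.
Qed.

Lemma measurable_strip_density x0 x1 u v f : measurable_fun [set: T] u ->
  measurable_fun [set: T] v -> measurable_fun [set: T] f ->
  measurable_fun [set: T] (fun x => strip_density beta m x0 x1 (v x) (f x) (u x)).
Proof.
move=> mu mv mf; apply: measurable_funM => //.
apply: measurable_funM; first exact: measurable_cst.
apply: measurable_Ncdf_uv => //; apply: measurable_funM; last exact: measurable_cst.
by apply: measurable_funB => //; exact: measurable_cst.
Qed.

End measurability.

(** * Second marginal of a vertical strip across the two horizontal strips *)

Section profile.
Context {R : realType}.
Local Notation leb := (@lebesgue_measure R).

(* [glue c b1 b2] is the density and [glue c B1 B2] the distribution function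
   in the second coordinate of a vertical strip of mass [m]. *)
Record profile (m c : R) (b1 b2 B1 B2 : R -> R) : Prop := Profile {
  profile_derive1 : forall y : R, is_derive y (1 : R) B1 (b1 y);
  profile_derive2 : forall y : R, is_derive y (1 : R) B2 (b2 y);
  profile_continuous1 : continuous b1;
  profile_continuous2 : continuous b2;
  profile_ge0 : forall y, 0 <= b1 y /\ 0 <= b2 y;
  profile_0 : B1 0 = 0;
  profile_c : B1 c = B2 c;
  profile_1 : B2 1 = m;
  profile_bounds1 : forall y, 0 <= y <= c -> 0 <= B1 y <= m;
  profile_bounds2 : forall y, c <= y <= 1 -> 0 <= B2 y <= m;
  profile_gt01 : forall y, 0 < y <= c -> b1 y != 0 -> 0 < B1 y;
  profile_gt02 : forall y, c < y <= 1 -> b2 y != 0 -> 0 < B2 y;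
  profile_degenerate : m = 0 -> forall y, b1 y = 0 /\ b2 y = 0 }.

Variables (beta m c : R) (b1 b2 B1 B2 : R -> R).
Hypotheses (c01 : 0 < c < 1) (m0 : 0 <= m) (H : profile m c b1 b2 B1 B2).

Local Notation b := (glue c b1 b2).
Local Notation B := (glue c B1 B2).

Lemma glue_ge0 y : 0 <= b y.
Proof. by have [h1 h2] := profile_ge0 H y; rewrite /glue; case: ifP. Qed.

Lemma glue_bounds y : 0 <= y <= 1 -> 0 <= B y <= m.
Proof.
move=> /andP[y0 y1]; rewrite /glue; case: ifPn => yc.
  by apply: (profile_bounds1 H); rewrite y0.
by apply: (profile_bounds2 H); rewrite y1 andbT ltW// ltNge.
Qed.

Lemma glue_gt0 y : 0 < y <= 1 -> b y != 0 -> 0 < B y.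
Proof.
move=> /andP[y0 y1]; rewrite /glue; case: ifPn => yc.
  by apply: (profile_gt01 H); rewrite y0.
by apply: (profile_gt02 H); rewrite y1 andbT ltNge.
Qed.

Lemma glue_m_gt0 y : b y != 0 -> 0 < m.
Proof.
move=> h; rewrite lt_def m0 andbT; apply: contraNneq h => mz.
by have [h1 h2] := profile_degenerate H mz y; rewrite /glue h1 h2 if_same.
Qed.

Lemma glue0 : B 0 = 0.
Proof. by case/andP: c01 => h _; rewrite /glue (ltW h) (profile_0 H). Qed.

Lemma glue1 : B 1 = m.
Proof. by case/andP: c01 => _ h; rewrite /glue leNgt h (profile_1 H). Qed.

Lemma measurable_profile_density : measurable_fun [set: R] b.
Proof.
apply: measurable_glue; apply: continuous_measurable_fun.
  exact: profile_continuous1 H.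
exact: profile_continuous2 H.
Qed.

Lemma measurable_profile_cdf : measurable_fun [set: R] B.
Proof.
apply: measurable_glue; apply: continuous_measurable_fun => y.
  exact: is_derive_continuous (profile_derive1 H y).
exact: is_derive_continuous (profile_derive2 H y).
Qed.

Let piece_cdf (u a z : R) (bj Bj : R -> R) : 0 < m -> 0 <= u <= m -> a <= z ->
  (forall y : R, is_derive y (1 : R) Bj (bj y)) -> continuous bj ->
  (forall y, a <= y <= z -> 0 <= Bj y <= m) ->
  (\int[leb]_(y in `[a, z]) (bj y * Ncdf_v beta m u (Bj y))%:E)%E =
  (Ncdf beta m u (Bj z) - Ncdf beta m u (Bj a))%:E.
Proof.
move=> mp uu az dB cb bnd.
have dy y : a <= y <= z -> 0 < den beta m u (Bj y).
  by move=> yy; apply: den_gt0 => //; exact: bnd.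
have cB y : {for y, continuous Bj} by exact: is_derive_continuous (dB y).
pose F y := Ncdf beta m u (Bj y).
have dF y : a <= y <= z -> is_derive y (1 : R) F (bj y * Ncdf_v beta m u (Bj y)).
  move=> yy; have e := @is_derive1_comp _ (Ncdf beta m u) Bj y _ _
    (is_derive_Ncdf mp (dy _ yy)) (dB y).
  by apply: (is_derive_eq e); rewrite mulrC.
have dF' y : y \in `]a, z[ -> is_derive y (1 : R) F (bj y * Ncdf_v beta m u (Bj y)).
  by rewrite in_itv/= => /andP[z0 zx]; apply: dF; rewrite !ltW.
have cF : {within `[a, z], continuous F}.
  apply: continuous_in_subspaceT => y; rewrite inE/= in_itv/= => yy.
  exact: is_derive_continuous (dF y yy).
have cf : {within `[a, z], continuous (fun y => bj y * Ncdf_v beta m u (Bj y))}.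
  apply: continuous_in_subspaceT => y; rewrite inE/= in_itv/= => yy.
  have D0 := dy _ yy; have Bm := brk_gt0 beta mp.
  apply: cvgM; first exact: cb.
  apply: (@continuous_comp _ _ _ Bj (fun v => Ncdf_v beta m u v)); first exact: cB.
  apply: cvgM.
    apply: cvgM; first exact: cvg_cst.
    exact: is_derive_continuous (is_derive_exp_affine beta (Bj y)).
  apply: cvgV; first by rewrite mulf_neq0// gt_eqF.
  apply: cvgM; first exact: cvg_cst.
  exact: is_derive_continuous (is_derive_den beta m u (Bj y)).
by rewrite (integral_is_derive az dF' cF cf).
Qed.

Lemma measurable_profile_row u : measurable_fun [set: R] (fun y => b y * Ncdf_v beta m u (B y)).
Proof.
apply: measurable_funM; first exact: measurable_profile_density.
by apply: measurable_Ncdf_v; [exact: measurable_cst|exact: measurable_profile_cdf].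
Qed.

(** By the chain rule [b * Ncdf_v] is the derivative of [N(u, B)] on each side of [c], and the
    pieces join because [B1 c = B2 c]. The flag [bb] serves closed and left-open intervals alike. *)
Lemma profile_cdf (u a z : R) (bb : bool) : 0 <= u <= m -> 0 <= a -> a <= z -> z <= 1 ->
  (\int[leb]_(y in [set` Interval (BSide bb a) (BRight z)]) (b y * Ncdf_v beta m u (B y))%:E)%E =
  (Ncdf beta m u (B z) - Ncdf beta m u (B a))%:E.
Proof.
move=> uu a0 az z1; have mrow := measurable_profile_row u.
have mrowE : measurable_fun [set: R] (fun y => (b y * Ncdf_v beta m u (B y))%:E).
  exact/measurable_EFinP.
transitivity (\int[leb]_(y in `[a, z]) (b y * Ncdf_v beta m u (B y))%:E)%E.
  by case: bb => //; rewrite integral_itv_obnd_cbnd//; exact: measurable_funTS.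
have ab : 0 <= a <= 1 by rewrite a0 (le_trans az).
have zb : 0 <= z <= 1 by rewrite z1 (le_trans a0).
have [mz|mn] := eqVneq m 0.
  have Bz y : 0 <= y <= 1 -> B y = 0 by move=> /glue_bounds; rewrite mz => /le_anti.
  rewrite !Bz// subrr integral0_eq// => y _.
  by have [h1 h2] := profile_degenerate H mz y; rewrite /glue h1 h2 if_same mul0r.
have mp : 0 < m by rewrite lt_def mn.
have p1 a' z' : 0 <= a' -> a' <= z' -> z' <= c ->
    (\int[leb]_(y in `[a', z']) (b y * Ncdf_v beta m u (B y))%:E)%E =
    (Ncdf beta m u (B1 z') - Ncdf beta m u (B1 a'))%:E.
  move=> a'0 az' zc; rewrite -(piece_cdf mp uu az' (profile_derive1 H) (profile_continuous1 H)).
    apply: eq_integral => y; rewrite inE/= in_itv/= => /andP[_ yz].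
    by rewrite /glue (le_trans yz zc).
  by move=> y /andP[ay yz]; apply: (profile_bounds1 H); rewrite (le_trans a'0)// (le_trans yz).
have p2 a' z' : c <= a' -> a' <= z' -> z' <= 1 ->
    (\int[leb]_(y in `]a', z']) (b y * Ncdf_v beta m u (B y))%:E)%E =
    (Ncdf beta m u (B2 z') - Ncdf beta m u (B2 a'))%:E.
  move=> ca az' z1'; rewrite -(piece_cdf mp uu az' (profile_derive2 H) (profile_continuous2 H)).
    transitivity (\int[leb]_(y in `]a', z']) (b2 y * Ncdf_v beta m u (B2 y))%:E)%E.
      apply: eq_integral => y; rewrite inE/= in_itv/= => /andP[ay _].
      by rewrite /glue leNgt (le_lt_trans ca ay).
    rewrite integral_itv_obnd_cbnd//.
    apply/measurable_EFinP/measurable_funTS/measurable_funM.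
      by apply: continuous_measurable_fun; exact: profile_continuous2 H.
    apply: measurable_Ncdf_v; first exact: measurable_cst.
    apply: continuous_measurable_fun => y.
    exact: is_derive_continuous (profile_derive2 H y).
  by move=> y /andP[ay yz]; apply: (profile_bounds2 H); rewrite (le_trans ca)// (le_trans yz).
have [zc|cz] := leP z c; first by rewrite (p1 a z a0 az zc) /glue zc (le_trans az zc).
have [ac|ca] := leP a c; last first.
  transitivity (\int[leb]_(y in `]a, z]) (b y * Ncdf_v beta m u (B y))%:E)%E.
    by apply/esym/integral_itv_obnd_cbnd; exact: measurable_funTS.
  by rewrite (p2 a z (ltW ca) az z1) /glue !leNgt ca cz.
rewrite (@integral_itv_split _ _ a c z) ?ac ?ltW//.
rewrite (p1 a c a0 ac (lexx c)) (p2 c z (lexx c) (ltW cz) z1) -EFinD; congr EFin.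
by rewrite (profile_c H) /glue ac leNgt cz/=; ring.
Qed.

End profile.

Section bounds.
Context {R : realType}.

Lemma xl_abs_le (x : R) : 0 <= x -> `|xl x| <= 2 + x ^+ 2.
Proof.
move=> x0; have [x1|x1] := leP x 1.
  apply: (le_trans (xl_bound x1)).
  have : Num.sqrt x <= 1 by rewrite -[leRHS]sqrtr1 ler_sqrt.
  by have := sqr_ge0 x; lra.
have xp : 0 < x by apply: lt_trans x1.
have l0 : 0 <= ln x by rewrite ln_ge0// ltW.
have l1 : x * ln x <= x * x by rewrite ler_wpM2l// ltW// ln_sublinear.
by rewrite /xl ger0_norm ?mulr_ge0// expr2; lra.
Qed.

Lemma pb_le (beta s t y0 y1 y : R) : 0 <= s -> 0 <= t -> y0 < y1 ->
  pb1 beta s t y0 y1 y <= (s + t) / (y1 - y0) /\ pb2 beta s t y0 y1 y <= (s + t) / (y1 - y0).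
Proof.
move=> s0 t0 y01; have [M0|M0] := eqVneq (s + t) 0.
  by rewrite /pb1 /pb2 M0 !mul0r lexx.
have M0' := sum_gt0 s0 t0 M0.
have r := rateD beta s0 t0 M0' (lin (s + t) y0 y1 y).
have r1 := rate1_ge0 beta s0 t0 (lin (s + t) y0 y1 y).
have r2 := rate2_ge0 beta s0 t0 (lin (s + t) y0 y1 y).
have c0 : 0 <= (s + t) / (y1 - y0) by apply: divr_ge0; [exact: addr_ge0|rewrite subr_ge0 ltW].
by split; rewrite /pb1 /pb2 ler_piMr// -r ?lerDl ?lerDr.
Qed.

Lemma pb1_le (beta s t y0 y1 y : R) : 0 <= s -> 0 <= t -> y0 < y1 ->
  pb1 beta s t y0 y1 y <= (s + t) / (y1 - y0).
Proof. by move=> s0 t0 y01; have [] := pb_le beta y s0 t0 y01. Qed.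

Lemma pb2_le (beta s t y0 y1 y : R) : 0 <= s -> 0 <= t -> y0 < y1 ->
  pb2 beta s t y0 y1 y <= (s + t) / (y1 - y0).
Proof. by move=> s0 t0 y01; have [] := pb_le beta y s0 t0 y01. Qed.

(** For [m > 0], [Qchi m = m ln ([m] / m) - Fpress m], so the bracket cancels; for [m = 0] every
    term is 0. *)
Lemma Qchi_mass (beta m w : R) : 0 <= m -> 0 < w ->
  ln (m / w / brk beta m) * m + Qchi beta m = - (m * ln w) - Fpress beta m.
Proof.
rewrite le_eqVlt => /predU1P[<- w0|m0 w0].
  by rewrite Qchi0 Fpress0 mulr0 mul0r oppr0 !addr0.
have Bp := brk_gt0 beta m0.
rewrite ln_div ?posrE ?divr_gt0// ln_div ?posrE// /Qchi phi_brk//; ring.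
Qed.

End bounds.

(** * Construction of the minimizer and its rate *)

Section minimizer.
Context {R : realType}.
Variables (beta th1 th2 t00 t01 t10 t11 : R).
Hypotheses (h1 : 0 < th1 < 1) (h2 : 0 < th2 < 1).
Hypotheses (p00 : 0 <= t00) (p01 : 0 <= t01) (p10 : 0 <= t10) (p11 : 0 <= t11).
Hypothesis t_sum : t00 + t01 + (t10 + t11) = 1.

Local Notation T2 := (measurableTypeR R * measurableTypeR R)%type.
Local Notation leb := (@lebesgue_measure R).

Let th1_gt0 : 0 < th1. Proof. by case/andP: h1. Qed.
Let th1_lt1 : th1 < 1. Proof. by case/andP: h1. Qed.
Let th2_gt0 : 0 < th2. Proof. by case/andP: h2. Qed.
Let th2_lt1 : th2 < 1. Proof. by case/andP: h2. Qed.

Local Notation m0 := (t00 + t01).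
Local Notation m1 := (t10 + t11).

Let m0_ge0 : 0 <= m0. Proof. exact: addr_ge0. Qed.
Let m1_ge0 : 0 <= m1. Proof. exact: addr_ge0. Qed.

Local Notation b01 := (pb1 beta t00 t10 0 th2).
Local Notation b02 := (pb1 beta t01 t11 th2 1).
Local Notation B01 := (pB1 beta t00 t10 0 th2).
Local Notation B02 := (fun y : R => t00 + pB1 beta t01 t11 th2 1 y).
Local Notation b11 := (pb2 beta t00 t10 0 th2).
Local Notation b12 := (pb2 beta t01 t11 th2 1).
Local Notation B11 := (pB2 beta t00 t10 0 th2).
Local Notation B12 := (fun y : R => t10 + pB2 beta t01 t11 th2 1 y).

(** Index 0 is the left vertical strip, 1 the right one. Above [th2] the distribution functions
    start from the masses [t00] and [t10] already collected below. *)
Definition dens0 : R -> R := glue th2 b01 b02.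
Definition cdf0 : R -> R := glue th2 B01 B02.
Definition dens1 : R -> R := glue th2 b11 b12.
Definition cdf1 : R -> R := glue th2 B11 B12.

Let is_derive_offset (o : R) (B b : R -> R) : (forall y : R, is_derive y (1 : R) B (b y)) ->
  forall y : R, is_derive y (1 : R) (fun y => o + B y) (b y).
Proof.
move=> dB y; have e := is_deriveD (is_derive_cst o y (1 : R)) (dB y).
by apply: (is_derive_eq e); rewrite add0r.
Qed.

Lemma profile_left : profile m0 th2 b01 b02 B01 B02.
Proof.
have [e0 _] := pB_y0 beta 0 th2 p00 p10; have [e1 _] := pB_y1 beta p00 p10 th2_gt0.
have [f0 _] := pB_y0 beta th2 1 p01 p11; have [f1 _] := pB_y1 beta p01 p11 th2_lt1.
split.
- by move=> y; exact: is_derive_pB1.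
- by apply: is_derive_offset => y; exact: is_derive_pB1.
- exact: continuous_pb1.
- exact: continuous_pb1.
- by move=> y; split; exact: pb1_ge0.
- exact: e0.
- by rewrite e1 f0 addr0.
- by rewrite f1.
- move=> y /(pB_bounds beta p00 p10 th2_gt0) /andP[/andP[-> /= h] _].
  by rewrite (le_trans h)// lerDl.
- move=> y /(pB_bounds beta p01 p11 th2_lt1) /andP[/andP[g h] _].
  by rewrite addr_ge0//= lerD2l.
- by move=> y; exact: pB1_gt0.
- by move=> y yb nz; rewrite ltr_wpDl// (pB1_gt0 p01 p11 th2_lt1 yb).
- move=> mz; have s0 : t00 = 0 by move: mz p00 p01; lra.
  have s1 : t01 = 0 by move: mz p00 p01; lra.
  by move=> y; rewrite /pb1 /rate1 /pathP s0 s1 brk0 !(mulr0, mul0r).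
Qed.

Lemma profile_right : profile m1 th2 b11 b12 B11 B12.
Proof.
have [_ e0] := pB_y0 beta 0 th2 p00 p10; have [_ e1] := pB_y1 beta p00 p10 th2_gt0.
have [_ f0] := pB_y0 beta th2 1 p01 p11; have [_ f1] := pB_y1 beta p01 p11 th2_lt1.
split.
- by move=> y; exact: is_derive_pB2.
- by apply: is_derive_offset => y; exact: is_derive_pB2.
- exact: continuous_pb2.
- exact: continuous_pb2.
- by move=> y; split; exact: pb2_ge0.
- exact: e0.
- by rewrite e1 f0 addr0.
- by rewrite f1.
- move=> y /(pB_bounds beta p00 p10 th2_gt0) /andP[_ /andP[-> /= h]].
  by rewrite (le_trans h)// lerDl.
- move=> y /(pB_bounds beta p01 p11 th2_lt1) /andP[_ /andP[g h]].
  by rewrite addr_ge0//= lerD2l.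
- by move=> y; exact: pB2_gt0.
- by move=> y yb nz; rewrite ltr_wpDl// (pB2_gt0 p01 p11 th2_lt1 yb).
- move=> mz; have s0 : t10 = 0 by move: mz p10 p11; lra.
  have s1 : t11 = 0 by move: mz p10 p11; lra.
  by move=> y; rewrite /pb2 /rate2 /pathQ s0 s1 brk0 !(mulr0, mul0r).
Qed.

Local Notation left_density z := (strip_density beta m0 0 th1 (cdf0 z.2) (dens0 z.2) z.1).
Local Notation right_density z := (strip_density beta m1 th1 1 (cdf1 z.2) (dens1 z.2) z.1).

Definition min_density (z : R * R) : R :=
  if z.1 <= th1 then left_density z else right_density z.

Local Notation g := min_density.

Let dens0_ge0 y : 0 <= dens0 y. Proof. exact: glue_ge0 profile_left y. Qed.
Let dens1_ge0 y : 0 <= dens1 y. Proof. exact: glue_ge0 profile_right y. Qed.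

Let cdf0_bounds y : 0 <= y <= 1 -> 0 <= cdf0 y <= m0.
Proof. by move=> h; exact: (glue_bounds profile_left h). Qed.
Let cdf1_bounds y : 0 <= y <= 1 -> 0 <= cdf1 y <= m1.
Proof. by move=> h; exact: (glue_bounds profile_right h). Qed.
Let m0_gt0 y : dens0 y != 0 -> 0 < m0.
Proof. by move=> h; exact: (glue_m_gt0 m0_ge0 profile_left h). Qed.
Let m1_gt0 y : dens1 y != 0 -> 0 < m1.
Proof. by move=> h; exact: (glue_m_gt0 m1_ge0 profile_right h). Qed.

Let mb0 : measurable_fun [set: R] dens0. Proof. exact: measurable_profile_density profile_left. Qed.
Let mb1 : measurable_fun [set: R] dens1. Proof. exact: measurable_profile_density profile_right. Qed.
Let mB0 : measurable_fun [set: R] cdf0. Proof. exact: measurable_profile_cdf profile_left. Qed.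
Let mB1 : measurable_fun [set: R] cdf1. Proof. exact: measurable_profile_cdf profile_right. Qed.

Lemma min_density_ge0 z : 0 <= g z.
Proof.
rewrite /min_density; case: ifP => _; apply: strip_density_ge0 => //.
Qed.

Lemma measurable_min_density : measurable_fun [set: T2] g.
Proof.
apply: measurable_fun_ifT.
- by apply: measurable_fun_ler => //; exact: measurable_cst.
- apply: (@measurable_strip_density _ _ T2) => //.
    exact: (@measurableT_comp _ _ _ _ _ _ cdf0 _ snd).
  exact: (@measurableT_comp _ _ _ _ _ _ dens0 _ snd).
- apply: (@measurable_strip_density _ _ T2) => //.
    exact: (@measurableT_comp _ _ _ _ _ _ cdf1 _ snd).
  exact: (@measurableT_comp _ _ _ _ _ _ dens1 _ snd).
Qed.

Let measurable_row y : measurable_fun [set: R] (fun x => (g (x, y))%:E).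
Proof.
have mg : measurable_fun [set: T2] (EFin \o g) by apply/measurable_EFinP; exact: measurable_min_density.
by apply: (@measurableT_comp _ _ _ _ _ _ (EFin \o g) _ (fun x => (x, y))).
Qed.

Local Notation C0 := (lin m0 0 th1).
Local Notation C1 := (lin m1 th1 1).

Let row_left x y : 0 <= y <= 1 -> 0 <= x <= th1 ->
  (\int[leb]_(z in `[0%R, x]) (g (z, y))%:E)%E = (dens0 y * Ncdf_v beta m0 (C0 x) (cdf0 y))%:E.
Proof.
move=> yb xb; rewrite -strip_density_integral//; [|exact: cdf0_bounds|exact: m0_gt0].
apply: eq_integral => z; rewrite inE/= in_itv/= => /andP[_ zx].
by rewrite /min_density/= (le_trans zx)//; case/andP: xb.
Qed.

Let measurable_right_row y : measurable_fun [set: R] (fun x => (right_density (x, y))%:E).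
Proof.
apply/measurable_EFinP.
by apply: (@measurable_strip_density _ _ R beta m1 th1 1 id (cst (cdf1 y)) (cst (dens1 y))).
Qed.

Let row_right x y : 0 <= y <= 1 -> th1 <= x <= 1 ->
  (\int[leb]_(z in `]th1, x]) (g (z, y))%:E)%E = (dens1 y * Ncdf_v beta m1 (C1 x) (cdf1 y))%:E.
Proof.
move=> yb xb; rewrite -strip_density_integral//; [|exact: cdf1_bounds|exact: m1_gt0].
transitivity (\int[leb]_(z in `]th1, x]) (right_density (z, y))%:E)%E.
  apply: eq_integral => z; rewrite inE/= in_itv/= => /andP[zx _].
  by rewrite /min_density/= leNgt zx.
by apply: integral_itv_obnd_cbnd; exact: measurable_funTS (measurable_right_row y).
Qed.

Let left_cdf u a z bb : 0 <= u <= m0 -> 0 <= a -> a <= z -> z <= 1 ->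
  (\int[leb]_(y in [set` Interval (BSide bb a) (BRight z)])
    (dens0 y * Ncdf_v beta m0 u (cdf0 y))%:E)%E = (Ncdf beta m0 u (cdf0 z) - Ncdf beta m0 u (cdf0 a))%:E.
Proof. exact: (profile_cdf beta m0_ge0 profile_left). Qed.

Let right_cdf u a z bb : 0 <= u <= m1 -> 0 <= a -> a <= z -> z <= 1 ->
  (\int[leb]_(y in [set` Interval (BSide bb a) (BRight z)])
    (dens1 y * Ncdf_v beta m1 u (cdf1 y))%:E)%E = (Ncdf beta m1 u (cdf1 z) - Ncdf beta m1 u (cdf1 a))%:E.
Proof. exact: (profile_cdf beta m1_ge0 profile_right). Qed.

Let Ncdf_top m u : 0 <= u <= m -> Ncdf beta m u m = u.
Proof.
move=> /andP[u0 um]; have [mz|mn] := eqVneq m 0.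
  have -> : u = 0 by move: u0 um; rewrite mz; lra.
  by rewrite mz Ncdf_0.
by apply: Ncdf_m; rewrite lt_def mn (le_trans u0).
Qed.

Let cdf0_0 : cdf0 0 = 0. Proof. exact: (glue0 h2 profile_left). Qed.
Let cdf1_0 : cdf1 0 = 0. Proof. exact: (glue0 h2 profile_right). Qed.
Let cdf0_1 : cdf0 1 = m0. Proof. exact: (glue1 h2 profile_left). Qed.
Let cdf1_1 : cdf1 1 = m1. Proof. exact: (glue1 h2 profile_right). Qed.

Let cdf0_th : cdf0 th2 = t00.
Proof. by rewrite /cdf0 /glue lexx; have [] := pB_y1 beta p00 p10 th2_gt0. Qed.
Let cdf1_th : cdf1 th2 = t10.
Proof. by rewrite /cdf1 /glue lexx; have [] := pB_y1 beta p00 p10 th2_gt0. Qed.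

Let C0_bounds x : 0 <= x <= th1 -> 0 <= C0 x <= m0.
Proof.
move=> xb; have [mz|mn] := eqVneq m0 0; first by rewrite /lin mz mul0r mulr0 lexx.
by apply: lin_bounds => //; rewrite lt_def mn m0_ge0.
Qed.

Let C1_bounds x : th1 <= x <= 1 -> 0 <= C1 x <= m1.
Proof.
move=> xb; have [mz|mn] := eqVneq m1 0; first by rewrite /lin mz mul0r mulr0 lexx.
by apply: lin_bounds => //; rewrite lt_def mn m1_ge0.
Qed.

Let mass (X Y : set R) : measurable X -> measurable Y ->
  (\int[lambda2]_(z in X `*` Y) (g z)%:E =
   \int[leb]_(y in Y `&` `[0%R, 1%R]) \int[leb]_(x in X `&` `[0%R, 1%R]) (g (x, y))%:E)%E.
Proof.
move=> mX mY; apply: integral_rectangle => //.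
- exact: measurable_min_density.
- exact: min_density_ge0.
Qed.

Let row_full x y : 0 <= y <= 1 -> th1 <= x <= 1 ->
  (\int[leb]_(z in `[0%R, x]) (g (z, y))%:E = (dens0 y * Ncdf_v beta m0 m0 (cdf0 y))%:E +
    (dens1 y * Ncdf_v beta m1 (C1 x) (cdf1 y))%:E)%E.
Proof.
move=> yb xb; have [t1x _] := andP xb.
rewrite (@integral_itv_split _ _ 0 th1 x) ?(ltW th1_gt0)//.
have h : 0 <= th1 <= th1 by apply/andP; split => //; exact: ltW.
by rewrite (row_left yb h) (row_right yb xb) lin_x1.
Qed.

Let column_sum u v a z bb : 0 <= u <= m0 -> 0 <= v <= m1 -> 0 <= a -> a <= z -> z <= 1 ->
  (\int[leb]_(y in [set` Interval (BSide bb a) (BRight z)])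
    ((dens0 y * Ncdf_v beta m0 u (cdf0 y))%:E + (dens1 y * Ncdf_v beta m1 v (cdf1 y))%:E))%E =
  (Ncdf beta m0 u (cdf0 z) - Ncdf beta m0 u (cdf0 a) +
   (Ncdf beta m1 v (cdf1 z) - Ncdf beta m1 v (cdf1 a)))%:E.
Proof.
move=> ub vb a0 az z1.
have yb y : y \in Interval (BSide bb a) (BRight z) -> 0 <= y <= 1.
  rewrite in_itv/= => /andP[ay yz]; rewrite (le_trans yz z1) andbT (le_trans a0)//.
  by case: bb ay => //= /ltW.
have r0 m u' v' : 0 <= u' <= m -> 0 <= v' <= m -> 0 <= Ncdf_v beta m u' v'.
  move=> /[dup] ub' /andP[u0 um] vb'; have [mz|mn] := eqVneq m 0.
    by rewrite /Ncdf_v mz brk0 mul0r invr0 mulr0.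
  have mp : 0 < m by rewrite lt_def mn (le_trans u0).
  apply: divr_ge0; first by rewrite mulr_ge0 ?expR_ge0 ?brk_ge0.
  by apply: mulr_ge0; [rewrite brk_ge0// ltW|rewrite ltW// den_gt0].
rewrite ge0_integralD//.
- by rewrite left_cdf// right_cdf// -EFinD.
- by move=> y /yb yy; rewrite lee_fin mulr_ge0// r0// cdf0_bounds.
- apply/measurable_EFinP/measurable_funTS; exact: (measurable_profile_row beta profile_left).
- by move=> y /yb yy; rewrite lee_fin mulr_ge0// r0// cdf1_bounds.
- apply/measurable_EFinP/measurable_funTS; exact: (measurable_profile_row beta profile_right).
Qed.

Let total_mass :
  (\int[leb]_(y in `[0%R, 1%R]) \int[leb]_(x in `[0%R, 1%R]) (g (x, y))%:E = 1)%E.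
Proof.
transitivity (\int[leb]_(y in `[0%R, 1%R]) ((dens0 y * Ncdf_v beta m0 m0 (cdf0 y))%:E +
    (dens1 y * Ncdf_v beta m1 m1 (cdf1 y))%:E))%E.
  apply: eq_integral => y; rewrite inE/= in_itv/= => yb.
  have h : (th1 <= (1 : R)) && ((1 : R) <= 1) by rewrite (ltW th1_lt1) lexx.
  by rewrite (row_full yb h) lin_x1.
rewrite column_sum ?lexx ?m0_ge0 ?m1_ge0//.
rewrite cdf0_0 cdf1_0 cdf0_1 cdf1_1 !Ncdf_0 !Ncdf_top ?lexx ?m0_ge0 ?m1_ge0//.
by rewrite !subr0 t_sum.
Qed.

Lemma min_density_mass1 : (\int[lambda2]_z (g z)%:E = 1)%E.
Proof. by rewrite -setXTT mass// !setTI. Qed.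

Variable nu : prob2 R.
Hypothesis nuE : forall A, nu A = (\int[lambda2]_(z in A) (g z)%:E)%E.

(** Over the full width of a strip [N(m, v) = v], so each block mass is an increment of [cdf0] or
    [cdf1] between two of the heights 0, [th2] and 1. *)
Lemma minimizer_Lambda (t : 'M[R]_2) :
  t 0 0 = t00 -> t 0 1 = t01 -> t 1 0 = t10 -> t 1 1 = t11 ->
  forall i j, nu (Lambda th1 th2 i j) = (t i j)%:E.
Proof.
move=> e00 e01 e10 e11.
have L (i : 'I_2) (th : R) : 0 < th < 1 -> Lpart i th `&` `[0, 1] = Lpart i th.
  move=> /andP[a b]; apply: setIidl => x; rewrite /Lpart; case: ifP => _; rewrite /= !in_itv/=.
    by move=> /andP[-> xt]; rewrite (le_trans xt (ltW b)).
  by move=> /andP[tx ->]; rewrite (ltW (lt_trans a tx)).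
have row i : i = 0 \/ i = 1 :> 'I_2.
  by case: i => [[|[|//]] ?]; [left|right]; exact/val_inj.
move=> i j; rewrite nuE /Lambda mass; [|exact: measurable_Lpart..].
rewrite !L//; have [->|->] := row i; have [->|->] := row j; rewrite /Lpart/=.
- transitivity (\int[leb]_(y in `[0%R, th2]) (dens0 y * Ncdf_v beta m0 m0 (cdf0 y))%:E)%E.
    apply: eq_integral => y; rewrite inE/= in_itv/= => /andP[y0 yt].
    by rewrite row_left ?lin_x1 ?y0 ?lexx ?ltW// (le_lt_trans yt).
  rewrite left_cdf ?lexx ?m0_ge0 ?ltW// cdf0_0 Ncdf_0 subr0 NcdfC cdf0_th Ncdf_top ?e00//.
  by rewrite p00 lerDl.
- transitivity (\int[leb]_(y in `]th2, 1%R]) (dens0 y * Ncdf_v beta m0 m0 (cdf0 y))%:E)%E.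
    apply: eq_integral => y; rewrite inE/= in_itv/= => /andP[y0 yt].
    by rewrite row_left ?lin_x1 ?yt ?lexx ?ltW// (lt_trans th2_gt0).
  rewrite left_cdf ?lexx ?m0_ge0 ?ltW// cdf0_1 cdf0_th !(NcdfC _ m0 m0) !Ncdf_top ?e01 ?lexx ?m0_ge0//.
    by congr EFin; ring.
  by rewrite p00 lerDl.
- transitivity (\int[leb]_(y in `[0%R, th2]) (dens1 y * Ncdf_v beta m1 m1 (cdf1 y))%:E)%E.
    apply: eq_integral => y; rewrite inE/= in_itv/= => /andP[y0 yt].
    by rewrite row_right ?lin_x1 ?y0 ?lexx ?ltW// (le_lt_trans yt).
  rewrite right_cdf ?lexx ?m1_ge0 ?ltW// cdf1_0 Ncdf_0 subr0 NcdfC cdf1_th Ncdf_top ?e10//.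
  by rewrite p10 lerDl.
- transitivity (\int[leb]_(y in `]th2, 1%R]) (dens1 y * Ncdf_v beta m1 m1 (cdf1 y))%:E)%E.
    apply: eq_integral => y; rewrite inE/= in_itv/= => /andP[y0 yt].
    by rewrite row_right ?lin_x1 ?yt ?lexx ?ltW// (lt_trans th2_gt0).
  rewrite right_cdf ?lexx ?m1_ge0 ?ltW// cdf1_1 cdf1_th !(NcdfC _ m1 m1) !Ncdf_top ?e11 ?lexx ?m1_ge0//.
    by congr EFin; ring.
  by rewrite p10 lerDl.
Qed.

(** Mass to the upper left of [z]: within the strip of [z] it is [u - N(u, v)], and a point of the
    right strip also sees the part of the left strip above it, of mass [m0 - cdf0 z.2]. *)
Let V (z : R * R) : R :=
  if z.1 <= th1 then C0 z.1 - Ncdf beta m0 (C0 z.1) (cdf0 z.2)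
  else m0 - cdf0 z.2 + C1 z.1 - Ncdf beta m1 (C1 z.1) (cdf1 z.2).

Lemma minimizer_upper_left z : unit_square z -> nu (upper_left z) = (V z)%:E.
Proof.
case: z => x y; rewrite /unit_square/= !in_itv/= => -[xb yb].
have -> : upper_left (x, y) = `]-oo, x[ `*` `]y, +oo[.
  by apply/seteqP; split => p; rewrite /upper_left/= !in_itv/= andbT.
rewrite nuE mass; [|exact: measurable_itv..].
have -> : `]-oo, x[%classic `&` `[0, 1]%classic = `[0, x[%classic :> set R.
  apply/seteqP; split => p; rewrite /= !in_itv/=; first by move=> [-> /andP[-> _]].
  move=> /andP[-> px]; rewrite px (le_trans (ltW px))//; by case/andP: xb.
have -> : `]y, +oo[%classic `&` `[0, 1]%classic = `]y, 1]%classic :> set R.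
  apply/seteqP; split => p; rewrite /= !in_itv/= ?andbT; first by move=> [-> /andP[_ ->]].
  by move=> /andP[yp ->]; rewrite yp andbT (le_trans _ (ltW yp))//; case/andP: yb.
have mx y' : (\int[leb]_(x0 in `[0%R, x[) (g (x0, y'))%:E =
    \int[leb]_(x0 in `[0%R, x]) (g (x0, y'))%:E)%E.
  by apply: integral_itv_bndo_bndc; exact: measurable_funTS (measurable_row y').
have [y0 y1] := andP yb; have [x0 x1] := andP xb.
have yb' y' : y' \in `]y, 1] -> 0 <= y' <= 1.
  by rewrite in_itv/= => /andP[yy ->]; rewrite (le_trans y0 (ltW yy)).
rewrite /V/=; case: ifPn => xt.
  have xb' : 0 <= x <= th1 by rewrite x0.
  transitivity (\int[leb]_(y' in `]y, 1%R]) (dens0 y' * Ncdf_v beta m0 (C0 x) (cdf0 y'))%:E)%E.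
    by apply: eq_integral => y'; rewrite inE/= => /yb' yy; rewrite mx row_left.
  by rewrite left_cdf ?C0_bounds// cdf0_1 Ncdf_top// C0_bounds.
have xb' : th1 <= x <= 1 by rewrite x1 andbT ltW// ltNge.
transitivity (\int[leb]_(y' in `]y, 1%R]) ((dens0 y' * Ncdf_v beta m0 m0 (cdf0 y'))%:E +
    (dens1 y' * Ncdf_v beta m1 (C1 x) (cdf1 y'))%:E))%E.
  by apply: eq_integral => y'; rewrite inE/= => /yb' yy; rewrite mx row_full.
rewrite column_sum ?C1_bounds ?m0_ge0 ?lexx// cdf0_1 cdf1_1.
rewrite !(NcdfC _ m0 m0) !Ncdf_top ?C1_bounds ?cdf0_bounds ?m0_ge0 ?lexx//.
by congr EFin; ring.
Qed.

Lemma minimizer_on_unit_square : on_unit_square nu.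
Proof.
rewrite /on_unit_square/= nuE /unit_square mass; [|exact: measurable_itv..].
by rewrite !setIid.
Qed.

(** Boundedness makes the entropy and energy integrands integrable, which allows the rate to be
    split and computed by iterated integrals. *)
Lemma min_density_le : exists M, forall z, unit_square z -> g z <= M.
Proof.
pose K := (t00 + t10) / (th2 - 0) + (t01 + t11) / (1 - th2).
have s1 : 0 <= (t00 + t10) / (th2 - 0) by apply: divr_ge0; [exact: addr_ge0|rewrite subr0 ltW].
have s2 : 0 <= (t01 + t11) / (1 - th2) by apply: divr_ge0; [exact: addr_ge0|rewrite subr_ge0 ltW].
have b0K y : dens0 y <= K.
  rewrite /dens0 /glue; case: ifP => _; rewrite (le_trans (pb1_le _ _ _ _ _))//.
    by rewrite lerDl.
  by rewrite lerDr.
have b1K y : dens1 y <= K.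
  rewrite /dens1 /glue; case: ifP => _; rewrite (le_trans (pb2_le _ _ _ _ _))//.
    by rewrite lerDl.
  by rewrite lerDr.
pose M m x0 x1 : R := m / (x1 - x0) * (expR (`|beta| * (2 * m)) /
    (brk beta m * expR (- `|beta| * m) ^+ 2)) * K.
exists (Num.max (M m0 0 th1) (M m1 th1 1)).
move=> [x y]; rewrite /unit_square/= !in_itv/= => -[/andP[x0 x1] yb].
rewrite /min_density/= le_max; case: ifPn => xt.
  by rewrite strip_density_le ?cdf0_bounds ?x0//; exact: m0_gt0.
rewrite orbC strip_density_le ?cdf1_bounds ?x1 ?andbT//; first exact: m1_gt0.
by rewrite ltW// ltNge.
Qed.

(** Equal to [V] on the square; being read off from [nu], it is measurable and at most 1 on the
    whole plane. *)
Let V' (z : R * R) : R := fine (nu (upper_left z)).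

Let V'E z : nu (upper_left z) = (V' z)%:E.
Proof. by rewrite /V' fineK// fin_num_measure//; exact: measurable_upper_left. Qed.

Let V'_bounds z : 0 <= V' z <= 1.
Proof.
rewrite -!lee_fin -V'E measure_ge0/=; apply: probability_le1; exact: measurable_upper_left.
Qed.

Let measurable_V' : measurable_fun [set: T2] V'.
Proof. by apply: measurableT_comp => //; exact: measurable_upper_left_mass. Qed.

Let xg z := xl (g z).
Let Vg z := V' z * g z.

Let measurable_xg : measurable_fun [set: T2] xg.
Proof.
apply: measurableT_comp; last exact: measurable_min_density.
by apply: continuous_measurable_fun; exact: continuous_xl.
Qed.

Let measurable_Vg : measurable_fun [set: T2] Vg.
Proof. by apply: measurable_funM => //; exact: measurable_min_density. Qed.

Let integrable_xg : lambda2.-integrable [set: T2] (EFin \o xg).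
Proof.
have [M gM] := min_density_le.
apply: (@integrable_lambda2 _ _ (2 + M ^+ 2)) => // z /gM gz.
apply: (le_trans (xl_abs_le (min_density_ge0 z))).
by rewrite lerD2l lerXn2r ?nnegrE ?min_density_ge0// (le_trans (min_density_ge0 z)).
Qed.

Let integrable_Vg : lambda2.-integrable [set: T2] (EFin \o Vg).
Proof.
have [M gM] := min_density_le.
apply: (@integrable_lambda2 _ _ M) => // z /gM gz.
have /andP[v0 v1] := V'_bounds z; have g0 := min_density_ge0 z.
by rewrite /Vg ger0_norm ?mulr_ge0// (le_trans _ gz)// ler_piMl.
Qed.

Lemma rate_minimizerE :
  rate beta nu = ((\int[lambda2]_z (xg z + beta * Vg z)%:E) + (pressure beta)%:E)%E.
Proof.
have mg := measurable_min_density; have g0 := min_density_ge0.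
have nuE' A : measurable A -> nu A = (\int[lambda2]_(z in A) (g z)%:E)%E by move=> _.
rewrite /rate /rel_entropy asboolT; last exact: (@density_dominates _ _ _ lambda2 nu g mg nuE').
rewrite oppeK (@integral_lne_density _ _ _ lambda2 nu g mg g0 nuE').
rewrite energyE; last exact: minimizer_on_unit_square.
congr (_ + _)%E.
rewrite (@density_change_of_variables_signed _ _ _ lambda2 nu g mg g0 nuE'); last first.
  by apply/measurable_EFinP; apply: measurableT_comp => //; exact: measurable_ln.
rewrite (@density_change_of_variables_signed _ _ _ lambda2 nu g mg g0 nuE'); last first.
  exact: measurable_upper_left_mass.
transitivity (\int[lambda2]_z (xg z)%:E + beta%:E * \int[lambda2]_z (Vg z)%:E)%E.
  congr (_ + _ * _)%E; apply: eq_integral => z _.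
    by rewrite -EFinM mulrC.
  by rewrite V'E -EFinM.
have iV : lambda2.-integrable [set: T2] (fun z => beta%:E * (EFin \o Vg) z)%E.
  exact: integrableZl.
rewrite -integralZl//; exact: esym (integralD measurableT integrable_xg iV).
Qed.

Let k0 := ln (m0 / (th1 - 0) / brk beta m0).
Let k1 := ln (m1 / (1 - th1) / brk beta m1).

Let row_cost (y : R) : R :=
  (dens0 y * k0 + xl (dens0 y) + dens0 y * chi beta (cdf0 y)) +
  (dens1 y * k1 + xl (dens1 y) + dens1 y * chi beta (cdf1 y) + beta * (m0 - cdf0 y) * dens1 y).

(** The line [y = 0] is excluded: there a distribution function can vanish while its density does
    not, and [strip_cost_integral] asks for [0 < v]. *)
Let row_costE y : 0 < y <= 1 ->
  (\int[leb]_(x in `[0%R, 1%R]) (xg (x, y) + beta * Vg (x, y))%:E)%E = (row_cost y)%:E.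
Proof.
move=> /andP[y0 y1]; have yb : 0 <= y <= 1 by rewrite ltW.
have mrow : measurable_fun [set: R] (fun x => (xg (x, y) + beta * Vg (x, y))%:E).
  have m : measurable_fun [set: T2] (fun z => (xg z + beta * Vg z)%:E).
    apply/measurable_EFinP; apply: measurable_funD => //.
    by apply: measurable_funM => //; exact: measurable_cst.
  by apply: (@measurableT_comp _ _ _ _ _ _ (fun z => (xg z + beta * Vg z)%:E) _ (fun x => (x, y))).
rewrite (@integral_itv_split _ _ 0 th1 1) ?(ltW th1_gt0) ?(ltW th1_lt1)//.
(* Nothing lies to the left of the left strip, hence the offset 0. *)
have -> : (\int[leb]_(x in `[0%R, th1]) (xg (x, y) + beta * Vg (x, y))%:E)%E =
    (dens0 y * k0 + xl (dens0 y) + dens0 y * chi beta (cdf0 y) + beta * 0 * dens0 y)%:E.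
  rewrite -(strip_cost_integral beta th1_gt0 (dens0_ge0 y) (cdf0_bounds yb) (@m0_gt0 y)); last first.
    by move=> bn; apply: (glue_gt0 profile_left _ bn); rewrite y0.
  apply: eq_integral => x; rewrite inE/= in_itv/= => /andP[x0 xt].
  have zu : unit_square (x, y) by rewrite /unit_square/= !in_itv/= x0 (le_trans xt (ltW th1_lt1)).
  congr EFin; rewrite /xg /Vg /V' minimizer_upper_left// /V /min_density/= xt.
  by rewrite add0r.
have -> : (\int[leb]_(x in `]th1, 1%R]) (xg (x, y) + beta * Vg (x, y))%:E)%E =
    (dens1 y * k1 + xl (dens1 y) + dens1 y * chi beta (cdf1 y) + beta * (m0 - cdf0 y) * dens1 y)%:E.
  rewrite -(strip_cost_integral beta th1_lt1 (dens1_ge0 y) (cdf1_bounds yb) (@m1_gt0 y)); last first.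
    by move=> bn; apply: (glue_gt0 profile_right _ bn); rewrite y0.
  transitivity (\int[leb]_(x in `]th1, 1%R]) (xl (right_density (x, y)) +
     beta * ((m0 - cdf0 y + C1 x - Ncdf beta m1 (C1 x) (cdf1 y)) * right_density (x, y)))%:E)%E.
    apply: eq_integral => x; rewrite inE/= in_itv/= => /andP[tx x1].
    have zu : unit_square (x, y).
      by rewrite /unit_square/= !in_itv/= x1 (ltW (lt_trans th1_gt0 tx)).
    by congr EFin; rewrite /xg /Vg /V' minimizer_upper_left// /V /min_density/= leNgt tx.
  apply: integral_itv_obnd_cbnd.
  apply: (@eq_measurable_fun _ _ _ _ _ (fun x => (xg (x, y) + beta * Vg (x, y))%:E)); last first.
    exact: measurable_funTS.
  move=> x; rewrite inE/= in_itv/= => /andP[tx x1].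
  have zu : unit_square (x, y).
    by rewrite /unit_square/= !in_itv/= x1 (ltW (lt_trans th1_gt0 tx)).
  by congr EFin; rewrite /xg /Vg /V' minimizer_upper_left// /V /min_density/= leNgt tx.
by rewrite -EFinD; congr EFin; rewrite /row_cost mulr0 mul0r addr0.
Qed.

Let column_cost (s t y0 y1 o1 o2 : R) : R :=
  k0 * s + k1 * t + (Qchi beta (o1 + s) - Qchi beta o1) + (Qchi beta (o2 + t) - Qchi beta o2)
   + (Gent beta s + Gent beta t - Gent beta (s + t) + (s + t) * ln ((s + t) / (y1 - y0)))
   + beta * (m0 - o1 - s) * t.

Let measurable_row_cost : measurable_fun [set: R] row_cost.
Proof.
have mxl (f : R -> R) : measurable_fun [set: R] f -> measurable_fun [set: R] (fun y => xl (f y)).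
  by apply: measurableT_comp; apply: continuous_measurable_fun; exact: continuous_xl.
have mchi (f : R -> R) : measurable_fun [set: R] f ->
    measurable_fun [set: R] (fun y => chi beta (f y)).
  by apply: measurableT_comp; apply: continuous_measurable_fun; exact: continuous_chi.
apply: measurable_funD.
  apply: measurable_funD; last by apply: measurable_funM => //; exact: mchi.
  by apply: measurable_funD; [apply: measurable_funM => //; exact: measurable_cst|exact: mxl].
apply: measurable_funD; last first.
  apply: measurable_funM => //; apply: measurable_funM; first exact: measurable_cst.
  by apply: measurable_funB => //; exact: measurable_cst.
apply: measurable_funD; last by apply: measurable_funM => //; exact: mchi.
by apply: measurable_funD; [apply: measurable_funM => //; exact: measurable_cst|exact: mxl].
Qed.

Lemma minimizer_cost : (\int[lambda2]_z (xg z + beta * Vg z)%:E)%E =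
  (column_cost t00 t10 0 th2 0 0 + column_cost t01 t11 th2 1 t00 t10)%:E.
Proof.
have mf : measurable_fun [set: T2] (fun z => xg z + beta * Vg z).
  by apply: measurable_funD => //; apply: measurable_funM => //; exact: measurable_cst.
have intf : lambda2.-integrable [set: T2] (EFin \o (fun z => xg z + beta * Vg z)).
  have iV : lambda2.-integrable [set: T2] (fun z => beta%:E * (EFin \o Vg) z)%E.
    exact: integrableZl.
  exact: integrableD integrable_xg iV.
rewrite (integral_lambda2 mf intf).
have mrowE : measurable_fun [set: R] (EFin \o row_cost) by exact/measurable_EFinP.
(* Drops the null line [y = 0], which [row_costE] does not cover. *)
transitivity (\int[leb]_(y in `]0%R, 1%R]) (row_cost y)%:E)%E.
  rewrite -integral_itv_obnd_cbnd; last first.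
    apply: (@eq_measurable_fun _ _ _ _ _ (EFin \o row_cost)); last exact: measurable_funTS.
    by move=> y; rewrite inE/= in_itv/= => yb; rewrite row_costE.
  by apply: eq_integral => y; rewrite inE/= in_itv/= => yb; rewrite row_costE.
rewrite integral_itv_obnd_cbnd; last exact: measurable_funTS.
rewrite (@integral_itv_split _ _ 0 th2 1) ?(ltW th2_gt0) ?(ltW th2_lt1)//.
rewrite EFinD; congr (_ + _)%E.
  rewrite /column_cost -piece_cost_integral//.
  apply: eq_integral => y; rewrite inE/= in_itv/= => /andP[_ yt].
  by rewrite /row_cost /dens0 /dens1 /cdf0 /cdf1 /glue yt !add0r.
rewrite /column_cost -(piece_cost_integral beta p01 p11 th2_lt1 _ _ m0 p00 p10).
transitivity (\int[leb]_(y in `]th2, 1%R])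
  ((b02 y * k0 + xl (b02 y) + b02 y * chi beta (B02 y)) +
   (b12 y * k1 + xl (b12 y) + b12 y * chi beta (B12 y) + beta * (m0 - B02 y) * b12 y))%:E)%E.
  apply: eq_integral => y; rewrite inE/= in_itv/= => /andP[yt _].
  by rewrite /row_cost /dens0 /dens1 /cdf0 /cdf1 /glue leNgt yt.
apply: integral_itv_obnd_cbnd.
apply: (@eq_measurable_fun _ _ _ _ _ (EFin \o row_cost)); last exact: measurable_funTS.
move=> y; rewrite inE/= in_itv/= => /andP[yt _].
by rewrite /row_cost /dens0 /dens1 /cdf0 /cdf1 /glue leNgt yt.
Qed.

Lemma rate_minimizer (t : 'M[R]_2) :
  t 0 0 = t00 -> t 0 1 = t01 -> t 1 0 = t10 -> t 1 1 = t11 ->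
  rate beta nu = (Phi beta th1 th2 t)%:E.
Proof.
move=> e00 e01 e10 e11; rewrite rate_minimizerE minimizer_cost -EFinD; congr EFin.
have I2 (i : 'I_2) : i = 0 \/ i = 1.
  by case: i => [[|[|//]] ?]; [left|right]; exact/val_inj.
rewrite PhiE//; last first.
  by move=> i j; have [->|->] := I2 i; have [->|->] := I2 j; rewrite ?e00 ?e01 ?e10 ?e11.
(* The [Qchi] terms telescope over the two horizontal strips to [Qchi m0 + Qchi m1], and the
   explicit [beta] terms reduce to [beta t01 t10]: in the upper strip no left mass lies above. *)
rewrite e00 e01 e10 e11 /column_cost Qchi0 !add0r !subr0.
have w1 : 0 < th1 - 0 by rewrite subr0.
have w2 : 0 < 1 - th1 by rewrite subr_gt0.
have w3 : 0 < 1 - th2 by rewrite subr_gt0.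
have q0 := Qchi_mass beta m0_ge0 w1; have q1 := Qchi_mass beta m1_ge0 w2.
rewrite -/k0 in q0; rewrite -/k1 in q1.
have -> : Qchi beta m0 = - (m0 * ln th1) - Fpress beta m0 - k0 * m0.
  by rewrite -(addKr (k0 * m0) (Qchi beta m0)) q0 subr0; ring.
have -> : Qchi beta m1 = - (m1 * ln (1 - th1)) - Fpress beta m1 - k1 * m1.
  by rewrite -(addKr (k1 * m1) (Qchi beta m1)) q1; ring.
rewrite !xl_div ?addr_ge0// /Gent; ring.
Qed.

End minimizer.

Theorem theorem3p7 (R : realType) (beta theta1 theta2 : R) (t : 'M[R]_2)
    (htheta1 : 0 < theta1 < 1) (htheta2 : 0 < theta2 < 1) (ht : Sigma4 t) :
  is_min [set rate beta nu | nu in W theta1 theta2 t]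
    (Phi beta theta1 theta2 t)%:E.
Proof.
have [tb tsum] := ht.
have t0 i j : 0 <= t i j by have /andP[] := tb i j.
have ts : t 0 0 + t 0 1 + (t 1 0 + t 1 1) = 1 by rewrite -(sum_I22 t).
have [nu nuE] := density_probability
  (measurable_min_density beta theta1 htheta2 (t0 0 0) (t0 0 1) (t0 1 0) (t0 1 1))
  (min_density_ge0 beta htheta1 htheta2 (t0 0 0) (t0 0 1) (t0 1 0) (t0 1 1))
  (min_density_mass1 beta htheta1 htheta2 (t0 0 0) (t0 0 1) (t0 1 0) (t0 1 1) ts).
split; last by move=> _ [mu muW <-]; exact: rate_ge_Phi muW.
exists nu; last exact: rate_minimizer nuE _ _ _ _ _.
split; first exact: minimizer_on_unit_square nuE.
exact: minimizer_Lambda nuE _ _ _ _ _.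
Qed.
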